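(* Let $f$ be a function satisfying the following conditions. (1) $f(-x)\neq f(x)$, i.e. $f$ is not an even function. (2) $f$ is regular (analytic) at the point $x=0$, and its Taylor series has the form $$f(x)=\sum_{k=0}^{\infty}\frac{g^{(k)}(0)}{k!}\,(-x)^k ,$$ where $(-1)^k g^{(k)}(x)$ is the $k$-th derivative of $f(x)$ (so $g^{(k)}(0)=(-1)^k f^{(k)}(0)$ for $k=0,1,2,\dots$). (3) $x^{1/2}f(x)\to 0$ as $x\to\infty$. (4) $g^{(s)}(0)$ is a regular (analytic, single-valued) function of $s$ defined on the half-plane $H(\delta)=\{s\in\mathbb{C}:\operatorname{Re}(s)\geq-\delta\}$ for some $3/4<\delta<1$, and it satisfies the growth condition $$|g^{(s)}(0)|<C\,a^{\operatorname{Re}(s)}$$ for some constants $C$ and $a>0$ and all $s\in H(\delta)$. Then, for $q>a>0$, the second-order Hankel transform $$\mathcal{H}_2[f(x)](q)=\int_0^{\infty}x f(x)J_2(qx)\,dx$$ can be presented by the absolutely and uniformly convergent series $$\begin{aligned}\mathcal{H}_2[f(x)](q)&=\frac{2}{q^2}f(0)+\frac{4}{\pi q^3}\sum_{m=0}^{\infty}(-1)^{m}\frac{\Gamma(m+5/2)\,\Gamma(m+1/2)}{\Gamma(2m+2)}\,f^{(2m+1)}(0)\left(\frac{q}{2}\right)^{-2m}\\&=\frac{2}{q^2}\sum_{k=0}^{\infty}\frac{\Gamma(k/2+2)}{\Gamma(1-k/2)\,\Gamma(k+1)}\,f^{(k)}(0)\left(\frac{q}{2}\right)^{-k}.\end{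aligned}$$
   Context: $J_\nu$ is the Bessel function of the first kind of order $\nu$, $\Gamma$ is the Gamma function, and $1/\Gamma(z)$ is taken to be $0$ when $z$ is a non-positive integer. The parameter $q$ is positive and is not assumed to be large. The notation $g^{(s)}(0)$ for complex $s$ denotes a function of the complex variable $s$ whose value at each integer $s=k\geq 0$ is $g^{(k)}(0)=(-1)^k f^{(k)}(0)$. The number $a$ in ''$q>a>0$'' is the constant $a$ of the growth condition. The integral over $[0,\infty)$ is an improper integral.
   Formalization: Uniform convergence is stated for q ≥ b for every b > a, since it fails on all of q > a (for f(x) = exp(-ax) the terms are of size √m (a/q)^(2m)); the Taylor identity is required for every real x, as otherwise f could be changed away from 0. *)

(* Defs.v *)
From Stdlib Require Import Reals Lra Lia ZArith.
From Coquelicot Require Import Coquelicot.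
Open Scope R_scope.

Definition Euler_integral (x : R) : R :=
  RInt_gen (fun t => Rpower t (x - 1) * exp (- t))
    (at_right 0) (Rbar_locally p_infty).

Fixpoint rising (x : R) (n : nat) : R :=
  match n with
  | O => 1
  | S m => rising x m * (x + INR m)
  end.

(* The least natural number n with 0 < x + n; it is 0 exactly when 0 < x. *)
Definition Gamma_shift (x : R) : nat := Z.to_nat (up (- x)).

(* Euler's integral for x > 0, continued to x <= 0 by
   Gamma (x + n) = x (x + 1) ... (x + n - 1) Gamma x.
   At the poles the value is the junk value of a division by 0. *)
Definition Gamma (x : R) : R :=
  Euler_integral (x + INR (Gamma_shift x)) / rising x (Gamma_shift x).

(* 1 / Gamma, equal to 0 at the poles of Gamma: see rGamma_pole. *)
Definition rGamma (x : R) : R :=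
  rising x (Gamma_shift x) / Euler_integral (x + INR (Gamma_shift x)).

Lemma rGamma_Rinv (x : R) : rGamma x = / Gamma x.
Proof.
unfold rGamma, Gamma, Rdiv; rewrite Rinv_mult, Rinv_inv; ring.
Qed.

Lemma Gamma_pos (x : R) : 0 < x -> Gamma x = Euler_integral x.
Proof.
intros Hx; unfold Gamma.
replace (Gamma_shift x) with O; [simpl; rewrite Rplus_0_r; field|].
unfold Gamma_shift; destruct (archimed (- x)) as [_ H].
assert (IZR (up (- x)) < 1) by lra.
apply lt_IZR in H0; lia.
Qed.

Lemma rGamma_pole (n : nat) : rGamma (- INR n) = 0.
Proof.
unfold rGamma.
replace (Gamma_shift (- INR n)) with (S n).
{ simpl rising; replace (- INR n + INR n) with 0 by ring.
  unfold Rdiv; ring. }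
unfold Gamma_shift; rewrite Ropp_involutive.
replace (up (INR n)) with (Z.of_nat n + 1)%Z; [lia|].
apply tech_up; rewrite plus_IZR, <- INR_IZR_INZ; lra.
Qed.

(* Bessel function of the first kind of integer order n,
   J_n(x) = sum_m (-1)^m / (m! Gamma(m + n + 1)) (x/2)^(2m+n),
   with Gamma(m + n + 1) = (m + n)!. *)
Definition BesselJ (n : nat) (x : R) : R :=
  (x / 2) ^ n *
  PSeries (fun m => (-1) ^ m / (INR (fact m) * INR (fact (m + n))))
    ((x / 2) ^ 2).

Definition hankel_integrand (n : nat) (f : R -> C) (q x : R) : C :=
  (RtoC (x * BesselJ n (q * x)) * f x)%C.

Definition hankel_converges (n : nat) (f : R -> C) (q : R) : Prop :=
  ex_RInt_gen (V := C_R_NormedModule) (hankel_integrand n f q)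
    (at_point 0) (Rbar_locally p_infty).

Definition hankel (n : nat) (f : R -> C) (q : R) : C :=
  RInt_gen (V := C_R_CompleteNormedModule) (hankel_integrand n f q)
    (at_point 0) (Rbar_locally p_infty).

(* Analyticity at a point as local expansion in a power series, both for
   functions of a real variable (K = R) and of a complex one (K = C). *)
Definition analytic_at {K : AbsRing} {V : NormedModule K}
    (h : K -> V) (z0 : K) : Prop :=
  exists c : nat -> V,
    locally z0 (fun z : K => is_pseries c (minus z z0) (h z)).

Definition Derive_nC (f : R -> C) (k : nat) (x : R) : C :=
  (Derive_n (fun y => Re (f y)) k x, Derive_n (fun y => Im (f y)) k x).

(* g^(k) is given by (-1)^k g^(k) = f^(k). *)
Definition g_der (f : R -> C) (k : nat) (x : R) : C :=
  (RtoC ((-1) ^ k) * Derive_nC f k x)%C.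

Definition odd_term (f : R -> C) (m : nat) (q : R) : C :=
  (RtoC ((-1) ^ m * (Gamma (INR m + 5 / 2) * Gamma (INR m + 1 / 2)
                     / Gamma (2 * INR m + 2)))
   * Derive_nC f (2 * m + 1) 0
   * RtoC (/ (q / 2) ^ (2 * m)))%C.

Definition full_term (f : R -> C) (k : nat) (q : R) : C :=
  (RtoC (Gamma (INR k / 2 + 2) * rGamma (1 - INR k / 2) / Gamma (INR k + 1))
   * Derive_nC f k 0
   * RtoC (/ (q / 2) ^ k))%C.

Definition abs_cv_series (u : nat -> R -> C) (q : R) : Prop :=
  ex_series (fun k => Cmod (u k q)).

Definition unif_cv_series (u : nat -> R -> C) (s : R -> C) (D : R -> Prop) :
    Prop :=
  forall eps : posreal,
    eventually (fun n => forall q : R, D q ->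
      Cmod (sum_n (fun k => u k q) n - s q)%C < eps).

(* Main.v *)
Require Import Defs.
From Stdlib Require Import Reals Factorial Lra Lia Psatz ZArith Classical_Prop.
From Coquelicot Require Import Coquelicot.
Open Scope R_scope.

(** The growth condition at the integers bounds the Taylor coefficients of f by
    |f^(k)(0)| <= K a^k, so f is the restriction of an entire function of exponential type
    at most a < q.  Its real and imaginary parts are treated separately; let f be real.

    _An explicit antiderivative._  One looks for entire functions P, Q and a constant c with
      (P(x) J0(q x) + Q(x) J1(q x))' = (x f(x) + c) J2(q x).
    Since J2(y) = 2 J1(y) / y - J0(y), this amounts to Q = - (P' + x f + c) / q together with a
    second order equation for P.  For the derivatives p_k of P at 0 it reads
      p_k = - ((k + 2) f^(k)(0) + k / (k + 1) p_(k+2)) / q^2,    c = p_1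
    (hankel_coef_rec).  Iterating it upwards converges because a < q.  Now P(0) = p_0 =
    - 2 f(0) / q^2, and the integral of J2(q x) over the half-line is 1 / q, so the transform
    equals 2 f(0) / q^2 - c / q as soon as P J0 + Q J1 tends to 0 at infinity.  Unfolding the
    recurrence for c, with the values of Gamma at half-integers, gives the odd series; the full
    series adds to it the term k = 0 and, for even k >= 2, terms that vanish at the poles of
    Gamma.  Both are dominated by (k + 1) (a / b)^k for q >= b.

    _The boundary term at infinity._  As J0 and J1 are O(1 / sqrt x), it suffices that P and
    P' + x f are o(sqrt x) (prim_decay).  The function S = (P' + x f) - i q P satisfies
      S' = - i q S + G,    G = - f + V + i q x f,    V = (P' - c) / x,
    where x f = o(sqrt x) by hypothesis, but V depends on S.  A Gronwall argument gives
    S = O(x^(3/2)), whence G = O(sqrt x).  Integrating this bound would only give back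
    S = O(x^(3/2)).  What helps is that S and G have exponential type r < q, so that G cannot
    resonate with the frequency q: up to a constant factor, a bound on G over the half-line
    passes to S (linear_ode_weighted).  Hence S = O(sqrt x), then V = O(1 / sqrt x) and
    G = o(sqrt x), and a second application gives S = o(sqrt x).

    _Functions of exponential type on a half-line._  For z = - i q one has
    S = - sum_k G^(k) / z^(k+1), so one needs |G^(k)(x)| <= C (k + 1) rho^k for x >= 0 and some
    rho < q, given a bound M of |G| on the half-line and the type r < rho
    (tower_half_line_bound).  This is a Bernstein inequality, proved by Newman's contour
    argument.  The resolvent R(z, x) = sum_k G^(k)(x) / z^(k+1) converges for |z| > r and solves
    R' = z R - G.  For Re z < 0, solving this equation from 0 bounds R by M / |Re z| plus a
    constant.  For Re z > 0, solving it from infinity bounds R by M / Re z; this is legitimate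
    when Re z > r, and the bound is carried to all z with |z| > r, Re z > 0 by moving z
    horizontally with the resolvent identity (half_line_bound_right).  On the circle |z| = rho
    the function z^2 + rho^2 has modulus 2 rho |Re z|, hence (z^2 + rho^2) R is bounded there,
    and Cauchy's estimates bound G^(k) + G^(k+2) / rho^2, hence G^(k). *)

(** * Elementary real analysis *)

(** Equations between reals stated over the carrier of R seen as a normed module hide the
    ring structure of R. *)
Ltac as_real_equation := match goal with |- ?l = ?r => change (@eq R l r) end.

Lemma ex_derive_continuous_R (f : R -> R) x : ex_derive f x -> continuous f x.
Proof. apply (ex_derive_continuous (V := R_NormedModule)). Qed.

Lemma ex_series_scal_l_R (c : R) (a : nat -> R) : ex_series a -> ex_series (fun n => c * a n).
Proof. apply (ex_series_scal_l (V := R_NormedModule)). Qed.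

Lemma mean_value_le (g dg : R -> R) (x y : R) :
  x <= y -> (forall t, x <= t <= y -> is_derive g t (dg t)) ->
  (forall t, x <= t <= y -> dg t <= 0) -> g y <= g x.
Proof.
intros Hxy Hd Hle.
destruct (MVT_gen g x y dg) as [c [Hc Heq]].
- rewrite Rmin_left, Rmax_right by lra. intros t Ht; apply Hd; lra.
- rewrite Rmin_left, Rmax_right by lra. intros t Ht.
  apply continuity_pt_filterlim, (ex_derive_continuous g).
  exists (dg t); apply Hd; lra.
- rewrite Rmin_left, Rmax_right in Hc by lra.
  assert (dg c <= 0) by (apply Hle; lra). nra.
Qed.

Lemma is_derive_quadratic (F : R -> R) (x l B : R) :
  (forall y, Rabs (y - x) <= 1 ->
    Rabs (F y - F x - (y - x) * l) <= B * (y - x) ^ 2) ->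
  is_derive F x l.
Proof.
intros H. apply is_derive_Reals. intros eps Heps.
assert (HB : 0 <= B).
{ assert (H1 := H (x + 1)). replace (x + 1 - x) with 1 in H1 by ring.
  rewrite Rabs_R1 in H1. assert (H2 := H1 (Rle_refl 1)).
  assert (H3 := Rabs_pos (F (x + 1) - F x - 1 * l)). lra. }
assert (Hd : 0 < Rmin 1 (eps / (B + 1))).
{ apply Rmin_pos; [lra | apply Rdiv_lt_0_compat; lra]. }
exists (mkposreal _ Hd). simpl. intros h Hh Hlt.
assert (H1 := Rmin_l 1 (eps / (B + 1))). assert (H2 := Rmin_r 1 (eps / (B + 1))).
assert (Hq := H (x + h)). replace (x + h - x) with h in Hq by ring.
assert (H3 : Rabs h <= 1) by lra. apply Hq in H3.
replace ((F (x + h) - F x) / h - l) with ((F (x + h) - F x - h * l) / h)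
  by (field; auto).
unfold Rdiv; rewrite Rabs_mult, Rabs_inv.
assert (Hp : 0 < Rabs h) by (apply Rabs_pos_lt; auto).
apply Rle_lt_trans with (B * h ^ 2 * / Rabs h).
- apply Rmult_le_compat_r; [left; apply Rinv_0_lt_compat|]; auto.
- rewrite <- (pow2_abs h).
  replace (B * Rabs h ^ 2 * / Rabs h) with (B * Rabs h) by (field; lra).
  apply Rle_lt_trans with ((B + 1) * Rabs h); [nra|].
  replace eps with ((B + 1) * (eps / (B + 1))) by (field; lra).
  apply Rmult_lt_compat_l; lra.
Qed.

Lemma is_RInt_deriv (F dF : R -> R) (a b : R) : a <= b ->
  (forall x, a <= x <= b -> is_derive F x (dF x)) ->
  (forall x, a <= x <= b -> continuous dF x) -> is_RInt dF a b (F b - F a).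
Proof.
intros Hab H1 H2. apply (is_RInt_derive F dF); rewrite Rmin_left, Rmax_right by lra; auto.
Qed.

Lemma ex_RInt_cont (f : R -> R) a b : (forall x, continuous f x) -> ex_RInt f a b.
Proof. intros H. apply (ex_RInt_continuous (V := R_CompleteNormedModule)). auto. Qed.

Lemma exp_mono (x y : R) : x <= y -> exp x <= exp y.
Proof. intros [H| ->]; [left; apply exp_increasing; auto | apply Rle_refl]. Qed.

Lemma is_lim_seq_geom_scal (c q : R) :
  0 <= q < 1 -> is_lim_seq (fun n => c * q ^ n) 0.
Proof.
intros Hq. replace (Finite 0) with (Rbar_mult c 0).
- apply is_lim_seq_scal_l, is_lim_seq_geom. rewrite Rabs_right; lra.
- simpl. rewrite Rmult_0_r. reflexivity.
Qed.

Lemma le_of_lim_zero (a b : R) (e : nat -> R) :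
  is_lim_seq e 0 -> (forall n, a <= b + e n) -> a <= b.
Proof.
intros He H.
apply (is_lim_seq_le (fun _ => a) (fun n => b + e n) a b); auto using is_lim_seq_const.
replace (Finite b) with (Rbar_plus b 0) by (simpl; f_equal; ring).
apply is_lim_seq_plus'; auto using is_lim_seq_const.
Qed.

(** Bernoulli's inequality for b / a. *)
Lemma linear_le_geometric (a b : R) : 0 < a < b ->
  exists c, 0 < c /\ forall n, (INR n + 1) * a ^ n <= c * b ^ n.
Proof.
intros Hab. set (y := b / a - 1).
assert (Hy : 0 < y).
{ unfold y. assert (1 < b / a) by (apply Rlt_div_r; lra). lra. }
exists (1 + / y). assert (Hy' := Rinv_0_lt_compat y Hy). split; [lra|].
intros n. assert (H := poly n y Hy). assert (Hn := pos_INR n).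
assert (Ha : 0 < a ^ n) by (apply pow_lt; lra).
replace (b ^ n) with ((1 + y) ^ n * a ^ n).
2:{ rewrite <- Rpow_mult_distr. f_equal. unfold y. field. lra. }
rewrite <- Rmult_assoc. apply Rmult_le_compat_r; [lra|].
apply Rle_trans with ((1 + / y) * (1 + INR n * y)); [|apply Rmult_le_compat_l; lra].
replace ((1 + / y) * (1 + INR n * y)) with (1 + INR n * y + / y + INR n) by (field; lra).
assert (0 <= INR n * y) by nra. lra.
Qed.

(** * Complex-valued functions of a real variable *)

Definition Cderiv (u : R -> C) (x : R) (v : C) : Prop :=
  is_derive (fun t => Re (u t)) x (Re v) /\
  is_derive (fun t => Im (u t)) x (Im v).

Lemma Cmod_le_Re_Im (z : C) : Cmod z <= Rabs (Re z) + Rabs (Im z).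
Proof.
assert (H := Cmod_ge_0 z). assert (Hz := Cmod2_alt z).
assert (H1 := Rabs_pos (Re z)). assert (H2 := Rabs_pos (Im z)).
apply Rsqr_incr_0_var; [unfold Rsqr | lra].
rewrite <- (pow2_abs (Re z)), <- (pow2_abs (Im z)) in Hz. nra.
Qed.

Lemma Im_le_Cmod (z : C) : Rabs (Im z) <= Cmod z.
Proof.
assert (H := Rmax_Cmod z). unfold Im.
assert (H1 := Rmax_r (Rabs (fst z)) (Rabs (snd z))). lra.
Qed.

Lemma C_ext (z w : C) : Re z = Re w -> Im z = Im w -> z = w.
Proof. destruct z, w; simpl; intros -> ->; reflexivity. Qed.

(** Projecting on the direction of the increment reduces the vector-valued
    mean value inequality to the monotonicity of one real function. *)
Lemma Cmod_mean_value (u u' : R -> C) (psi psi' : R -> R) (x y : R) :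
  x <= y ->
  (forall t, x <= t <= y -> Cderiv u t (u' t)) ->
  (forall t, x <= t <= y -> is_derive psi t (psi' t)) ->
  (forall t, x <= t <= y -> Cmod (u' t) <= psi' t) ->
  Cmod (u y - u x) <= psi y - psi x.
Proof.
intros Hxy Hu Hpsi Hle.
set (d := (u y - u x)%C).
assert (Hm : psi x <= psi y).
{ assert (H := mean_value_le (fun t => - psi t) (fun t => - psi' t) x y Hxy).
  cut (- psi y <= - psi x); [lra|]. apply H.
  - intros t Ht. apply @is_derive_opp, Hpsi, Ht.
  - intros t Ht. assert (H0 := Hle t Ht). assert (H1 := Cmod_ge_0 (u' t)). lra. }
destruct (Req_dec (Cmod d) 0) as [E|E]; [rewrite E; lra|].
assert (Hd : 0 < Cmod d) by (assert (H := Cmod_ge_0 d); lra).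
assert (H := mean_value_le
  (fun t => Re d * Re (u t) + Im d * Im (u t) - Cmod d * psi t)
  (fun t => Re d * Re (u' t) + Im d * Im (u' t) - Cmod d * psi' t) x y Hxy).
assert (H' : Re d * Re (u y) + Im d * Im (u y) - Cmod d * psi y <=
  Re d * Re (u x) + Im d * Im (u x) - Cmod d * psi x).
{ apply H.
  - intros t Ht. destruct (Hu t Ht) as [H1 H2].
    apply @is_derive_minus; [apply @is_derive_plus|];
      apply is_derive_scal; auto.
  - intros t Ht.
    assert (H1 := Hle t Ht). assert (H2 := Cmod_ge_0 (u' t)).
    assert (H3 : Rabs (Re (Cconj d * u' t)) <= Cmod d * Cmod (u' t)).
    { rewrite <- (Cmod_conj d), <- Cmod_mult. apply re_le_Cmod. }
    assert (H4 := Rle_abs (Re (Cconj d * u' t))).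
    assert (H5 : Re (Cconj d * u' t) = Re d * Re (u' t) + Im d * Im (u' t)).
    { unfold Re, Im, Cmult, Cconj; simpl; ring. }
    nra. }
assert (Hd2 := Cmod2_alt d).
assert (Er : Re d = Re (u y) - Re (u x)) by reflexivity.
assert (Ei : Im d = Im (u y) - Im (u x)) by reflexivity.
nra.
Qed.

Lemma Cmod_lipschitz (u u' : R -> C) (B x y : R) :
  (forall t, Rmin x y <= t <= Rmax x y -> Cderiv u t (u' t)) ->
  (forall t, Rmin x y <= t <= Rmax x y -> Cmod (u' t) <= B) ->
  Cmod (u y - u x) <= B * Rabs (y - x).
Proof.
intros Hu HB.
assert (Hl : forall c t, is_derive (fun t => c * t) t c).
{ intros c t. auto_derive; auto; ring. }
destruct (Rle_dec x y) as [h|h].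
- rewrite Rmin_left, Rmax_right in Hu, HB by lra.
  rewrite Rabs_right by lra. rewrite Rmult_minus_distr_l.
  apply (Cmod_mean_value u u' (fun t => B * t) (fun _ => B)); auto.
- rewrite Rmin_right, Rmax_left in Hu, HB by lra.
  rewrite Rabs_left by lra.
  replace (B * - (y - x)) with (B * x - B * y) by ring.
  rewrite <- Cmod_opp. replace (- (u y - u x))%C with (u x - u y)%C by ring.
  apply (Cmod_mean_value u u' (fun t => B * t) (fun _ => B)); auto; lra.
Qed.

Lemma Cderiv_quadratic (u : R -> C) (x B : R) (v : C) :
  (forall y, Rabs (y - x) <= 1 ->
    Cmod (u y - u x - RtoC (y - x) * v) <= B * (y - x) ^ 2) ->
  Cderiv u x v.
Proof.
intros H; split; apply is_derive_quadratic with B; intros y Hy;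
  eapply Rle_trans; [|apply (H y Hy)| |apply (H y Hy)].
- eapply Rle_trans; [|apply re_le_Cmod]. apply Req_le; f_equal.
  unfold Re, Cminus, Cmult, Cplus, Copp, RtoC; simpl; ring.
- eapply Rle_trans; [|apply Im_le_Cmod]. apply Req_le; f_equal.
  unfold Im, Cminus, Cmult, Cplus, Copp, RtoC; simpl; ring.
Qed.

(** The function exp (- z t) of the real variable t. *)
Definition cexp_neg (z : C) (t : R) : C :=
  (exp (- (Re z * t)) * cos (Im z * t), - (exp (- (Re z * t)) * sin (Im z * t))).

Lemma Cmod_cexp_neg (z : C) (t : R) : Cmod (cexp_neg z t) = exp (- (Re z * t)).
Proof.
assert (He := exp_pos (- (Re z * t))).
assert (H : Cmod (cexp_neg z t) ^ 2 = exp (- (Re z * t)) ^ 2).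
{ rewrite Cmod2_alt. destruct z as [a b]. unfold cexp_neg, Re, Im; cbn [fst snd].
  assert (Hs := sin2_cos2 (b * t)). unfold Rsqr in Hs.
  transitivity (exp (- (a * t)) ^ 2 * (sin (b * t) * sin (b * t) +
      cos (b * t) * cos (b * t))); [ring | rewrite Hs; ring]. }
assert (H0 := Cmod_ge_0 (cexp_neg z t)). nra.
Qed.

Lemma Cderiv_cexp_neg_mult (z : C) (u : R -> C) (x : R) (v : C) :
  Cderiv u x v ->
  Cderiv (fun t => cexp_neg z t * u t)%C x (cexp_neg z x * (v - z * u x))%C.
Proof.
intros [H1 H2]; destruct z as [a b].
revert H1 H2.
set (U := fun t => Re (u t)). set (V := fun t => Im (u t)). intros H1 H2.
split.
- apply is_derive_ext with
    (fun t => exp (- (a * t)) * cos (b * t) * U t + exp (- (a * t)) * sin (b * t) * V t).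
  { intros t. as_real_equation.
    unfold U, V, cexp_neg, Cmult, Re, Im; cbn [fst snd]. ring. }
  auto_derive.
  + repeat split; eexists; eauto.
  + rewrite (is_derive_unique (fun t : R => U t) _ _ H1),
      (is_derive_unique (fun t : R => V t) _ _ H2).
    unfold U, V, cexp_neg, Cminus, Cplus, Copp, Cmult, Re, Im; cbn [fst snd]. ring.
- apply is_derive_ext with
    (fun t => exp (- (a * t)) * cos (b * t) * V t - exp (- (a * t)) * sin (b * t) * U t).
  { intros t. as_real_equation.
    unfold U, V, cexp_neg, Cmult, Re, Im; cbn [fst snd]. ring. }
  auto_derive.
  + repeat split; eexists; eauto.
  + rewrite (is_derive_unique (fun t : R => U t) _ _ H1),
      (is_derive_unique (fun t : R => V t) _ _ H2).
    unfold U, V, cexp_neg, Cminus, Cplus, Copp, Cmult, Re, Im; cbn [fst snd]. ring.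
Qed.

(** * Absolutely convergent complex series *)

Definition Cseries (a : nat -> C) : C :=
  (Series (fun j => Re (a j)), Series (fun j => Im (a j))).

Definition Cdominated (a : nat -> C) (B : nat -> R) : Prop :=
  ex_series B /\ forall j, Cmod (a j) <= B j.

Lemma Cdominated_ex (a : nat -> C) (B : nat -> R) :
  Cdominated a B ->
  ex_series (fun j => Re (a j)) /\ ex_series (fun j => Im (a j)).
Proof.
intros [HB H]; split; apply (ex_series_le (V := R_CompleteNormedModule)) with B; auto;
  intros j; eapply Rle_trans; [|apply H| |apply H].
- apply re_le_Cmod.
- apply Im_le_Cmod.
Qed.

(** As in the mean value inequality: a component-wise estimate would lose a constant,
    which the iterated resolvents below cannot afford. *)
Lemma Cseries_bound (a : nat -> C) (B : nat -> R) :
  Cdominated a B -> Cmod (Cseries a) <= Series B.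
Proof.
intros Hd. destruct (Cdominated_ex _ _ Hd) as [Hr Hi]. destruct Hd as [HB H].
set (d := Cseries a).
assert (H0 : Cmod d ^ 2 <= Cmod d * Series B).
{ rewrite Cmod2_alt.
  replace (Re d ^ 2 + Im d ^ 2) with
    (Series (fun j => Re d * Re (a j) + Im d * Im (a j))).
  2:{ rewrite Series_plus; try (apply ex_series_scal_l_R; auto).
      rewrite !Series_scal_l. change (Series (fun j => Re (a j))) with (Re d).
      change (Series (fun j => Im (a j))) with (Im d). ring. }
  rewrite <- Series_scal_l.
  assert (Hj : forall j, Rabs (Re d * Re (a j) + Im d * Im (a j)) <= Cmod d * B j).
  { intros j. replace (Re d * Re (a j) + Im d * Im (a j)) with (Re (Cconj d * a j)).
    2: unfold Re, Im, Cmult, Cconj; simpl; ring.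
    eapply Rle_trans; [apply re_le_Cmod|]. rewrite Cmod_mult, Cmod_conj.
    apply Rmult_le_compat_l; [apply Cmod_ge_0 | apply H]. }
  assert (Hs : ex_series (fun j => Cmod d * B j))
    by (apply ex_series_scal_l_R; auto).
  eapply Rle_trans; [apply Rle_abs|].
  eapply Rle_trans; [apply Series_Rabs|].
  - apply (ex_series_le (V := R_CompleteNormedModule)) with (fun j => Cmod d * B j); auto.
    intros j. unfold norm; simpl; unfold abs; simpl. rewrite Rabs_Rabsolu. apply Hj.
  - apply Series_le; auto. intros j; split; [apply Rabs_pos | apply Hj]. }
assert (Hp : 0 <= Series B).
{ rewrite <- (Rmult_0_l (Series B)), <- Series_scal_l. apply Series_le; auto.
  intros j. assert (H1 := Cmod_ge_0 (a j)). specialize (H j). split; lra. }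
assert (Hd := Cmod_ge_0 d).
destruct (Rle_dec (Cmod d) 0); [lra|]. nra.
Qed.

Lemma Cseries_incr_1 (a : nat -> C) (B : nat -> R) :
  Cdominated a B -> Cseries a = (a 0%nat + Cseries (fun j => a (S j)))%C.
Proof.
intros Hd. destruct (Cdominated_ex _ _ Hd) as [Hr Hi].
unfold Cseries. rewrite (Series_incr_1 _ Hr), (Series_incr_1 _ Hi).
reflexivity.
Qed.

Lemma Cseries_plus (a b : nat -> C) (A B : nat -> R) :
  Cdominated a A -> Cdominated b B ->
  Cseries (fun j => a j + b j)%C = (Cseries a + Cseries b)%C.
Proof.
intros Ha Hb. destruct (Cdominated_ex _ _ Ha), (Cdominated_ex _ _ Hb).
unfold Cseries, Cplus, Re, Im in *; cbn [fst snd] in *.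
rewrite !Series_plus by auto. reflexivity.
Qed.

Lemma Cseries_scal (z : C) (a : nat -> C) (A : nat -> R) :
  Cdominated a A -> Cseries (fun j => z * a j)%C = (z * Cseries a)%C.
Proof.
intros Ha. destruct (Cdominated_ex _ _ Ha) as [Hr Hi].
unfold Cseries, Cmult, Re, Im in *; cbn [fst snd] in *.
rewrite Series_minus, Series_plus;
  try (apply ex_series_scal_l_R; auto).
rewrite !Series_scal_l. reflexivity.
Qed.

Lemma Cdominated_plus (a b : nat -> C) (A B : nat -> R) :
  Cdominated a A -> Cdominated b B ->
  Cdominated (fun j => a j + b j)%C (fun j => A j + B j).
Proof.
intros [H1 H2] [H3 H4]; split.
- apply (ex_series_plus (V := R_NormedModule)); auto.
- intros j. eapply Rle_trans; [apply Cmod_triangle|]. specialize (H2 j); specialize (H4 j); lra.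
Qed.

Lemma Cdominated_scal (z : C) (a : nat -> C) (A : nat -> R) :
  Cdominated a A -> Cdominated (fun j => z * a j)%C (fun j => Cmod z * A j).
Proof.
intros [H1 H2]; split.
- apply ex_series_scal_l_R; auto.
- intros j. rewrite Cmod_mult. apply Rmult_le_compat_l; auto using Cmod_ge_0.
Qed.

(** * Derivative towers and their resolvents *)

(** A function of exponential type at most r together with all its derivatives. *)
Record tower (r K : R) (u : nat -> R -> C) : Prop := {
  tower_bound : forall k x, Cmod (u k x) <= K * r ^ k * exp (r * Rabs x);
  tower_deriv : forall k x, Cderiv (u k) x (u (S k) x) }.

Lemma tower_K_nonneg r K u : tower r K u -> 0 <= K.
Proof.
intros [H _]. specialize (H 0%nat 0). rewrite Rabs_R0, Rmult_0_r, exp_0 in H.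
assert (H1 := Cmod_ge_0 (u 0%nat 0)). simpl in H. lra.
Qed.

(** The dependence on k of this Taylor bound is r^k, which permits termwise
    differentiation of the resolvent series. *)
Lemma tower_quadratic r K u k x y :
  0 <= r -> tower r K u -> Rabs (y - x) <= 1 ->
  Cmod (u k y - u k x - RtoC (y - x) * u (S k) x) <=
  K * r ^ (S (S k)) * exp (r * (Rabs x + 1)) * (y - x) ^ 2.
Proof.
intros Hr Ht Hy. assert (HK := tower_K_nonneg _ _ _ Ht).
set (B := K * r ^ (S (S k)) * exp (r * (Rabs x + 1))).
assert (HB : 0 <= B).
{ unfold B. apply Rmult_le_pos; [|left; apply exp_pos].
  apply Rmult_le_pos; auto. apply pow_le; auto. }
assert (Hbet : forall t, Rmin x y <= t <= Rmax x y -> Rabs (t - x) <= Rabs (y - x)).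
{ intros t. destruct (Rle_dec x y).
  - rewrite Rmin_left, Rmax_right by lra. intros. rewrite !Rabs_right; lra.
  - rewrite Rmin_right, Rmax_left by lra. intros. rewrite !Rabs_left1; lra. }
assert (Hb : forall t, Rabs (t - x) <= 1 -> Cmod (u (S (S k)) t) <= B).
{ intros t H1. eapply Rle_trans; [apply (tower_bound _ _ _ Ht)|].
  apply Rmult_le_compat_l; [apply Rmult_le_pos; auto; apply pow_le; auto|].
  assert (H2 : r * Rabs t <= r * (Rabs x + 1)).
  { apply Rmult_le_compat_l; auto. assert (H2 := Rabs_triang x (t - x)).
    replace (x + (t - x)) with t in H2 by ring. lra. }
  destruct H2 as [H2|H2]; [left; apply exp_increasing; auto | rewrite H2; lra]. }
replace (u k y - u k x - RtoC (y - x) * u (S k) x)%C with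
  ((u k y - RtoC y * u (S k) x) - (u k x - RtoC x * u (S k) x))%C
  by (rewrite RtoC_minus; ring).
rewrite <- pow2_abs. replace (B * Rabs (y - x) ^ 2) with (B * Rabs (y - x) * Rabs (y - x)) by ring.
apply (Cmod_lipschitz (fun t => u k t - RtoC t * u (S k) x)%C
  (fun t => u (S k) t - u (S k) x)%C).
- intros t Ht'. destruct (tower_deriv _ _ _ Ht k t) as [H1 H2].
  split.
  + apply is_derive_ext with (fun t => Re (u k t) - t * Re (u (S k) x)).
    * intros s. as_real_equation.
      unfold Cminus, Cplus, Copp, Cmult, RtoC, Re, Im; simpl; ring.
    * apply (is_derive_minus (fun t => Re (u k t)) (fun t => t * Re (u (S k) x))
        t (Re (u (S k) t)) (Re (u (S k) x))); auto.
      auto_derive; auto; ring.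
  + apply is_derive_ext with (fun t => Im (u k t) - t * Im (u (S k) x)).
    * intros s. as_real_equation.
      unfold Cminus, Cplus, Copp, Cmult, RtoC, Re, Im; simpl; ring.
    * apply (is_derive_minus (fun t => Im (u k t)) (fun t => t * Im (u (S k) x))
        t (Im (u (S k) t)) (Im (u (S k) x))); auto.
      auto_derive; auto; ring.
- intros t Ht'.
  apply Rle_trans with (B * Rabs (t - x)); [|apply Rmult_le_compat_l; auto].
  apply (Cmod_lipschitz (u (S k)) (u (S (S k)))).
  + intros s _. apply (tower_deriv _ _ _ Ht).
  + intros s Hs. apply Hb. apply Rle_trans with (Rabs (t - x)); auto.
    * destruct (Rle_dec x t).
      -- rewrite Rmin_left, Rmax_right in Hs by lra. rewrite !Rabs_right; lra.
      -- rewrite Rmin_right, Rmax_left in Hs by lra. rewrite !Rabs_left1; lra.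
    * apply Rle_trans with (Rabs (y - x)); auto.
Qed.

(** The solution of z v - v' = u obtained by expanding 1 / (z - D) in powers of
    the derivation D; see resolvent_eq. *)
Definition resolvent (z : C) (u : nat -> R -> C) (k : nat) (x : R) : C :=
  Cseries (fun j => (/ z) ^ (S j) * u (k + j)%nat x)%C.

Lemma is_series_geom_shift (r m K : R) :
  0 <= r -> r < m -> is_series (fun j => (/ m) ^ (S j) * (K * r ^ j)) (K / (m - r)).
Proof.
intros Hr Hm.
assert (Hq : Rabs (r / m) < 1).
{ rewrite Rabs_right; [apply Rlt_div_l; lra|].
  apply Rle_ge, Rdiv_le_0_compat; lra. }
assert (H := is_series_geom (r / m) Hq).
apply (is_series_scal (V := R_NormedModule) (K / m)) in H.
replace (K / (m - r)) with (scal (K / m) (/ (1 - r / m))).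
2:{ unfold scal; simpl; unfold mult; simpl. field; split; lra. }
revert H; apply is_series_ext. intros n.
as_real_equation.
unfold scal; simpl; unfold mult; simpl.
unfold Rdiv; rewrite Rpow_mult_distr. ring.
Qed.

Lemma Cmod_lt_neq_0 (r : R) (z : C) : 0 <= r -> r < Cmod z -> z <> 0%C.
Proof. intros Hr Hz E. rewrite E, Cmod_0 in Hz. lra. Qed.

Lemma resolvent_dominated r K u z k x :
  0 <= r -> r < Cmod z -> tower r K u ->
  Cdominated (fun j => (/ z) ^ (S j) * u (k + j)%nat x)%C
    (fun j => (/ Cmod z) ^ (S j) * (K * r ^ k * exp (r * Rabs x) * r ^ j)).
Proof.
intros Hr Hz Ht. split.
- eexists; apply is_series_geom_shift; auto.
- intros j. rewrite Cmod_mult, Cmod_pow, Cmod_inv by (eapply Cmod_lt_neq_0; eauto).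
  apply Rmult_le_compat_l.
  + apply pow_le. left; apply Rinv_0_lt_compat; lra.
  + eapply Rle_trans; [apply (tower_bound _ _ _ Ht)|]. rewrite pow_add.
    apply Req_le; ring.
Qed.

Lemma resolvent_bound r K u z k x :
  0 <= r -> r < Cmod z -> tower r K u ->
  Cmod (resolvent z u k x) <= K / (Cmod z - r) * r ^ k * exp (r * Rabs x).
Proof.
intros Hr Hz Ht.
eapply Rle_trans; [eapply Cseries_bound, resolvent_dominated; eauto|].
apply Req_le. rewrite (is_series_unique _ _ (is_series_geom_shift r (Cmod z) _ Hr Hz)).
field. lra.
Qed.

Lemma resolvent_eq r K u z k x :
  0 <= r -> r < Cmod z -> tower r K u ->
  (z * resolvent z u k x)%C = (u k x + resolvent z u (S k) x)%C.
Proof.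
intros Hr Hz Ht. assert (Hz0 := Cmod_lt_neq_0 _ _ Hr Hz).
unfold resolvent at 1.
rewrite (Cseries_incr_1 _ _ (resolvent_dominated r K u z k x Hr Hz Ht)).
replace (Cseries (fun j => (/ z) ^ (S (S j)) * u (k + S j)%nat x)%C) with
  (/ z * resolvent z u (S k) x)%C.
- rewrite Nat.add_0_r. simpl Cpow. field. auto.
- unfold resolvent. rewrite <- (Cseries_scal _ _ _ (resolvent_dominated r K u z (S k) x Hr Hz Ht)).
  unfold Cseries; f_equal; apply Series_ext; intros j; f_equal;
    rewrite Nat.add_succ_r; simpl; ring.
Qed.

Lemma resolvent_tower r K u z :
  0 <= r -> r < Cmod z -> tower r K u ->
  tower r (K / (Cmod z - r)) (resolvent z u).
Proof.
intros Hr Hz Ht. split.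
- intros; eapply resolvent_bound; eauto.
- intros k x.
  set (B := K * r ^ (S (S k)) * exp (r * (Rabs x + 1))).
  apply Cderiv_quadratic with (B / (Cmod z - r)). intros y Hy.
  set (a := fun j => ((/ z) ^ (S j) *
    (u (k + j)%nat y - u (k + j)%nat x - RtoC (y - x) * u (S k + j)%nat x))%C).
  replace (resolvent z u k y - resolvent z u k x - RtoC (y - x) * resolvent z u (S k) x)%C
    with (Cseries a).
  + assert (Ha : Cdominated a (fun j => (/ Cmod z) ^ (S j) * (B * (y - x) ^ 2 * r ^ j))).
    { split.
      - eexists; apply is_series_geom_shift; auto.
      - intros j. unfold a. rewrite Cmod_mult, Cmod_pow, Cmod_inv
          by (eapply Cmod_lt_neq_0; eauto).
        apply Rmult_le_compat_l; [apply pow_le; left; apply Rinv_0_lt_compat; lra|].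
        eapply Rle_trans; [apply (tower_quadratic r K u (k + j)); auto|].
        unfold B. apply Req_le. simpl. rewrite pow_add. ring. }
    eapply Rle_trans; [apply (Cseries_bound _ _ Ha)|].
    rewrite (is_series_unique _ _ (is_series_geom_shift r (Cmod z) _ Hr Hz)).
    apply Req_le; field; lra.
  + assert (D1 := resolvent_dominated r K u z k y Hr Hz Ht).
    assert (D2 := resolvent_dominated r K u z k x Hr Hz Ht).
    assert (D3 := resolvent_dominated r K u z (S k) x Hr Hz Ht).
    assert (D2' := Cdominated_scal (-(1))%C _ _ D2).
    assert (D3' := Cdominated_scal (- RtoC (y - x))%C _ _ D3).
    assert (D4 := Cdominated_plus _ _ _ _ D1 D2').
    transitivity (resolvent z u k y + - (1) * resolvent z u k x +
      - RtoC (y - x) * resolvent z u (S k) x)%C; [|ring].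
    unfold resolvent. rewrite <- (Cseries_scal _ _ _ D2), <- (Cseries_scal _ _ _ D3).
    rewrite <- (Cseries_plus _ _ _ _ D1 D2'), <- (Cseries_plus _ _ _ _ D4 D3').
    unfold Cseries; f_equal; apply Series_ext; intros j; f_equal; unfold a; ring.
Qed.

Lemma geometric_sequence_zero (r K : R) (z : C) (w : nat -> C) :
  0 <= r -> r < Cmod z ->
  (forall k, w (S k) = (z * w k)%C) -> (forall k, Cmod (w k) <= K * r ^ k) ->
  w 0%nat = 0%C.
Proof.
intros Hr Hz Hw Hb. apply Cmod_eq_0.
assert (Hk : forall k, Cmod (w k) = Cmod z ^ k * Cmod (w 0%nat)).
{ induction k; simpl; [ring|]. rewrite Hw, Cmod_mult, IHk; ring. }
assert (Hl : is_lim_seq (fun k => K * (r / Cmod z) ^ k) 0).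
{ apply is_lim_seq_geom_scal.
  split; [apply Rdiv_le_0_compat; lra | apply Rlt_div_l; lra]. }
assert (H0 := Cmod_ge_0 (w 0%nat)). apply Rle_antisym; auto.
apply (is_lim_seq_le (fun _ => Cmod (w 0%nat)) (fun k => K * (r / Cmod z) ^ k)
  (Cmod (w 0%nat)) 0).
- intros k. specialize (Hb k). rewrite Hk in Hb.
  assert (Hp : 0 < Cmod z ^ k) by (apply pow_lt; lra).
  unfold Rdiv. rewrite Rpow_mult_distr, pow_inv.
  apply Rmult_le_reg_l with (Cmod z ^ k); auto.
  replace (Cmod z ^ k * (K * (r ^ k * / Cmod z ^ k))) with (K * r ^ k) by (field; lra).
  auto.
- apply is_lim_seq_const.
- auto.
Qed.

(** The resolvent identity; both sides solve the same first order recurrence,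
    whose only solution of type r < |z| is zero. *)
Lemma resolvent_identity r K u (s z : C) x :
  0 <= r -> r < Cmod s -> r < Cmod z -> tower r K u ->
  resolvent z u 0%nat x =
  (resolvent s u 0%nat x + (s - z) * resolvent z (resolvent s u) 0%nat x)%C.
Proof.
intros Hr Hs Hz Ht.
assert (Hts := resolvent_tower r K u s Hr Hs Ht).
set (w := fun k => (resolvent z u k x + - (1) * (resolvent s u k x
  + (s - z) * resolvent z (resolvent s u) k x))%C).
cut (w 0%nat = 0%C).
{ unfold w; intros H.
  transitivity (0 + (resolvent s u 0%nat x + (s - z) * resolvent z (resolvent s u) 0%nat x))%C;
    [rewrite <- H; ring | ring]. }
eapply (geometric_sequence_zero r _ z w Hr Hz).
- intros k. unfold w.
  assert (E1 := resolvent_eq r _ u z k x Hr Hz Ht).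
  assert (E2 := resolvent_eq r _ u s k x Hr Hs Ht).
  assert (E3 := resolvent_eq r _ (resolvent s u) z k x Hr Hz Hts).
  replace (resolvent z u (S k) x) with (z * resolvent z u k x - u k x)%C by (rewrite E1; ring).
  replace (resolvent z (resolvent s u) (S k) x) with
    (z * resolvent z (resolvent s u) k x - resolvent s u k x)%C by (rewrite E3; ring).
  replace (resolvent s u (S k) x) with (s * resolvent s u k x - u k x)%C by (rewrite E2; ring).
  ring.
- intros k. unfold w.
  assert (B1 := resolvent_bound r _ u z k x Hr Hz Ht).
  assert (B2 := resolvent_bound r _ u s k x Hr Hs Ht).
  assert (B3 := resolvent_bound r _ (resolvent s u) z k x Hr Hz Hts).
  eapply Rle_trans; [apply Cmod_triangle|]. rewrite Cmod_mult, Cmod_m1, Rmult_1_l.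
  eapply Rle_trans; [apply Rplus_le_compat_l, Cmod_triangle|]. rewrite Cmod_mult.
  eapply Rle_trans; [apply Rplus_le_compat; [apply B1|apply Rplus_le_compat; [apply B2|
    apply Rmult_le_compat_l; [apply Cmod_ge_0|apply B3]]]|].
  match goal with |- ?l <= _ => replace l with
   ((K / (Cmod z - r) * exp (r * Rabs x) + (K / (Cmod s - r) * exp (r * Rabs x)
     + Cmod (s - z) * (K / (Cmod s - r) / (Cmod z - r) * exp (r * Rabs x)))) * r ^ k)
    by ring end.
  apply Rle_refl.
Qed.

(** The function exp (- z t) v(t), with v the resolvent of u, has derivative
    - exp (- z t) u(t). *)
Lemma resolvent_increment r K u (z : C) (M x y : R) :
  0 <= r -> r < Cmod z -> tower r K u -> Re z <> 0 -> x <= y ->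
  (forall t, x <= t <= y -> Cmod (u 0%nat t) <= M) ->
  Cmod (cexp_neg z y * resolvent z u 0%nat y - cexp_neg z x * resolvent z u 0%nat x)
  <= M / Re z * (exp (- (Re z * x)) - exp (- (Re z * y))).
Proof.
intros Hr Hz Ht Hs Hxy HM.
assert (Htr := resolvent_tower r K u z Hr Hz Ht).
replace (M / Re z * (exp (- (Re z * x)) - exp (- (Re z * y)))) with
  (- (M / Re z) * exp (- (Re z * y)) - (- (M / Re z) * exp (- (Re z * x)))) by ring.
apply (Cmod_mean_value (fun t => cexp_neg z t * resolvent z u 0%nat t)%C
  (fun t => cexp_neg z t * (resolvent z u 1%nat t - z * resolvent z u 0%nat t))%C
  (fun t => - (M / Re z) * exp (- (Re z * t))) (fun t => M * exp (- (Re z * t)))); auto.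
- intros t _. apply Cderiv_cexp_neg_mult. apply (tower_deriv _ _ _ Htr).
- intros t _. auto_derive; auto. field; auto.
- intros t H. rewrite (resolvent_eq r K u z 0 t Hr Hz Ht).
  replace (resolvent z u 1%nat t - (u 0%nat t + resolvent z u 1%nat t))%C
    with (- u 0%nat t)%C by ring.
  rewrite Cmod_mult, Cmod_cexp_neg, Cmod_opp, Rmult_comm.
  apply Rmult_le_compat_r; [left; apply exp_pos | auto].
Qed.

(** The bound that the Laplace integral of u over a half-line would give. *)
Definition half_line_bound (r : R) (z : C) : Prop :=
  forall K M u, tower r K u ->
  (forall x, 0 <= x -> Cmod (u 0%nat x) <= M) ->
  forall x, 0 <= x -> Cmod (resolvent z u 0%nat x) <= M / Re z.

(** For Re z > r the function exp (- z t) v(t) of resolvent_increment tends to 0, because v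
    has type r. *)
Lemma half_line_bound_far r z : 0 <= r -> r < Re z -> half_line_bound r z.
Proof.
intros Hr Hs K M u Ht HM x Hx.
assert (Hz : r < Cmod z).
{ eapply Rlt_le_trans; [apply Hs|]. eapply Rle_trans; [apply Rle_abs | apply re_le_Cmod]. }
assert (Htr := resolvent_tower r K u z Hr Hz Ht).
assert (HK := tower_K_nonneg _ _ _ Ht).
set (C0 := K / (Cmod z - r) * exp (Re z * x) * exp ((r - Re z) * x)).
apply (le_of_lim_zero _ _ (fun n => C0 * exp (r - Re z) ^ n)).
- apply is_lim_seq_geom_scal. split; [left; apply exp_pos|].
  rewrite <- exp_0. apply exp_increasing. lra.
- intros n. set (y := x + INR n). assert (Hn := pos_INR n).
  assert (H := resolvent_increment r K u z M x y Hr Hz Ht ltac:(lra) ltac:(unfold y; lra)).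
  assert (H1 : Cmod (cexp_neg z x * resolvent z u 0%nat x) <=
    M / Re z * exp (- (Re z * x)) + K / (Cmod z - r) * exp (- (Re z * y)) * exp (r * y)).
  { replace (cexp_neg z x * resolvent z u 0%nat x)%C with
      (cexp_neg z y * resolvent z u 0%nat y -
       (cexp_neg z y * resolvent z u 0%nat y - cexp_neg z x * resolvent z u 0%nat x))%C by ring.
    unfold Cminus at 1. eapply Rle_trans; [apply Cmod_triangle|]. rewrite Cmod_opp.
    assert (H2 := tower_bound _ _ _ Htr 0%nat y). rewrite (Rabs_right y) in H2 by (unfold y; lra).
    simpl pow in H2. rewrite Rmult_1_r in H2.
    rewrite Cmod_mult, Cmod_cexp_neg.
    assert (H3 : Cmod (cexp_neg z y * resolvent z u 0%nat y - cexp_neg z x * resolvent z u 0%nat x)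
      <= M / Re z * exp (- (Re z * x))).
    { eapply Rle_trans; [apply H; intros t Ht'; apply HM; lra|].
      assert (He := exp_pos (- (Re z * y))).
      assert (HM0 : 0 <= M / Re z).
      { apply Rdiv_le_0_compat; [|lra]. assert (H3 := HM 0 (Rle_refl 0)).
        assert (H4 := Cmod_ge_0 (u 0%nat 0)). lra. }
      nra. }
    assert (He := exp_pos (- (Re z * y))). nra. }
  rewrite Cmod_mult, Cmod_cexp_neg in H1.
  assert (He := exp_pos (Re z * x)).
  apply (Rmult_le_compat_l (exp (Re z * x))) in H1; [|lra].
  assert (E1 : exp (Re z * x) * exp (- (Re z * x)) = 1).
  { rewrite <- exp_plus, Rplus_opp_r. apply exp_0. }
  replace (exp (Re z * x) * (exp (- (Re z * x)) * Cmod (resolvent z u 0%nat x))) with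
    (Cmod (resolvent z u 0%nat x)) in H1 by (rewrite <- Rmult_assoc, E1; ring).
  eapply Rle_trans; [apply H1|].
  rewrite Rmult_plus_distr_l.
  replace (exp (Re z * x) * (M / Re z * exp (- (Re z * x)))) with (M / Re z)
    by (transitivity (M / Re z * (exp (Re z * x) * exp (- (Re z * x)))); [rewrite E1|]; ring).
  apply Rplus_le_compat_l, Req_le. unfold C0.
  replace (exp (r - Re z) ^ n) with (exp ((r - Re z) * INR n)).
  + rewrite <- !Rmult_assoc. rewrite !(Rmult_assoc _ (exp _) (exp _)), <- !exp_plus.
    rewrite (Rmult_comm (exp _) (K / _)), !Rmult_assoc, <- !exp_plus.
    f_equal. f_equal. unfold y. ring.
  + clear. induction n; [simpl; rewrite Rmult_0_r; apply exp_0|].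
    rewrite S_INR, Rmult_plus_distr_l, exp_plus, IHn, Rmult_1_r. simpl. ring.
Qed.

(** Moving z to the left by d: iterate the resolvent identity with s = z + d.  The terms
    obtained sum to M / Re z, and the last one decays like (d / (|s| - r)) ^ N. *)
Lemma half_line_bound_step r (z : C) (d : R) :
  0 <= r -> r < Cmod z -> 0 < Re z -> 0 < d < Cmod z - r ->
  half_line_bound r (z + RtoC d)%C -> half_line_bound r z.
Proof.
intros Hr Hz Hs Hd Hh.
set (s := (z + RtoC d)%C) in *.
assert (Hre : Re s = Re z + d) by reflexivity.
assert (Hmod : Cmod z <= Cmod s).
{ assert (H1 := Cmod2_alt z). assert (H2 := Cmod2_alt s).
  assert (Him : Im s = Im z) by (unfold s, Im, Cplus, RtoC; simpl; ring).
  rewrite Hre, Him in H2. assert (H3 := Cmod_ge_0 s). assert (H4 := Cmod_ge_0 z). nra. }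
assert (Hzs : r < Cmod s) by lra.
assert (HN : forall N K M u, tower r K u ->
  (forall x, 0 <= x -> Cmod (u 0%nat x) <= M) -> forall x, 0 <= x ->
  Cmod (resolvent z u 0%nat x) <=
    M / Re z + K / (Cmod z - r) * exp (r * x) * (d / (Cmod s - r)) ^ N).
{ induction N; intros K M u Ht HM x Hx.
  - assert (H := resolvent_bound r K u z 0 x Hr Hz Ht).
    rewrite Rabs_right in H by lra. simpl in *.
    assert (0 <= M / Re z); [|lra].
    apply Rdiv_le_0_compat; [|lra]. assert (H3 := HM 0 (Rle_refl 0)).
    assert (H4 := Cmod_ge_0 (u 0%nat 0)). lra.
  - rewrite (resolvent_identity r K u s z x) by auto.
    replace (s - z)%C with (RtoC d) by (unfold s; ring).
    eapply Rle_trans; [apply Cmod_triangle|]. rewrite Cmod_mult, Cmod_R, (Rabs_right d) by lra.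
    assert (H1 := Hh K M u Ht HM x Hx).
    assert (H2 := IHN _ (M / Re s) (resolvent s u) (resolvent_tower r K u s Hr Hzs Ht)
      (Hh K M u Ht HM) x Hx).
    apply (Rmult_le_compat_l d) in H2; [|lra].
    eapply Rle_trans; [apply Rplus_le_compat; [apply H1|apply H2]|].
    apply Req_le. rewrite Hre. simpl. field. repeat split; lra. }
intros K M u Ht HM x Hx.
apply (le_of_lim_zero _ _ (fun N => K / (Cmod z - r) * exp (r * x) * (d / (Cmod s - r)) ^ N)).
- apply is_lim_seq_geom_scal.
  split; [apply Rdiv_le_0_compat; lra | apply Rlt_div_l; lra].
- intros N. apply HN; auto.
Qed.

(** The Laplace bound holds wherever the expansion of the resolvent converges in the
    right half-plane: an analytic continuation along a horizontal half-line. *)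
Lemma half_line_bound_right r (z : C) :
  0 <= r -> r < Cmod z -> 0 < Re z -> half_line_bound r z.
Proof.
intros Hr Hz Hs.
set (d := (Cmod z - r) / 2).
assert (Hn : forall n w, Cmod z <= Cmod w -> 0 < Re w ->
  half_line_bound r (w + RtoC (INR n * d))%C -> half_line_bound r w).
{ induction n; intros w Hw Hw0 H.
  - replace w with (w + RtoC (INR 0 * d))%C; auto. simpl. rewrite Rmult_0_l. ring.
  - apply half_line_bound_step with d; auto; try (unfold d; lra).
    apply IHn.
    + eapply Rle_trans; [apply Hw|].
      assert (H1 := Cmod2_alt w). assert (H2 := Cmod2_alt (w + RtoC d)%C).
      replace (Re (w + RtoC d)%C) with (Re w + d) in H2 by reflexivity.
      replace (Im (w + RtoC d)%C) with (Im w) in H2 by (unfold Im, Cplus, RtoC; simpl; ring).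
      assert (H3 := Cmod_ge_0 w). assert (H4 := Cmod_ge_0 (w + RtoC d)%C).
      assert (0 < d) by (unfold d; lra). nra.
    + replace (Re (w + RtoC d)%C) with (Re w + d) by reflexivity. unfold d; lra.
    + replace (w + RtoC d + RtoC (INR n * d))%C with (w + RtoC (INR (S n) * d))%C; auto.
      rewrite S_INR, Rmult_plus_distr_r, RtoC_plus, Rmult_1_l. ring. }
assert (Hd : 0 < d) by (unfold d; lra).
destruct (INR_unbounded (r / d)) as [n Hn'].
apply (Hn n); auto; try lra.
apply half_line_bound_far; auto.
replace (Re (z + RtoC (INR n * d))%C) with (Re z + INR n * d) by reflexivity.
assert (r < INR n * d); [|lra].
apply Rlt_div_l in Hn'; auto.
Qed.

(** On the circle of radius rho the factor z^2 + rho^2 has modulus 2 rho |Re z|, which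
    compensates the blow-up of both half-plane bounds at the imaginary axis. *)
Lemma resolvent_circle_bound r K M u rho (z : C) (x : R) :
  0 <= r -> r < rho -> Cmod z = rho -> tower r K u ->
  (forall y, 0 <= y -> Cmod (u 0%nat y) <= M) -> 0 <= x ->
  Cmod (z * z + RtoC (rho ^ 2)) * Cmod (resolvent z u 0%nat x) <=
  2 * rho * (M + rho * (K / (rho - r))).
Proof.
intros Hr Hrho Hz Ht HM Hx.
assert (HK := tower_K_nonneg _ _ _ Ht).
assert (HM0 : 0 <= M).
{ assert (H3 := HM 0 (Rle_refl 0)). assert (H4 := Cmod_ge_0 (u 0%nat 0)). lra. }
assert (Hzr : r < Cmod z) by lra.
assert (Hf : Cmod (z * z + RtoC (rho ^ 2)) = 2 * rho * Rabs (Re z)).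
{ assert (H1 := Cmod2_conj z). rewrite Hz in H1.
  replace (z * z + RtoC (rho ^ 2))%C with (z * RtoC (2 * Re z))%C.
  - rewrite Cmod_mult, Cmod_R, Rabs_mult, (Rabs_right 2), Hz by lra. ring.
  - rewrite H1. transitivity (z * (z + Cconj z))%C; [|ring]. f_equal.
    apply C_ext; unfold Re, Im, Cplus, Cconj, RtoC; simpl; ring. }
rewrite Hf.
assert (HKr : 0 <= K / (rho - r)) by (apply Rdiv_le_0_compat; lra).
destruct (Rtotal_order (Re z) 0) as [Hs|[Hs|Hs]].
- assert (H := resolvent_increment r K u z M 0 x Hr Hzr Ht ltac:(lra) Hx
    ltac:(intros; apply HM; lra)).
  set (R0 := resolvent z u 0%nat 0) in *. set (R1 := resolvent z u 0%nat x) in *.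
  assert (B0 : Cmod R0 <= K / (rho - r)).
  { assert (H0 := resolvent_bound r K u z 0 0 Hr Hzr Ht).
    rewrite Rabs_R0, Rmult_0_r, exp_0, Hz in H0. simpl in H0. unfold R0. lra. }
  assert (H1 : Cmod (cexp_neg z x * R1) <= K / (rho - r) +
    M / Re z * (exp (- (Re z * 0)) - exp (- (Re z * x)))).
  { replace (cexp_neg z x * R1)%C with (cexp_neg z 0 * R0 +
      (cexp_neg z x * R1 - cexp_neg z 0 * R0))%C by ring.
    eapply Rle_trans; [apply Cmod_triangle|].
    rewrite (Cmod_mult _ R0), Cmod_cexp_neg, Rmult_0_r, Ropp_0, exp_0, Rmult_1_l.
    rewrite Rmult_0_r, Ropp_0, exp_0 in H. lra. }
  rewrite Cmod_mult, Cmod_cexp_neg, Rmult_0_r, Ropp_0, exp_0 in H1.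
  rewrite (Rabs_left (Re z)) by lra.
  assert (He1 : 1 <= exp (- (Re z * x))).
  { rewrite <- exp_0. destruct (Req_dec x 0) as [->|]; [rewrite Rmult_0_r, Ropp_0; lra|].
    left; apply exp_increasing. nra. }
  set (e := exp (- (Re z * x))) in *.
  assert (H2 : e * (- Re z * Cmod R1) <= - Re z * (K / (rho - r)) + M * (e - 1)).
  { replace (e * (- Re z * Cmod R1)) with (- Re z * (e * Cmod R1)) by ring.
    apply (Rmult_le_compat_l (- Re z)) in H1; [|lra].
    eapply Rle_trans; [apply H1|]. apply Req_le. field. split; lra. }
  assert (Hsr : - Re z <= rho).
  { rewrite <- Hz. eapply Rle_trans; [|apply re_le_Cmod]. rewrite Rabs_left; lra. }
  assert (H3 : - Re z * Cmod R1 <= M + rho * (K / (rho - r))).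
  { apply Rmult_le_reg_l with e; [lra|].
    assert (- Re z * (K / (rho - r)) <= e * (rho * (K / (rho - r)))).
    { assert (- Re z * (K / (rho - r)) <= rho * (K / (rho - r))) by nra.
      assert (0 <= rho * (K / (rho - r))) by nra. nra. }
    nra. }
  assert (0 < rho) by lra. nra.
- rewrite Hs, Rabs_R0, Rmult_0_r, Rmult_0_l.
  apply Rmult_le_pos; [lra|]. assert (0 <= rho * (K / (rho - r))) by nra. lra.
- assert (H := half_line_bound_right r z Hr Hzr Hs K M u Ht HM x Hx).
  rewrite Rabs_right by lra.
  replace (2 * rho * Re z * Cmod (resolvent z u 0%nat x)) with
    (2 * rho * (Re z * Cmod (resolvent z u 0%nat x))) by ring.
  apply Rmult_le_compat_l; [lra|].
  assert (Re z * Cmod (resolvent z u 0%nat x) <= M).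
  { apply (Rmult_le_compat_l (Re z)) in H; [|lra]. replace M with (Re z * (M / Re z)) by (field; lra). auto. }
  assert (0 <= rho * (K / (rho - r))) by nra. lra.
Qed.

(** * Cauchy estimates on the unit circle *)

Fixpoint Csum (c : nat -> C) (n : nat) : C :=
  match n with
  | O => 0%C
  | S m => (Csum c m + c m)%C
  end.

(** The square root (1 + v) / |1 + v| bisects the angle of v; v = -1 is apart. *)
Lemma unit_sqrt (v : C) : Cmod v = 1 -> exists w, Cmod w = 1 /\ (w * w)%C = v.
Proof.
intros Hv. assert (H2 := Cmod2_alt v). rewrite Hv in H2.
destruct (Req_dec (Re v) (-1)) as [E|E].
- exists Ci; split; [apply Cmod_Ci|].
  assert (Im v = 0) by (rewrite E in H2; nra).
  apply C_ext; unfold Ci, Cmult, Re, Im in *; simpl in *; lra.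
- assert (Hn : (1 + v <> 0)%C).
  { intros H0. apply E. assert (H1 : Re (1 + v)%C = 0) by (rewrite H0; reflexivity).
    change (1 + Re v = 0) in H1. lra. }
  assert (Hc : (1 + Cconj v <> 0)%C).
  { intros H0. apply Hn. apply (f_equal Cconj) in H0. rewrite Cplus_conj, Cconj_conj in H0.
    replace (Cconj 1) with (RtoC 1) in H0 by (unfold Cconj, RtoC; simpl; f_equal; ring).
    rewrite H0. unfold Cconj, RtoC; simpl; f_equal; ring. }
  assert (Hm : Cmod (1 + v) <> 0) by (intros H0; apply Hn, Cmod_eq_0; auto).
  exists ((1 + v) / RtoC (Cmod (1 + v)))%C. split.
  + rewrite Cmod_div, Cmod_R, Rabs_right; [field; auto|apply Rle_ge, Cmod_ge_0|].
    intros H; apply Hm. apply RtoC_inj in H; auto.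
  + assert (H3 := Cmod2_conj (1 + v)%C).
    replace (Cconj (1 + v)%C) with (1 + Cconj v)%C in H3
      by (unfold Cconj, Cplus, RtoC; simpl; f_equal; ring).
    assert (H4 := Cmod2_conj v). rewrite Hv in H4.
    assert (H5 : (v * Cconj v)%C = 1%C) by (rewrite <- H4; f_equal; ring).
    assert (Hm' : RtoC (Cmod (1 + v)) <> 0%C) by (intros H; apply Hm, RtoC_inj, H).
    transitivity ((1 + v) * (1 + v) / RtoC (Cmod (1 + v) ^ 2))%C.
    * rewrite RtoC_pow. field. auto.
    * rewrite H3. transitivity (v * (v * Cconj v + v) / (v * (1 + Cconj v)))%C.
      -- rewrite H5. field. split; auto. split; auto. intros H0.
         rewrite H0, Cmod_0 in Hv. lra.
      -- field. split; auto. intros H0. rewrite H0, Cmod_0 in Hv. lra.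
Qed.

Lemma Csum_even_odd (c : nat -> C) (n : nat) :
  Csum c (2 * n) =
  (Csum (fun m => c (2 * m)%nat) n + Csum (fun m => c (2 * m + 1)%nat) n)%C.
Proof.
induction n; [simpl; ring|].
replace (2 * S n)%nat with (S (S (2 * n))) by lia.
cbn [Csum]. rewrite IHn. replace (2 * n + 1)%nat with (S (2 * n)) by lia. ring.
Qed.

Lemma Csum_ext (a b : nat -> C) n : (forall m, a m = b m) -> Csum a n = Csum b n.
Proof. intros H; induction n; simpl; [|rewrite IHn, H]; reflexivity. Qed.

Lemma Csum_scal (z : C) (a : nat -> C) n :
  Csum (fun m => z * a m)%C n = (z * Csum a n)%C.
Proof. induction n; simpl; [|rewrite IHn]; ring. Qed.

(** Splitting p(w) = E(w^2) + w O(w^2) and comparing p(w) with p(-w) bounds E and O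
    by the same constant; halving the degree repeatedly isolates one coefficient. *)
Lemma Cauchy_estimate (d : nat) : forall (c : nat -> C) (B : R),
  (forall w, Cmod w = 1 -> Cmod (Csum (fun m => c m * w ^ m)%C (2 ^ d)) <= B) ->
  forall m, (m < 2 ^ d)%nat -> Cmod (c m) <= B.
Proof.
induction d; intros c B H m Hm.
- assert (H1 := H 1%C Cmod_1). replace m with 0%nat by (simpl in Hm; lia).
  simpl in H1. replace (0 + c 0%nat * 1)%C with (c 0%nat) in H1 by ring. auto.
- change (2 ^ S d)%nat with (2 * 2 ^ d)%nat in *.
  assert (Hs : forall w, Csum (fun m => c m * w ^ m)%C (2 * 2 ^ d) =
    (Csum (fun m => c (2 * m)%nat * (w * w) ^ m) (2 ^ d) +
     w * Csum (fun m => c (2 * m + 1)%nat * (w * w) ^ m) (2 ^ d))%C).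
  { intros w. rewrite Csum_even_odd, <- Csum_scal. f_equal; apply Csum_ext; intros k.
    - rewrite Cpow_mult_r. simpl (w ^ 2)%C. do 2 f_equal. ring.
    - rewrite Cpow_add_r, Cpow_mult_r. replace (w * w)%C with (w ^ 2)%C by (simpl; ring).
      simpl (w ^ 1)%C. ring. }
  assert (Hboth : forall v, Cmod v = 1 ->
    Cmod (Csum (fun m => c (2 * m)%nat * v ^ m)%C (2 ^ d)) <= B /\
    Cmod (Csum (fun m => c (2 * m + 1)%nat * v ^ m)%C (2 ^ d)) <= B).
  { intros v Hv. destruct (unit_sqrt v Hv) as [w [Hw Hwv]].
    assert (H1 := H w Hw). assert (H2 := H (- w)%C ltac:(rewrite Cmod_opp; auto)).
    rewrite Hs in H1, H2. replace (- w * - w)%C with (w * w)%C in H2 by ring.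
    rewrite Hwv in H1, H2.
    set (E := Csum (fun m => c (2 * m)%nat * v ^ m)%C (2 ^ d)) in *.
    set (O := Csum (fun m => c (2 * m + 1)%nat * v ^ m)%C (2 ^ d)) in *.
    split.
    - assert (H3 := Cmod_triangle (E + w * O) (E + - w * O)).
      replace (E + w * O + (E + - w * O))%C with (RtoC 2 * E)%C in H3 by ring.
      rewrite Cmod_mult, Cmod_R, Rabs_right in H3 by lra. lra.
    - assert (H3 := Cmod_triangle (E + w * O) (- (E + - w * O))).
      rewrite Cmod_opp in H3.
      replace (E + w * O + - (E + - w * O))%C with (RtoC 2 * (w * O))%C in H3 by ring.
      rewrite !Cmod_mult, Cmod_R, Rabs_right, Hw in H3 by lra. lra. }
  destruct (Nat.Even_or_Odd m) as [[k Hk]|[k Hk]]; subst m.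
  + apply (IHd (fun m => c (2 * m)%nat) B); [|lia]. intros v Hv. apply Hboth, Hv.
  + apply (IHd (fun m => c (2 * m + 1)%nat) B); [|lia]. intros v Hv. apply Hboth, Hv.
Qed.

(** * Bernstein-type bounds on a half-line *)

Section Coefficients.
Variables (u : nat -> R -> C) (x rho : R).

(** With w = rho / z on the unit circle, these are the coefficients in powers of w of
    resolvent z u 0 x. *)
Definition laurent_coef (m : nat) : C :=
  match m with
  | O => 0%C
  | S k => (RtoC (/ rho) ^ m * u k x)%C
  end.

(** The coefficients after multiplication by 1 + w^2 = (z^2 + rho^2) / z^2. *)
Definition twisted_coef (m : nat) : C :=
  match m with
  | S (S k) => (laurent_coef m + laurent_coef k)%C
  | _ => laurent_coef m
  end.

Lemma twisted_sum (w : C) (n : nat) :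
  Csum (fun m => twisted_coef m * w ^ m)%C (S (S n)) =
  (Csum (fun m => laurent_coef m * w ^ m) (S (S n)) +
   w * w * Csum (fun m => laurent_coef m * w ^ m) n)%C.
Proof.
induction n; [simpl; ring|].
cbn [Csum] in *. rewrite IHn. cbn [twisted_coef Cpow]. ring.
Qed.

Lemma laurent_remainder r K (w : C) (n : nat) :
  0 <= r -> r < rho -> Cmod w = 1 -> tower r K u ->
  resolvent (RtoC rho / w) u 0%nat x =
  (Csum (fun m => laurent_coef m * w ^ m) (S n) +
   (w / RtoC rho) ^ n * resolvent (RtoC rho / w) u n x)%C.
Proof.
intros Hr Hrho Hw Ht.
assert (Hw0 : w <> 0%C) by (intros H; rewrite H, Cmod_0 in Hw; lra).
assert (Hrho0 : RtoC rho <> 0%C) by (intros H; apply RtoC_inj in H; lra).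
assert (Hz : r < Cmod (RtoC rho / w)).
{ rewrite Cmod_div, Hw, Cmod_R, Rabs_right by (auto; lra). lra. }
induction n; [simpl; ring|].
rewrite IHn. cbn [Csum laurent_coef].
assert (E := resolvent_eq r K u (RtoC rho / w) n x Hr Hz Ht).
replace (resolvent (RtoC rho / w) u n x) with
  (w / RtoC rho * (u n x + resolvent (RtoC rho / w) u (S n) x))%C.
- rewrite RtoC_inv by lra. rewrite (Cpow_S w), !Cpow_S, Cpow_inv by auto.
  unfold Cdiv. rewrite Cpow_mult_l, Cpow_inv by auto. ring.
- rewrite <- E. field. auto.
Qed.
End Coefficients.

(** Cauchy's estimate, applied to (1 + rho^2 / z^2) resolvent z u on |z| = rho, bounds sums of
    two rescaled derivatives of u at distance 2; a bound on each of them follows by induction,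
    at the price of a factor linear in k. *)
Lemma tower_half_line_bound r K M u rho (x : R) (k : nat) :
  0 <= r -> r < rho -> tower r K u ->
  (forall y, 0 <= y -> Cmod (u 0%nat y) <= M) -> 0 <= x ->
  Cmod (u k x) <= INR (S k) * rho ^ k * (2 * (M + rho * (K / (rho - r)))).
Proof.
intros Hr Hrho Ht HM Hx.
assert (HK := tower_K_nonneg _ _ _ Ht).
set (B := 2 * (M + rho * (K / (rho - r))) / rho).
set (L := K / (rho - r) * exp (r * x)).
assert (HL : 0 <= L).
{ apply Rmult_le_pos; [apply Rdiv_le_0_compat; lra | left; apply exp_pos]. }
set (q := r / rho).
assert (Hq : 0 <= q < 1).
{ unfold q; split; [apply Rdiv_le_0_compat; lra | apply Rlt_div_l; lra]. }
assert (HB : forall n w, Cmod w = 1 ->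
  Cmod (Csum (fun m => twisted_coef u x rho m * w ^ m)%C (S (S (S n))))
  <= B + 2 * (L * q ^ n)).
{ intros n w Hw.
  assert (Hw0 : w <> 0%C) by (intros H; rewrite H, Cmod_0 in Hw; lra).
  assert (Hrho0 : RtoC rho <> 0%C) by (intros H; apply RtoC_inj in H; lra).
  set (z := (RtoC rho / w)%C).
  assert (Hz : Cmod z = rho).
  { unfold z. rewrite Cmod_div, Hw, Cmod_R, Rabs_right by (auto; lra). field. }
  set (F := resolvent z u 0%nat x).
  assert (Hrem : forall j, Cmod ((w / RtoC rho) ^ j * resolvent z u j x) <= L * q ^ j).
  { intros j. rewrite Cmod_mult, Cmod_pow, Cmod_div, Hw, Cmod_R, Rabs_right by (auto; lra).
    assert (H := resolvent_bound r K u z j x Hr ltac:(lra) Ht).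
    rewrite Hz, Rabs_right in H by lra.
    apply Rle_trans with ((1 / rho) ^ j * (K / (rho - r) * r ^ j * exp (r * x))).
    - apply Rmult_le_compat_l; auto. apply pow_le. apply Rdiv_le_0_compat; lra.
    - apply Req_le. unfold L, q, Rdiv. rewrite !Rpow_mult_distr, pow1. ring. }
  assert (E1 := laurent_remainder u x rho r K w (S (S n)) Hr Hrho Hw Ht).
  assert (Hfac : Cmod (1 + w * w) * Cmod F <= B).
  { assert (H := resolvent_circle_bound r K M u rho z x Hr Hrho Hz Ht HM Hx).
    fold F in H.
    replace (z * z + RtoC (rho ^ 2))%C with (z * z * (1 + w * w))%C in H.
    - rewrite !Cmod_mult, Hz in H. unfold B.
      apply Rmult_le_reg_l with (rho * rho); [nra|].
      replace (rho * rho * (2 * (M + rho * (K / (rho - r))) / rho)) with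
        (2 * rho * (M + rho * (K / (rho - r)))) by (field; lra).
      lra.
    - unfold z. rewrite RtoC_pow. field. auto. }
  rewrite twisted_sum.
  assert (E2 := laurent_remainder u x rho r K w n Hr Hrho Hw Ht).
  fold z in E1, E2. fold F in E1, E2.
  match goal with |- Cmod ?t <= _ => replace t with
    ((1 + w * w) * F + - ((w / RtoC rho) ^ (S (S n)) * resolvent z u (S (S n)) x +
      w * w * ((w / RtoC rho) ^ n * resolvent z u n x)))%C end.
  2:{ replace (Csum (fun m => laurent_coef u x rho m * w ^ m)%C (S (S (S n)))) with
        (F - (w / RtoC rho) ^ (S (S n)) * resolvent z u (S (S n)) x)%C by (rewrite E1; ring).
      replace (Csum (fun m => laurent_coef u x rho m * w ^ m)%C (S n)) with
        (F - (w / RtoC rho) ^ n * resolvent z u n x)%C by (rewrite E2; ring).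
      ring. }
  eapply Rle_trans; [apply Cmod_triangle|]. rewrite Cmod_mult, Cmod_opp.
  eapply Rle_trans; [apply Rplus_le_compat_l, Cmod_triangle|].
  rewrite (Cmod_mult (w * w)), (Cmod_mult w w), Hw.
  assert (H1 := Hrem (S (S n))). assert (H2 := Hrem n).
  assert (q ^ S (S n) <= q ^ n).
  { assert (0 <= q ^ n) by (apply pow_le; lra).
    assert (Hqq : 0 <= 1 - q * q) by (clear - Hq; nra).
    replace (q ^ S (S n)) with (q * q * q ^ n) by (simpl; ring). clear - H Hqq; nra. }
  assert (L * q ^ S (S n) <= L * q ^ n) by (apply Rmult_le_compat_l; auto).
  lra. }
(* the estimate is for polynomials: let the number of terms 2 ^ d grow *)
assert (Ht' : forall m, Cmod (twisted_coef u x rho m) <= B).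
{ intros m. apply (le_of_lim_zero _ _ (fun n => 2 * L * q ^ n)).
  - apply is_lim_seq_geom_scal; auto.
  - intros n. set (d := (n + m + 3)%nat).
    assert (Hd : (d + 3 <= 2 ^ d)%nat).
    { clear. unfold d. generalize (n + m)%nat. intros p. induction p; simpl in *; lia. }
    apply (Cauchy_estimate d); [|unfold d in *; lia].
    intros w Hw. replace (2 ^ d)%nat with (S (S (S (2 ^ d - 3)))) by lia.
    eapply Rle_trans; [apply HB; auto|].
    assert (Hp : q ^ (2 ^ d - 3) <= q ^ n).
    { replace (2 ^ d - 3)%nat with (n + (2 ^ d - 3 - n))%nat by (unfold d in *; lia).
      rewrite pow_add. assert (H1 : 0 <= q ^ n) by (apply pow_le; lra).
      assert (H2 : q ^ (2 ^ d - 3 - n) <= 1 ^ (2 ^ d - 3 - n)) by (apply pow_incr; lra).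
      rewrite pow1 in H2. nra. }
    nra. }
assert (HB0 : 0 <= B) by (eapply Rle_trans; [apply Cmod_ge_0|apply (Ht' 0%nat)]).
assert (Hl : forall m, Cmod (laurent_coef u x rho m) <= INR m * B /\ Cmod (laurent_coef u x rho (S m)) <= INR (S m) * B).
{ induction m.
  - split; [simpl; rewrite Cmod_0; lra|]. assert (H := Ht' 1%nat). simpl in *. lra.
  - destruct IHm as [IH IH']. split; [exact IH'|].
    assert (H := Ht' (S (S m))). cbn [twisted_coef] in H.
    assert (H1 := Cmod_triangle (laurent_coef u x rho (S (S m)) + laurent_coef u x rho m)
      (- laurent_coef u x rho m)).
    replace (laurent_coef u x rho (S (S m)) + laurent_coef u x rho m + - laurent_coef u x rho m)%C
      with (laurent_coef u x rho (S (S m))) in H1 by ring.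
    rewrite Cmod_opp in H1. rewrite !S_INR in *. lra. }
destruct (Hl k) as [_ H]. cbn [laurent_coef] in H.
rewrite Cmod_mult, Cmod_pow, Cmod_R, Rabs_right in H
  by (apply Rle_ge; left; apply Rinv_0_lt_compat; lra).
assert (Hp : 0 < rho ^ S k) by (apply pow_lt; lra).
apply (Rmult_le_compat_l (rho ^ S k)) in H; [|lra].
rewrite pow_inv, <- Rmult_assoc, Rinv_r, Rmult_1_l in H by lra.
eapply Rle_trans; [apply H|]. apply Req_le. unfold B. simpl pow. field. lra.
Qed.

(** The bounds on the derivatives of g make the series - sum g^(k) / z^(k+1) converge;
    it represents s. *)
Lemma linear_ode_bounded r rho q K M (z : C) (s g : nat -> R -> C) (x : R) :
  0 <= r -> r < rho -> rho < q -> q <= Cmod z -> tower r K s -> tower r K g ->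
  (forall k y, s (S k) y = z * s k y + g k y)%C ->
  (forall y, 0 <= y -> Cmod (g 0%nat y) <= M) -> 0 <= x ->
  Cmod (s 0%nat x) <= 2 * (M + rho * (K / (rho - r))) * q / (q - rho) ^ 2.
Proof.
intros Hr Hrho Hq Hz Hs Hg Heq HM Hx.
assert (HK := tower_K_nonneg _ _ _ Hg).
set (D := 2 * (M + rho * (K / (rho - r)))).
assert (HD : 0 <= D).
{ unfold D. assert (H3 := HM 0 (Rle_refl 0)). assert (H4 := Cmod_ge_0 (g 0%nat 0)).
  assert (0 <= K / (rho - r)) by (apply Rdiv_le_0_compat; lra). nra. }
set (t := rho / q).
assert (Ht : 0 < t < 1).
{ unfold t; split; [apply Rdiv_lt_0_compat; lra | apply Rlt_div_l; lra]. }
assert (Hn : forall n, Cmod (s 0%nat x) <=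
  D / q * ((1 - INR (S n) * t ^ n + INR n * t ^ S n) / (1 - t) ^ 2) +
  Cmod (s n x) / q ^ n).
{ induction n.
  - simpl. apply Req_le. field. lra.
  - eapply Rle_trans; [apply IHn|].
    assert (H1 : q * Cmod (s n x) <= Cmod (s (S n) x) + INR (S n) * rho ^ n * D).
    { assert (H2 := tower_half_line_bound r K M g rho x n Hr Hrho Hg HM Hx). fold D in H2.
      apply Rle_trans with (Cmod z * Cmod (s n x)).
      { apply Rmult_le_compat_r; auto using Cmod_ge_0. }
      rewrite <- Cmod_mult.
      replace (z * s n x)%C with (s (S n) x + - g n x)%C by (rewrite Heq; ring).
      eapply Rle_trans; [apply Cmod_triangle|]. rewrite Cmod_opp. lra. }
    assert (Hqn : 0 < q ^ n) by (apply pow_lt; lra).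
    assert (H2 : Cmod (s n x) / q ^ n <= Cmod (s (S n) x) / q ^ S n + D / q * (INR (S n) * t ^ n)).
    { unfold t. replace ((rho / q) ^ n) with (rho ^ n / q ^ n)
        by (unfold Rdiv; rewrite Rpow_mult_distr, pow_inv; auto).
      apply Rmult_le_reg_l with (q * q ^ n); [nra|].
      replace (q * q ^ n * (Cmod (s n x) / q ^ n)) with (q * Cmod (s n x)) by (field; lra).
      replace (q * q ^ n * (Cmod (s (S n) x) / q ^ S n + D / q * (INR (S n) * (rho ^ n / q ^ n))))
        with (Cmod (s (S n) x) + INR (S n) * rho ^ n * D) by (simpl pow; field; lra).
      auto. }
    eapply Rle_trans; [apply Rplus_le_compat_l, H2|].
    apply Req_le. rewrite !S_INR. simpl pow. field. lra. }
replace (D * q / (q - rho) ^ 2) with (D / q * (1 / (1 - t) ^ 2)) by (unfold t; field; lra).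
apply (le_of_lim_zero _ _ (fun n => K * exp (r * x) * (r / q) ^ n)).
- apply is_lim_seq_geom_scal. split; [apply Rdiv_le_0_compat; lra | apply Rlt_div_l; lra].
- intros n. eapply Rle_trans; [apply (Hn n)|]. apply Rplus_le_compat.
  + apply Rmult_le_compat_l; [apply Rdiv_le_0_compat; lra|].
    apply Rmult_le_compat_r; [left; apply Rinv_0_lt_compat, pow_lt; lra|].
    assert (H1 : 0 <= t ^ n) by (apply pow_le; lra). assert (H2 := pos_INR n).
    rewrite S_INR. simpl pow. assert (0 <= INR n * t ^ n * (1 - t)); [|nra].
    apply Rmult_le_pos; [nra|lra].
  + assert (H := tower_bound _ _ _ Hs n x). rewrite Rabs_right in H by lra.
    assert (Hqn : 0 < q ^ n) by (apply pow_lt; lra).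
    apply Rmult_le_reg_r with (q ^ n); auto.
    replace (Cmod (s n x) / q ^ n * q ^ n) with (Cmod (s n x)) by (field; lra).
    replace (K * exp (r * x) * (r / q) ^ n * q ^ n) with (K * r ^ n * exp (r * x)); auto.
    unfold Rdiv. rewrite Rpow_mult_distr, pow_inv. field. lra.
Qed.

(** The operator exp (eta x) D exp (- eta x), iterated j times. *)
Fixpoint shifted (eta : R) (u : nat -> R -> C) (j : nat) : nat -> R -> C :=
  match j with
  | O => u
  | S i => fun k x => (shifted eta u i (S k) x - RtoC eta * shifted eta u i k x)%C
  end.

Definition damped (eta : R) (u : nat -> R -> C) (j : nat) (x : R) : C :=
  (cexp_neg (RtoC eta) x * shifted eta u j 0%nat x)%C.

Lemma shifted_bound r K eta u j :
  0 <= r -> 0 <= eta -> tower r K u -> forall k x,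
  Cmod (shifted eta u j k x) <= K * (r + eta) ^ j * r ^ k * exp (r * Rabs x).
Proof.
intros Hr He Ht. induction j; intros k x.
- simpl. rewrite Rmult_1_r. apply (tower_bound _ _ _ Ht).
- cbn [shifted]. unfold Cminus. eapply Rle_trans; [apply Cmod_triangle|].
  rewrite Cmod_opp, Cmod_mult, Cmod_R, Rabs_right by lra.
  assert (H1 := IHj (S k) x). assert (H2 := IHj k x).
  apply (Rmult_le_compat_l eta) in H2; auto.
  eapply Rle_trans; [apply Rplus_le_compat; [apply H1|apply H2]|].
  apply Req_le. simpl. ring.
Qed.

Lemma Cderiv_minus_scal (u v : R -> C) (x c : R) (u' v' : C) :
  Cderiv u x u' -> Cderiv v x v' ->
  Cderiv (fun t => u t - RtoC c * v t)%C x (u' - RtoC c * v')%C.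
Proof.
intros [H1 H2] [H3 H4]. split.
- apply is_derive_ext with (fun t => Re (u t) - c * Re (v t)).
  { intros t. as_real_equation.
    unfold Cminus, Cplus, Copp, Cmult, RtoC, Re, Im; simpl; ring. }
  replace (Re (u' - RtoC c * v')%C) with (Re u' - c * Re v')
    by (unfold Cminus, Cplus, Copp, Cmult, RtoC, Re, Im; simpl; ring).
  apply (is_derive_minus (fun t => Re (u t)) (fun t => c * Re (v t)) x (Re u') (c * Re v')); auto.
  apply is_derive_scal; auto.
- apply is_derive_ext with (fun t => Im (u t) - c * Im (v t)).
  { intros t. as_real_equation.
    unfold Cminus, Cplus, Copp, Cmult, RtoC, Re, Im; simpl; ring. }
  replace (Im (u' - RtoC c * v')%C) with (Im u' - c * Im v')
    by (unfold Cminus, Cplus, Copp, Cmult, RtoC, Re, Im; simpl; ring).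
  apply (is_derive_minus (fun t => Im (u t)) (fun t => c * Im (v t)) x (Im u') (c * Im v')); auto.
  apply is_derive_scal; auto.
Qed.

Lemma damped_tower r K eta eta0 u :
  0 <= r -> 0 <= eta <= eta0 -> tower r K u -> tower (r + eta0) K (damped eta u).
Proof.
intros Hr He Ht. assert (HK := tower_K_nonneg _ _ _ Ht).
assert (Hd : forall j k x, Cderiv (shifted eta u j k) x (shifted eta u j (S k) x)).
{ induction j; intros k x.
  - apply (tower_deriv _ _ _ Ht).
  - cbn [shifted]. apply Cderiv_minus_scal; apply IHj. }
split.
- intros k x. unfold damped. rewrite Cmod_mult, Cmod_cexp_neg.
  change (Re (RtoC eta)) with eta.
  assert (H := shifted_bound r K eta u k Hr ltac:(lra) Ht 0%nat x).
  rewrite pow_O, Rmult_1_r in H.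
  apply (Rmult_le_compat_l (exp (- (eta * x)))) in H; [|left; apply exp_pos].
  eapply Rle_trans; [apply H|].
  replace (exp (- (eta * x)) * (K * (r + eta) ^ k * exp (r * Rabs x))) with
    (K * (r + eta) ^ k * exp (r * Rabs x + - (eta * x))) by (rewrite exp_plus; ring).
  apply Rmult_le_compat.
  + apply Rmult_le_pos; auto. apply pow_le; lra.
  + left; apply exp_pos.
  + apply Rmult_le_compat_l; auto. apply pow_incr. lra.
  + apply exp_mono. assert (H1 := Rle_abs (- x)). rewrite Rabs_Ropp in H1.
    assert (H2 := Rabs_pos x). nra.
- intros k x. unfold damped. apply (Cderiv_cexp_neg_mult (RtoC eta) (shifted eta u k 0%nat)).
  apply Hd.
Qed.

Lemma sqrt_affine_tangent (al be x y : R) :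
  0 < al -> 0 <= be -> 0 <= x -> 0 <= y ->
  sqrt (al + be * y) <= sqrt (al + be * x) * exp (be / (2 * (al + be * x)) * (y - x)).
Proof.
intros Ha Hb Hx Hy.
assert (Hp : 0 < al + be * x) by nra.
set (eta := be / (2 * (al + be * x))).
rewrite <- (sqrt_Rsqr (exp (eta * (y - x)))) by (left; apply exp_pos).
rewrite <- sqrt_mult; [|lra|apply Rle_0_sqr]. apply sqrt_le_1_alt.
unfold Rsqr. rewrite <- exp_plus.
replace (eta * (y - x) + eta * (y - x)) with (2 * eta * (y - x)) by ring.
assert (H := exp_ineq1_le (2 * eta * (y - x))).
apply Rle_trans with ((al + be * x) * (1 + 2 * eta * (y - x))).
- apply Req_le. unfold eta. field. lra.
- apply Rmult_le_compat_l; lra.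
Qed.

(** A square-root weight is dominated by the exponential tangent to it at the point x under
    consideration, so damping by this exponential reduces the weighted bound to the
    bounded case, with constants independent of x. *)
Lemma linear_ode_weighted r q : 0 <= r -> r < q ->
  exists C0 eta0, 0 < C0 /\ 0 < eta0 /\
  forall K al be (z : C) (s g : nat -> R -> C),
  Re z = 0 -> Cmod z = q -> tower r K s -> tower r K g ->
  (forall k y, s (S k) y = z * s k y + g k y)%C ->
  0 < al -> 0 <= be <= 2 * eta0 * al ->
  (forall y, 0 <= y -> Cmod (g 0%nat y) <= sqrt (al + be * y)) ->
  forall x, 0 <= x -> Cmod (s 0%nat x) <= C0 * (K + sqrt (al + be * x)).
Proof.
intros Hr Hq.
set (eta0 := (q - r) / 4). set (rho := (r + q) / 2).
assert (He0 : 0 < eta0) by (unfold eta0; lra).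
assert (H1 : 0 <= r + eta0) by lra.
assert (H2 : r + eta0 < rho) by (unfold eta0, rho; lra).
assert (H3 : rho < q) by (unfold rho; lra).
set (c1 := 2 * q / (q - rho) ^ 2). set (c2 := rho / (rho - (r + eta0))).
assert (Hc1 : 0 < c1) by (apply Rdiv_lt_0_compat; [lra | apply pow_lt; lra]).
assert (Hc2 : 0 <= c2) by (apply Rdiv_le_0_compat; lra).
exists (c1 * (1 + 2 * c2)), eta0. split; [nra|]. split; auto.
intros K al be z s g Hz0 Hz Hs Hg Heq Ha Hb Hw x Hx.
assert (HK := tower_K_nonneg _ _ _ Hg).
assert (Hp : 0 < al + be * x) by nra.
set (eta := be / (2 * (al + be * x))).
assert (He : 0 <= eta <= eta0).
{ unfold eta; split; [apply Rdiv_le_0_compat; lra|].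
  apply Rle_div_l; [lra|]. assert (0 <= be * x) by nra. nra. }
assert (Hex : eta * x <= 1 / 2).
{ unfold eta. apply Rmult_le_reg_r with (2 * (al + be * x)); [lra|].
  replace (be / (2 * (al + be * x)) * x * (2 * (al + be * x))) with (be * x) by (field; lra).
  lra. }
set (M := sqrt (al + be * x) * exp (- (eta * x))).
assert (Heq' : forall j k y, shifted eta s j (S k) y =
  (z * shifted eta s j k y + shifted eta g j k y)%C).
{ induction j; intros k y; [apply Heq|]. cbn [shifted]. rewrite !IHj. ring. }
assert (Hzm : q <= Cmod (z - RtoC eta)).
{ assert (E1 := Cmod2_alt z). assert (E2 := Cmod2_alt (z - RtoC eta)%C).
  replace (Re (z - RtoC eta)%C) with (Re z - eta) in E2 by (unfold Re, Cminus, Cplus, Copp, RtoC; simpl; ring).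
  replace (Im (z - RtoC eta)%C) with (Im z) in E2 by (unfold Im, Cminus, Cplus, Copp, RtoC; simpl; ring).
  rewrite Hz0 in *. rewrite Hz in E1. assert (H4 := Cmod_ge_0 (z - RtoC eta)%C). nra. }
assert (H := linear_ode_bounded (r + eta0) rho q K M (z - RtoC eta)%C
  (damped eta s) (damped eta g) x H1 H2 H3 Hzm
  (damped_tower r K eta eta0 s Hr He Hs) (damped_tower r K eta eta0 g Hr He Hg)).
assert (H' : Cmod (damped eta s 0%nat x) <= 2 * (M + rho * (K / (rho - (r + eta0)))) * q / (q - rho) ^ 2).
{ apply H; auto.
  - intros k y. unfold damped. cbn [shifted]. rewrite Heq'. ring.
  - intros y Hy. unfold damped. cbn [shifted]. rewrite Cmod_mult, Cmod_cexp_neg.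
    change (Re (RtoC eta)) with eta.
    apply Rle_trans with (exp (- (eta * y)) * (sqrt (al + be * x) * exp (eta * (y - x)))).
    + apply Rmult_le_compat_l; [left; apply exp_pos|].
      eapply Rle_trans; [apply Hw; auto|]. apply sqrt_affine_tangent; lra.
    + apply Req_le. unfold M.
      transitivity (sqrt (al + be * x) * (exp (- (eta * y)) * exp (eta * (y - x)))); [ring|].
      rewrite <- exp_plus. do 2 f_equal. ring. }
unfold damped in H'. cbn [shifted] in H'. rewrite Cmod_mult, Cmod_cexp_neg in H'.
change (Re (RtoC eta)) with eta in H'.
replace (2 * (M + rho * (K / (rho - (r + eta0)))) * q / (q - rho) ^ 2) with
  (c1 * (M + c2 * K)) in H' by (unfold c1, c2; field; lra).
apply (Rmult_le_compat_l (exp (eta * x))) in H'; [|left; apply exp_pos].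
assert (E : exp (eta * x) * exp (- (eta * x)) = 1) by (rewrite <- exp_plus, Rplus_opp_r; apply exp_0).
rewrite <- Rmult_assoc, E, Rmult_1_l in H'.
replace (exp (eta * x) * (c1 * (M + c2 * K))) with
  (c1 * (sqrt (al + be * x) * (exp (eta * x) * exp (- (eta * x))) + c2 * K * exp (eta * x))) in H'
  by (unfold M; ring).
rewrite E, Rmult_1_r in H'.
assert (He2 : exp (eta * x) <= 2).
{ apply Rle_trans with (exp (1 / 2)); [apply exp_mono; auto|].
  assert (E2 : exp (1 / 2) * exp (1 / 2) = exp 1) by (rewrite <- exp_plus; f_equal; lra).
  assert (E3 := exp_le_3). assert (E4 := exp_pos (1 / 2)). nra. }
assert (Hsq := sqrt_pos (al + be * x)).
eapply Rle_trans; [apply H'|]. rewrite (Rmult_assoc c1).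
apply Rmult_le_compat_l; [lra|].
assert (0 <= c2 * K) by nra. assert (c2 * K * exp (eta * x) <= c2 * K * 2) by (apply Rmult_le_compat_l; auto).
assert (0 <= c2 * sqrt (al + be * x)) by nra. nra.
Qed.

(** * Exponential generating functions *)

Definition egf (p : nat -> R) (x : R) : R := PSeries (fun k => p k / INR (fact k)) x.

Definition geometric (r K : R) (p : nat -> R) : Prop :=
  0 <= r /\ forall k, Rabs (p k) <= K * r ^ k.

Lemma geometric_nonneg r K p : geometric r K p -> 0 <= K.
Proof.
intros [_ H]. specialize (H 0%nat). assert (H0 := Rabs_pos (p 0%nat)). simpl in H. lra.
Qed.

Lemma is_series_exp (x : R) : is_series (fun k => x ^ k / INR (fact k)) (exp x).
Proof.
assert (H := is_exp_Reals x). revert H. unfold is_pseries. apply is_series_ext.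
intros n. as_real_equation.
unfold scal; simpl; unfold mult; simpl. rewrite pow_n_pow. reflexivity.
Qed.

Lemma pow_fact_le_exp n t : 0 <= t -> t ^ n / INR (fact n) <= exp t.
Proof.
intros Ht.
assert (H := is_series_exp t).
set (u := fun k => t ^ k / INR (fact k)) in *. change (u n <= exp t).
assert (Hu : forall k, 0 <= u k).
{ intros k. apply Rdiv_le_0_compat; [apply pow_le; auto | apply INR_fact_lt_0]. }
apply (is_lim_seq_le_loc (fun _ => u n) (sum_n u) (u n) (exp t)).
- exists n. intros m Hm. induction Hm.
  + destruct n; [rewrite sum_O; lra|]. rewrite sum_Sn. unfold plus; simpl.
    assert (0 <= sum_n u n); [|lra].
    induction n; [rewrite sum_O; auto|]. rewrite sum_Sn. unfold plus; simpl.
    specialize (Hu (S n)). lra.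
  + rewrite sum_Sn. unfold plus; simpl. specialize (Hu (S m)). lra.
- apply is_lim_seq_const.
- exact H.
Qed.

Lemma geometric_dominated r K p x k : geometric r K p ->
  Rabs (p k / INR (fact k) * x ^ k) <= K * ((r * Rabs x) ^ k / INR (fact k)).
Proof.
intros [Hr Hp]. assert (Hf := INR_fact_lt_0 k).
unfold Rdiv. rewrite !Rabs_mult, Rabs_inv, (Rabs_right (INR (fact k))), <- RPow_abs by lra.
rewrite Rpow_mult_distr.
replace (K * (r ^ k * Rabs x ^ k * / INR (fact k))) with
  (K * r ^ k * / INR (fact k) * Rabs x ^ k) by ring.
apply Rmult_le_compat_r; [apply pow_le, Rabs_pos|].
apply Rmult_le_compat_r; [left; apply Rinv_0_lt_compat; auto | apply Hp].
Qed.

Lemma egf_ex_series r K p x : geometric r K p ->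
  ex_series (fun k => Rabs (p k / INR (fact k) * x ^ k)).
Proof.
intros Hp.
apply (ex_series_le (V := R_CompleteNormedModule)) with
  (fun k => K * ((r * Rabs x) ^ k / INR (fact k))).
- intros k. unfold norm; simpl; unfold abs; simpl. rewrite Rabs_Rabsolu.
  apply geometric_dominated; auto.
- apply ex_series_scal_l_R. eexists; apply is_series_exp.
Qed.

Lemma egf_bound r K p x : geometric r K p -> Rabs (egf p x) <= K * exp (r * Rabs x).
Proof.
intros Hp. unfold egf, PSeries.
eapply Rle_trans; [apply Series_Rabs, (egf_ex_series r K p x Hp)|].
rewrite <- (is_series_unique _ _ (is_series_exp (r * Rabs x))), <- Series_scal_l.
apply Series_le.
- intros k. split; [apply Rabs_pos|]. apply geometric_dominated; auto.
- apply ex_series_scal_l_R. eexists; apply is_series_exp.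
Qed.

Lemma egf_radius r K p x : geometric r K p ->
  Rbar_lt (Rabs x) (CV_radius (fun k => p k / INR (fact k))).
Proof.
intros Hp. apply Rbar_lt_le_trans with (Rabs x + 1); [simpl; lra|].
destruct (CV_radius_bounded (fun k => p k / INR (fact k))) as [H _].
apply H. exists (K * exp (r * (Rabs x + 1))). intros n.
assert (H1 := geometric_dominated r K p (Rabs x + 1) n Hp).
assert (HK := geometric_nonneg _ _ _ Hp). destruct Hp as [Hr _].
rewrite (Rabs_right (Rabs x + 1)) in H1 by (assert (H0 := Rabs_pos x); lra).
eapply Rle_trans; [apply H1|]. apply Rmult_le_compat_l; auto.
apply pow_fact_le_exp. apply Rmult_le_pos; auto. assert (H0 := Rabs_pos x); lra.
Qed.

Lemma egf_ex_pseries r K p x : geometric r K p ->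
  ex_pseries (fun k => p k / INR (fact k)) x.
Proof.
intros Hp. apply CV_radius_inside. eapply egf_radius; eauto.
Qed.

Lemma egf_ext p p' x : (forall k, p k = p' k) -> egf p x = egf p' x.
Proof. intros H. apply PSeries_ext. intros n. rewrite H. reflexivity. Qed.

Lemma egf_deriv r K p x : geometric r K p -> is_derive (egf p) x (egf (fun k => p (S k)) x).
Proof.
intros Hp. assert (H := is_derive_PSeries _ x (egf_radius r K p x Hp)).
replace (egf (fun k => p (S k)) x) with
  (PSeries (PS_derive (fun k => p k / INR (fact k))) x); auto.
apply PSeries_ext. intros n. unfold PS_derive.
rewrite fact_simpl, mult_INR. field. split; first [apply INR_fact_neq_0 | apply not_0_INR; lia].
Qed.

Lemma egf_lin r1 K1 r2 K2 p p' (c d x : R) :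
  geometric r1 K1 p -> geometric r2 K2 p' ->
  egf (fun k => c * p k + d * p' k) x = c * egf p x + d * egf p' x.
Proof.
intros H1 H2. unfold egf.
assert (E1 := egf_ex_pseries _ _ _ x H1). assert (E2 := egf_ex_pseries _ _ _ x H2).
rewrite <- !PSeries_scal, <- PSeries_plus.
- apply PSeries_ext. intros n. unfold PS_plus, PS_scal, plus, scal; simpl; unfold mult; simpl.
  field. apply INR_fact_neq_0.
- apply ex_pseries_scal; auto. apply Rmult_comm.
- apply ex_pseries_scal; auto. apply Rmult_comm.
Qed.

Lemma egf_mult_x p x : x * egf p x = egf (fun k => INR k * p (pred k)) x.
Proof.
unfold egf. rewrite <- PSeries_incr_1. apply PSeries_ext.
intros [|n].
- unfold PS_incr_1. simpl. unfold zero; simpl. unfold Rdiv; ring.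
- unfold PS_incr_1. cbn [pred]. rewrite fact_simpl, mult_INR. field.
  split; first [apply INR_fact_neq_0 | apply not_0_INR; lia].
Qed.

Lemma egf_decr r K p x : geometric r K p ->
  egf p x = p 0%nat + x * egf (fun k => p (S k) / INR (S k)) x.
Proof.
intros Hp. unfold egf. rewrite PSeries_decr_1 by (eapply egf_ex_pseries; eauto).
f_equal; [simpl; field|]. f_equal. apply PSeries_ext. intros n. unfold PS_decr_1.
rewrite fact_simpl, mult_INR. field. split; first [apply INR_fact_neq_0 | apply not_0_INR; lia].
Qed.

Lemma egf_0 p : egf p 0 = p 0%nat.
Proof. unfold egf. rewrite PSeries_0. simpl. field. Qed.

(** * Bessel functions *)

Definition bessel_coef (n m : nat) : R := (-1) ^ m / INR (fact (m + n)).

(** The factor of J_n complementary to (x / 2)^n: computing with it avoids divisions by x. *)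
Definition bessel_series (n : nat) (x : R) : R := egf (bessel_coef n) ((x / 2) ^ 2).

Lemma bessel_coef_geometric n : geometric 1 1 (bessel_coef n).
Proof.
split; [lra|]. intros k. unfold bessel_coef, Rdiv.
rewrite Rabs_mult, pow_1_abs, pow1, Rabs_inv.
assert (H : 1 <= INR (fact (k + n))).
{ apply (le_INR 1). apply lt_O_fact. }
rewrite Rabs_right by lra. rewrite !Rmult_1_l, <- Rinv_1. apply Rinv_le_contravar; lra.
Qed.

Lemma BesselJ_series n x : BesselJ n x = (x / 2) ^ n * bessel_series n x.
Proof.
unfold BesselJ, bessel_series, egf. f_equal. apply PSeries_ext. intros m.
unfold bessel_coef. field. split; apply INR_fact_neq_0.
Qed.

Lemma bessel_series_deriv n x :
  is_derive (bessel_series n) x (- (x / 2) * bessel_series (S n) x).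
Proof.
assert (H := egf_deriv _ _ _ ((x / 2) ^ 2) (bessel_coef_geometric n)).
assert (H1 : is_derive (fun x => (x / 2) ^ 2) x (x / 2)).
{ auto_derive; auto. field. }
assert (H2 := is_derive_comp (egf (bessel_coef n)) (fun x => (x / 2) ^ 2) x _ _ H H1).
replace (- (x / 2) * bessel_series (S n) x) with
  (scal (x / 2) (egf (fun k => bessel_coef n (S k)) ((x / 2) ^ 2))); auto.
unfold scal; simpl; unfold mult; simpl. unfold bessel_series.
transitivity (x / 2 * (-1 * egf (bessel_coef (S n)) (x / 2 * (x / 2 * 1)) +
  0 * egf (bessel_coef n) (x / 2 * (x / 2 * 1)))).
- f_equal. rewrite <- (egf_lin 1 1 1 1) by apply bessel_coef_geometric.
  apply egf_ext. intros k. unfold bessel_coef.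
  replace (S k + n)%nat with (k + S n)%nat by lia. simpl pow.
    field. split; apply INR_fact_neq_0.
- simpl pow. ring.
Qed.

Lemma bessel_series_rec n x :
  (x / 2) ^ 2 * bessel_series (S (S n)) x =
  INR (S n) * bessel_series (S n) x - bessel_series n x.
Proof.
unfold bessel_series. rewrite egf_mult_x.
transitivity (INR (S n) * egf (bessel_coef (S n)) ((x / 2) ^ 2) +
  (-1) * egf (bessel_coef n) ((x / 2) ^ 2)); [|ring].
rewrite <- (egf_lin 1 1 1 1) by apply bessel_coef_geometric.
apply egf_ext. intros [|k]; unfold bessel_coef.
- simpl (INR 0). rewrite Rmult_0_l. cbn [Nat.add pow]. rewrite fact_simpl, mult_INR. field.
  split; first [apply INR_fact_neq_0 | apply not_0_INR; lia].
- cbn [pred]. replace (k + S (S n))%nat with (S (S (k + n))) by lia.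
  replace (S k + S n)%nat with (S (S (k + n))) by lia.
  replace (S k + n)%nat with (S (k + n)) by lia.
  rewrite !fact_simpl, !mult_INR, !S_INR, plus_INR. simpl pow.
  assert (H1 := pos_INR k). assert (H2 := pos_INR n).
  field. repeat split; try lra. apply INR_fact_neq_0.
Qed.

Lemma BesselJ_1_eq x : BesselJ 1 x = x / 2 * bessel_series 1 x.
Proof. rewrite BesselJ_series. ring. Qed.

Lemma BesselJ_0_eq x : BesselJ 0 x = bessel_series 0 x.
Proof. rewrite BesselJ_series. ring. Qed.

Lemma BesselJ_2_eq x : BesselJ 2 x = bessel_series 1 x - BesselJ 0 x.
Proof. rewrite BesselJ_series, BesselJ_0_eq, bessel_series_rec. simpl. ring. Qed.

Lemma BesselJ_0_at_0 : BesselJ 0 0 = 1.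
Proof.
rewrite BesselJ_0_eq. unfold bessel_series. replace ((0 / 2) ^ 2) with 0 by (simpl; field).
rewrite egf_0. unfold bessel_coef. simpl. field.
Qed.

Lemma is_derive_BesselJ_0 x : is_derive (BesselJ 0) x (- BesselJ 1 x).
Proof.
apply is_derive_ext with (bessel_series 0); [intros; symmetry; apply BesselJ_0_eq|].
replace (- BesselJ 1 x) with (- (x / 2) * bessel_series 1 x) by (rewrite BesselJ_1_eq; ring).
apply bessel_series_deriv.
Qed.

Lemma is_derive_BesselJ_1 x :
  is_derive (BesselJ 1) x (BesselJ 0 x - bessel_series 1 x / 2).
Proof.
apply is_derive_ext with (fun x => x / 2 * bessel_series 1 x);
  [intros; symmetry; apply BesselJ_1_eq|].
assert (H := bessel_series_deriv 1 x).
auto_derive.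
- eexists; eauto.
- rewrite (is_derive_unique (fun x : R => bessel_series 1 x) _ _ H).
  assert (H1 := bessel_series_rec 0 x). simpl INR in H1. rewrite BesselJ_0_eq.
  transitivity (bessel_series 1 x / 2 - (x / 2) ^ 2 * bessel_series 2 x); [field|].
  rewrite H1. field.
Qed.

Lemma BesselJ_continuous_0 x : continuous (BesselJ 0) x.
Proof. apply ex_derive_continuous_R. eexists; apply is_derive_BesselJ_0. Qed.

Lemma BesselJ_continuous_1 x : continuous (BesselJ 1) x.
Proof. apply ex_derive_continuous_R. eexists; apply is_derive_BesselJ_1. Qed.

Lemma BesselJ_continuous_2 x : continuous (BesselJ 2) x.
Proof.
apply continuous_ext with (fun x => bessel_series 1 x - BesselJ 0 x).
- intros; symmetry; apply BesselJ_2_eq.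
- apply (continuous_minus (bessel_series 1) (BesselJ 0)); [|apply BesselJ_continuous_0].
  apply ex_derive_continuous_R. eexists; apply bessel_series_deriv.
Qed.

(** The energy F = x (J0^2 + J1^2) - J0 J1 satisfies F' = J0 J1 / x, hence F x / (x - 1/2)
    is nonincreasing. *)
Lemma BesselJ_decay : exists M, 0 < M /\ forall x, 1 <= x ->
  Rabs (BesselJ 0 x) <= M / sqrt x /\ Rabs (BesselJ 1 x) <= M / sqrt x.
Proof.
set (F := fun x => x * (BesselJ 0 x ^ 2 + BesselJ 1 x ^ 2) - BesselJ 0 x * BesselJ 1 x).
set (G := fun x => F x * (x / (x - 1 / 2))).
assert (HdF : forall x, 1 <= x -> is_derive F x (BesselJ 0 x * BesselJ 1 x / x)).
{ intros x Hx. unfold F.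
  assert (H0 := is_derive_BesselJ_0 x). assert (H1 := is_derive_BesselJ_1 x).
  assert (E : bessel_series 1 x = 2 * BesselJ 1 x / x) by (rewrite BesselJ_1_eq; field; lra).
  auto_derive.
  - repeat split; eexists; eauto.
  - rewrite (is_derive_unique (fun x : R => BesselJ 0 x) _ _ H0),
      (is_derive_unique (fun x : R => BesselJ 1 x) _ _ H1), E. field. lra. }
assert (HG : forall x, 1 <= x -> G x <= G 1).
{ intros x Hx.
  apply (mean_value_le G (fun x => BesselJ 0 x * BesselJ 1 x / x * (x / (x - 1 / 2)) +
    F x * (- (1 / 2) / (x - 1 / 2) ^ 2)) 1 x Hx).
  - intros t Ht. unfold G. apply (is_derive_mult F (fun t => t / (t - 1 / 2))).
    + apply HdF; lra.
    + auto_derive; [lra | field; lra].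
    + intros; apply Rmult_comm.
  - intros t Ht. set (a := BesselJ 0 t). set (b := BesselJ 1 t).
    unfold F. fold a b.
    replace (a * b / t * (t / (t - 1 / 2)) +
      (t * (a ^ 2 + b ^ 2) - a * b) * (- (1 / 2) / (t - 1 / 2) ^ 2)) with
      (- ((a - b) ^ 2 * t * / (2 * (t - 1 / 2) ^ 2))) by (field; lra).
    assert (0 <= (a - b) ^ 2 * t * / (2 * (t - 1 / 2) ^ 2)); [|lra].
    apply Rmult_le_pos; [apply Rmult_le_pos; [apply pow2_ge_0|lra]|].
    left; apply Rinv_0_lt_compat. assert (0 < (t - 1 / 2) ^ 2) by (apply pow_lt; lra). lra. }
assert (HF : forall x, 1 <= x -> x * (BesselJ 0 x ^ 2 + BesselJ 1 x ^ 2) <= G 1).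
{ intros x Hx. eapply Rle_trans; [|apply (HG x Hx)]. unfold G, F.
  set (a := BesselJ 0 x). set (b := BesselJ 1 x).
  replace ((x * (a ^ 2 + b ^ 2) - a * b) * (x / (x - 1 / 2))) with
    (x * (a ^ 2 + b ^ 2) + (a - b) ^ 2 / 2 * (x / (x - 1 / 2))) by (field; lra).
  assert (0 <= (a - b) ^ 2 / 2 * (x / (x - 1 / 2))); [|lra].
  apply Rmult_le_pos; [assert (H := pow2_ge_0 (a - b)); lra|].
  apply Rdiv_le_0_compat; lra. }
assert (HG1 : 0 <= G 1).
{ eapply Rle_trans; [|apply (HF 1); lra].
  assert (H0 := pow2_ge_0 (BesselJ 0 1)). assert (H1 := pow2_ge_0 (BesselJ 1 1)). lra. }
exists (sqrt (G 1 + 1)). split; [apply sqrt_lt_R0; lra|].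
assert (Hgen : forall x a, 1 <= x -> x * a ^ 2 <= G 1 -> Rabs a <= sqrt (G 1 + 1) / sqrt x).
{ intros x a Hx H. assert (Hs : 0 < sqrt x) by (apply sqrt_lt_R0; lra).
  apply Rle_div_r; auto. rewrite <- sqrt_Rsqr_abs, <- sqrt_mult; [|apply Rle_0_sqr|lra].
  apply sqrt_le_1_alt. unfold Rsqr. lra. }
intros x Hx. assert (H := HF x Hx).
assert (H0 := pow2_ge_0 (BesselJ 0 x)). assert (H1 := pow2_ge_0 (BesselJ 1 x)).
split; apply Hgen; auto; nra.
Qed.

(** * The integral of J0 over the half-line *)

(** The integral of exp (- T x) over the half-line is 1 / T. *)
Lemma damped_integral_bound (h : R -> R) (B T X I : R) : 0 <= X -> 0 < T -> 0 <= B ->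
  (forall x, 0 <= x <= X -> Rabs (h x) <= B) ->
  is_RInt (fun x => exp (- (T * x)) * h x) 0 X I -> Rabs I <= B / T.
Proof.
intros HX HT HB Hh HI.
assert (HG : is_RInt (fun x => B * exp (- (T * x))) 0 X
  (- (B / T) * exp (- (T * X)) - - (B / T) * exp (- (T * 0)))).
{ apply (is_RInt_deriv (fun x => - (B / T) * exp (- (T * x)))); auto.
  - intros x _. auto_derive; auto. field. lra.
  - intros x _. apply ex_derive_continuous_R. auto_derive; auto. }
assert (Hle : forall x, 0 <= x <= X -> norm (exp (- (T * x)) * h x) <= B * exp (- (T * x))).
{ intros x Hx. change (Rabs (exp (- (T * x)) * h x) <= B * exp (- (T * x))).
  assert (He := exp_pos (- (T * x))).
  rewrite Rabs_mult, (Rabs_right (exp (- (T * x)))), Rmult_comm by lra.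
  apply Rmult_le_compat_r; [lra | apply (Hh x Hx)]. }
assert (H := norm_RInt_le _ _ 0 X _ _ HX Hle HI HG).
change (norm I) with (Rabs I) in H.
rewrite Rmult_0_r, Ropp_0, exp_0 in H.
assert (He := exp_pos (- (T * X))).
assert (0 <= B / T) by (apply Rdiv_le_0_compat; lra). nra.
Qed.

(** Truncation at X keeps every integral proper; the identities below are exact for finite X. *)
Definition laplace_J0 (X t : R) : R := RInt (fun x => exp (- (t * x)) * BesselJ 0 x) 0 X.

Lemma continuous_exp_lin t x : continuous (fun x => exp (- (t * x))) x.
Proof. apply ex_derive_continuous_R. auto_derive; auto. Qed.

Lemma laplace_J0_deriv X t :
  is_derive (laplace_J0 X) t (RInt (fun x => - x * exp (- (t * x)) * BesselJ 0 x) 0 X).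
Proof.
unfold laplace_J0.
assert (HD : forall u v, is_derive (fun z => exp (- (z * v)) * BesselJ 0 v) u
  (- v * exp (- (u * v)) * BesselJ 0 v)).
{ intros u v. auto_derive; auto. ring. }
replace (RInt (fun x => - x * exp (- (t * x)) * BesselJ 0 x) 0 X) with
  (RInt (fun v => Derive (fun u => exp (- (u * v)) * BesselJ 0 v) t) 0 X).
- apply is_derive_RInt_param.
  + apply filter_forall. intros u v _. eexists; apply HD.
  + intros v _. apply continuity_2d_pt_ext with
      (fun u v => (- v * exp (- (u * v))) * BesselJ 0 v).
    { intros u w. symmetry. apply is_derive_unique, HD. }
    apply continuity_2d_pt_mult.
    * apply continuity_2d_pt_mult.
      -- apply continuity_2d_pt_opp, continuity_2d_pt_id2.
      -- apply (continuity_1d_2d_pt_comp exp (fun u v => - (u * v))).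
         ++ apply derivable_continuous_pt, derivable_pt_exp.
         ++ apply continuity_2d_pt_opp, continuity_2d_pt_mult;
              [apply continuity_2d_pt_id1 | apply continuity_2d_pt_id2].
    * apply (continuity_1d_2d_pt_comp (BesselJ 0) (fun u v => v)).
      -- apply continuity_pt_filterlim, BesselJ_continuous_0.
      -- apply continuity_2d_pt_id2.
  + apply filter_forall. intros u. apply ex_RInt_cont. intros x.
    apply (continuous_mult (fun x => exp (- (u * x))) (BesselJ 0));
      [apply continuous_exp_lin | apply BesselJ_continuous_0].
- apply RInt_ext. intros v _. apply is_derive_unique, HD.
Qed.

(** The Bessel equation gives (1 + t^2) Z' + t Z up to a boundary term at X. *)
Lemma laplace_J0_ode X t : 0 <= X ->
  (1 + t ^ 2) * RInt (fun x => - x * exp (- (t * x)) * BesselJ 0 x) 0 X + t * laplace_J0 X t =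
  - (exp (- (t * X)) * (X * (BesselJ 1 X - t * BesselJ 0 X))).
Proof.
intros HX.
assert (C1 : ex_RInt (fun x => - x * exp (- (t * x)) * BesselJ 0 x) 0 X).
{ apply ex_RInt_cont. intros x.
  apply (continuous_mult (fun x => - x * exp (- (t * x))) (BesselJ 0)); [|apply BesselJ_continuous_0].
  apply ex_derive_continuous_R. auto_derive; auto. }
assert (C2 : ex_RInt (fun x => exp (- (t * x)) * BesselJ 0 x) 0 X).
{ apply ex_RInt_cont. intros x.
  apply (continuous_mult (fun x => exp (- (t * x))) (BesselJ 0)); [|apply BesselJ_continuous_0].
  apply continuous_exp_lin. }
apply (RInt_correct (V := R_CompleteNormedModule)) in C1.
apply (RInt_correct (V := R_CompleteNormedModule)) in C2. fold (laplace_J0 X t) in C2.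
assert (H := is_RInt_plus _ _ _ _ _ _ (is_RInt_scal _ _ _ (1 + t ^ 2) _ C1)
  (is_RInt_scal _ _ _ t _ C2)).
assert (H' : is_RInt (fun x => - (exp (- (t * x)) * ((1 + t ^ 2) * x * BesselJ 0 x - t * BesselJ 0 x)))
  0 X (- (exp (- (t * X)) * (X * (BesselJ 1 X - t * BesselJ 0 X))) -
       - (exp (- (t * 0)) * (0 * (BesselJ 1 0 - t * BesselJ 0 0))))).
{ apply (is_RInt_deriv (fun x => - (exp (- (t * x)) * (x * (BesselJ 1 x - t * BesselJ 0 x))))); auto.
  - intros x _. assert (D0 := is_derive_BesselJ_0 x). assert (D1 := is_derive_BesselJ_1 x).
    auto_derive.
    + repeat split; eexists; eauto.
    + rewrite (is_derive_unique (fun x : R => BesselJ 0 x) _ _ D0),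
        (is_derive_unique (fun x : R => BesselJ 1 x) _ _ D1), (BesselJ_1_eq x). field.
  - intros x _.
    apply (continuous_ext (fun x => (- (exp (- (t * x)) * ((1 + t ^ 2) * x - t))) * BesselJ 0 x)).
    + intros y. as_real_equation. ring.
    + apply (continuous_mult (fun x => - (exp (- (t * x)) * ((1 + t ^ 2) * x - t))) (BesselJ 0));
        [|apply BesselJ_continuous_0].
      apply ex_derive_continuous_R. auto_derive; auto. }
apply (is_RInt_unique (V := R_CompleteNormedModule)) in H.
apply (is_RInt_unique (V := R_CompleteNormedModule)) in H'.
rewrite Rmult_0_l, Rmult_0_r, Ropp_0, Rminus_0_r in H'.
rewrite <- H'.
change (plus (scal (1 + t ^ 2) (RInt (fun x => - x * exp (- (t * x)) * BesselJ 0 x) 0 X))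
  (scal t (laplace_J0 X t)) : R) with ((1 + t ^ 2) *
  RInt (fun x => - x * exp (- (t * x)) * BesselJ 0 x) 0 X + t * laplace_J0 X t) in H.
etransitivity; [symmetry; exact H|].
apply RInt_ext. intros x _. unfold plus, scal; simpl; unfold mult; simpl. ring.
Qed.

Lemma BesselJ_bounded X : 0 <= X ->
  exists B, 0 <= B /\ forall x, 0 <= x <= X -> Rabs (BesselJ 0 x) <= B /\ Rabs (BesselJ 1 x) <= B.
Proof.
intros HX. set (e := exp ((X / 2) ^ 2)).
assert (Hb : forall n x, 0 <= x <= X -> Rabs (bessel_series n x) <= e).
{ intros n x Hx. unfold bessel_series.
  eapply Rle_trans; [apply (egf_bound 1 1), bessel_coef_geometric|].
  rewrite !Rmult_1_l, Rabs_right by (apply Rle_ge, pow2_ge_0).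
  assert (H : (x / 2) ^ 2 <= (X / 2) ^ 2) by (apply pow_incr; lra).
  destruct H as [H|H]; [left; apply exp_increasing; auto | unfold e; rewrite H; lra]. }
assert (He : 0 < e) by apply exp_pos.
exists ((1 + X) * e). split; [nra|]. intros x Hx. split.
- rewrite BesselJ_0_eq. assert (H := Hb 0%nat x Hx). nra.
- rewrite BesselJ_1_eq, Rabs_mult, (Rabs_right (x / 2)) by lra.
  assert (H := Hb 1%nat x Hx). assert (H0 := Rabs_pos (bessel_series 1 x)). nra.
Qed.

(** As t goes to infinity with X fixed, the Laplace integral concentrates at J0(0) = 1. *)
Lemma laplace_J0_large X : 0 < X ->
  exists B, forall T, 1 <= T -> Rabs (sqrt (1 + T ^ 2) * laplace_J0 X T - 1) <= B / T.
Proof.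
intros HX. destruct (BesselJ_bounded X ltac:(lra)) as [B [HB Hb]].
exists (B + B + B / X). intros T HT.
assert (C2 : forall n, (forall x, continuous (BesselJ n) x) ->
  ex_RInt (fun x => exp (- (T * x)) * BesselJ n x) 0 X).
{ intros n Hn. apply ex_RInt_cont. intros x.
  apply (continuous_mult (fun x => exp (- (T * x))) (BesselJ n)); [|apply Hn].
  apply continuous_exp_lin. }
assert (I0 := RInt_correct (V := R_CompleteNormedModule) _ _ _ (C2 0%nat BesselJ_continuous_0)).
assert (I1 := RInt_correct (V := R_CompleteNormedModule) _ _ _ (C2 1%nat BesselJ_continuous_1)).
fold (laplace_J0 X T) in I0. set (Z := laplace_J0 X T) in *.
set (Z1 := RInt (fun x => exp (- (T * x)) * BesselJ 1 x) 0 X) in *.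
assert (B0 := damped_integral_bound (BesselJ 0) B T X Z ltac:(lra) ltac:(lra) HB
  ltac:(intros; apply Hb; auto) I0).
assert (B1 := damped_integral_bound (BesselJ 1) B T X Z1 ltac:(lra) ltac:(lra) HB
  ltac:(intros; apply Hb; auto) I1).
assert (E : T * Z + Z1 = 1 - exp (- (T * X)) * BesselJ 0 X).
{ assert (H := is_RInt_plus _ _ _ _ _ _ (is_RInt_scal _ _ _ T _ I0) I1).
  assert (H' : is_RInt (fun x => exp (- (T * x)) * (T * BesselJ 0 x + BesselJ 1 x)) 0 X
    (- (exp (- (T * X)) * BesselJ 0 X) - - (exp (- (T * 0)) * BesselJ 0 0))).
  { apply (is_RInt_deriv (fun x => - (exp (- (T * x)) * BesselJ 0 x))); [lra| |].
    - intros x _. assert (D0 := is_derive_BesselJ_0 x). auto_derive.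
      + eexists; eauto.
      + rewrite (is_derive_unique (fun x : R => BesselJ 0 x) _ _ D0). ring.
    - intros x _. apply (continuous_mult (fun x => exp (- (T * x)))
        (fun x => T * BesselJ 0 x + BesselJ 1 x)); [apply continuous_exp_lin|].
      apply (continuous_plus (fun x => T * BesselJ 0 x) (BesselJ 1)); [|apply BesselJ_continuous_1].
      apply (continuous_scal_r T (BesselJ 0)), BesselJ_continuous_0. }
  apply (is_RInt_unique (V := R_CompleteNormedModule)) in H.
apply (is_RInt_unique (V := R_CompleteNormedModule)) in H'.
  rewrite Rmult_0_r, Ropp_0, exp_0, BesselJ_0_at_0 in H'.
  replace (1 - exp (- (T * X)) * BesselJ 0 X) with
    (- (exp (- (T * X)) * BesselJ 0 X) - - (1 * 1)) by ring.
  rewrite <- H'. etransitivity; [symmetry; exact H|].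
  apply RInt_ext. intros x _. unfold plus, scal; simpl; unfold mult; simpl. ring. }
assert (Hs : T <= sqrt (1 + T ^ 2) <= T + 1).
{ split.
  - rewrite <- (sqrt_pow2 T) at 1 by lra. apply sqrt_le_1_alt. lra.
  - rewrite <- (sqrt_pow2 (T + 1)) by lra. apply sqrt_le_1_alt. nra. }
assert (He : exp (- (T * X)) * Rabs (BesselJ 0 X) <= B / X / T).
{ assert (H1 := exp_ineq1_le (T * X)). assert (0 < T * X) by nra.
  destruct (Hb X ltac:(lra)) as [H2 _].
  rewrite exp_Ropp. apply Rle_trans with (/ (T * X) * B).
  - apply Rmult_le_compat; auto using Rabs_pos.
    + left; apply Rinv_0_lt_compat, exp_pos.
    + apply Rinv_le_contravar; lra.
  - apply Req_le. field. lra. }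
replace (sqrt (1 + T ^ 2) * Z - 1) with
  ((sqrt (1 + T ^ 2) - T) * Z + (- Z1 + - (exp (- (T * X)) * BesselJ 0 X)))
  by (replace (exp (- (T * X)) * BesselJ 0 X) with (1 - (T * Z + Z1)) by lra; ring).
eapply Rle_trans; [apply Rabs_triang|]. rewrite Rabs_mult, (Rabs_right (sqrt _ - T)) by lra.
eapply Rle_trans; [apply Rplus_le_compat_l, Rabs_triang|].
rewrite !Rabs_Ropp, Rabs_mult, (Rabs_right (exp _)) by (apply Rle_ge; left; apply exp_pos).
assert (H1 := Rabs_pos Z).
replace ((B + B + B / X) / T) with (B / T + (B / T + B / X / T)) by (field; lra).
nra.
Qed.

(** sqrt (1 + t^2) times the truncated Laplace integral has a derivative controlled by the
    boundary values at X only, and it tends to 1 as t goes to infinity. *)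
Lemma RInt_BesselJ_0 X : 0 < X ->
  Rabs (RInt (BesselJ 0) 0 X - 1) <= Rabs (BesselJ 0 X) + Rabs (BesselJ 1 X).
Proof.
intros HX. set (b := Rabs (BesselJ 0 X) + Rabs (BesselJ 1 X)).
set (W := fun t => sqrt (1 + t ^ 2) * laplace_J0 X t).
set (dW := fun t => - (exp (- (t * X)) * (X * (BesselJ 1 X - t * BesselJ 0 X))) / sqrt (1 + t ^ 2)).
assert (Hsq : forall t, 0 < sqrt (1 + t ^ 2)).
{ intros t. apply sqrt_lt_R0. assert (H := pow2_ge_0 t). lra. }
assert (HW : forall t, is_derive W t (dW t)).
{ intros t. assert (H := laplace_J0_deriv X t). assert (Hp := Hsq t).
  assert (Ho := laplace_J0_ode X t ltac:(lra)).
  unfold W, dW. rewrite <- Ho. auto_derive.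
  - split; [assert (H0 := pow2_ge_0 t); simpl in H0; lra | split; auto]. eexists; eauto.
  - rewrite (is_derive_unique (fun x : R => laplace_J0 X x) _ _ H).
    set (I := RInt (fun x => - x * exp (- (t * x)) * BesselJ 0 x) 0 X).
    assert (E : sqrt (1 + t ^ 2) * sqrt (1 + t ^ 2) = 1 + t ^ 2)
      by (apply sqrt_sqrt; assert (H0 := pow2_ge_0 t); lra).
    replace (t * (t * 1)) with (t ^ 2) by ring.
    set (s := sqrt (1 + t ^ 2)) in *. rewrite <- E. field. lra. }
assert (HdW : forall t, 0 <= t -> Rabs (dW t) <= b * X * exp (- (t * X))).
{ intros t Ht. unfold dW, Rdiv. rewrite Rabs_mult, Rabs_Ropp, !Rabs_mult, Rabs_inv.
  assert (Hp := Hsq t).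
  rewrite (Rabs_right (exp _)) by (apply Rle_ge; left; apply exp_pos).
  rewrite (Rabs_right X), (Rabs_right (sqrt _)) by lra.
  assert (H1 : Rabs (BesselJ 1 X - t * BesselJ 0 X) <= b * sqrt (1 + t ^ 2)).
  { unfold Rminus. eapply Rle_trans; [apply Rabs_triang|].
    rewrite Rabs_Ropp, Rabs_mult, (Rabs_right t) by lra.
    assert (1 <= sqrt (1 + t ^ 2)).
    { rewrite <- sqrt_1 at 1. apply sqrt_le_1_alt. assert (H := pow2_ge_0 t). lra. }
    assert (t <= sqrt (1 + t ^ 2)).
    { rewrite <- (sqrt_pow2 t) at 1 by lra. apply sqrt_le_1_alt. lra. }
    unfold b. assert (H2 := Rabs_pos (BesselJ 0 X)). assert (H3 := Rabs_pos (BesselJ 1 X)). nra. }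
  assert (He := exp_pos (- (t * X))).
  apply (Rle_div_l _ _ (sqrt (1 + t ^ 2))); auto.
  replace (b * X * exp (- (t * X)) * sqrt (1 + t ^ 2)) with
    (exp (- (t * X)) * (X * (b * sqrt (1 + t ^ 2)))) by ring.
  apply Rmult_le_compat_l; [lra|]. apply Rmult_le_compat_l; lra. }
assert (Hpsi : forall t, is_derive (fun t => - b * exp (- (t * X))) t (b * X * exp (- (t * X)))).
{ intros t. auto_derive; auto. ring. }
assert (Hb : 0 <= b).
{ unfold b. assert (H2 := Rabs_pos (BesselJ 0 X)). assert (H3 := Rabs_pos (BesselJ 1 X)). lra. }
assert (HWT : forall T, 0 <= T -> Rabs (W T - W 0) <= b).
{ intros T HT. assert (He := exp_pos (- (T * X))).
  assert (Hc : forall s, Rabs s = 1 -> s * (W T - W 0) <= b).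
  { intros s Hs.
    assert (H := mean_value_le (fun t => s * W t - (- b * exp (- (t * X))))
      (fun t => s * dW t - b * X * exp (- (t * X))) 0 T HT
      ltac:(intros t _; apply (is_derive_minus (fun t => s * W t) (fun t => - b * exp (- (t * X)))
          t (s * dW t) (b * X * exp (- (t * X)))); [apply is_derive_scal, HW | apply Hpsi])
      ltac:(intros t Ht; assert (H1 := HdW t ltac:(lra)); assert (H2 := Rle_abs (s * dW t));
        rewrite Rabs_mult, Hs, Rmult_1_l in H2; lra)).
    cbv beta in H. rewrite Rmult_0_l, Ropp_0, exp_0 in H.
    assert (0 <= b * exp (- (T * X))) by nra. lra. }
  apply Rabs_le. assert (H1 := Hc 1 Rabs_R1).
  assert (H2 := Hc (-1) ltac:(rewrite Rabs_left; lra)). lra. }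
assert (HW0 : W 0 = RInt (BesselJ 0) 0 X).
{ unfold W, laplace_J0. replace (1 + 0 ^ 2) with 1 by ring. rewrite sqrt_1, Rmult_1_l.
  apply RInt_ext. intros x _. rewrite Rmult_0_l, Ropp_0, exp_0, Rmult_1_l. reflexivity. }
destruct (laplace_J0_large X HX) as [B HB].
rewrite <- HW0.
apply (is_lim_seq_le (fun _ => Rabs (W 0 - 1)) (fun n => b + B / (INR n + 1)) (Rabs (W 0 - 1)) b).
- intros n. assert (Hn := pos_INR n).
  assert (H1 := HWT (INR n + 1) ltac:(lra)). assert (H2 := HB (INR n + 1) ltac:(lra)).
  change (sqrt (1 + (INR n + 1) ^ 2) * laplace_J0 X (INR n + 1)) with (W (INR n + 1)) in H2.
  replace (W 0 - 1) with (- (W (INR n + 1) - W 0) + (W (INR n + 1) - 1)) by ring.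
  eapply Rle_trans; [apply Rabs_triang|]. rewrite Rabs_Ropp. lra.
- apply is_lim_seq_const.
- replace (Finite b) with (Rbar_plus b (Rbar_mult B 0)) by (simpl; f_equal; ring).
  apply is_lim_seq_plus'; [apply is_lim_seq_const|].
  apply (is_lim_seq_scal_l (fun n => / (INR n + 1)) B 0).
  apply (is_lim_seq_ext (fun n => / INR (S n))); [intros; rewrite S_INR; reflexivity|].
  replace (Finite 0) with (Rbar_inv p_infty) by reflexivity.
  apply is_lim_seq_inv; [|discriminate].
  apply (is_lim_seq_incr_1 INR), is_lim_seq_INR.
Qed.

(** * Sequences of at most geometric growth *)

Definition exp_type (r : R) (p : nat -> R) : Prop := exists K, geometric r K p.

Lemma exp_type_ext r p p' : (forall k, p k = p' k) -> exp_type r p -> exp_type r p'.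
Proof. intros H [K [Hr Hp]]. exists K; split; auto. intros k; rewrite <- H; auto. Qed.

Lemma exp_type_lin r p p' c d : exp_type r p -> exp_type r p' ->
  exp_type r (fun k => c * p k + d * p' k).
Proof.
intros [K [Hr Hp]] [K' [_ Hp']]. exists (Rabs c * K + Rabs d * K'); split; auto.
intros k. eapply Rle_trans; [apply Rabs_triang|]. rewrite !Rabs_mult.
assert (H1 := Rmult_le_compat_l _ _ _ (Rabs_pos c) (Hp k)).
assert (H2 := Rmult_le_compat_l _ _ _ (Rabs_pos d) (Hp' k)). lra.
Qed.

Lemma exp_type_shift r p : exp_type r p -> exp_type r (fun k => p (S k)).
Proof.
intros [K [Hr Hp]]. exists (K * r); split; auto. intros k.
eapply Rle_trans; [apply Hp|]. simpl. apply Req_le. ring.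
Qed.

Lemma exp_type_mono r r' p : r <= r' -> exp_type r p -> exp_type r' p.
Proof.
intros Hr [K Hp]. assert (HK := geometric_nonneg _ _ _ Hp). destruct Hp as [H0 Hp].
exists K; split; [lra|]. intros k. eapply Rle_trans; [apply Hp|].
apply Rmult_le_compat_l; auto. apply pow_incr. lra.
Qed.

Lemma exp_type_le r p p' : (forall k, Rabs (p' k) <= Rabs (p k)) -> exp_type r p -> exp_type r p'.
Proof.
intros H [K [H0 Hp]]. exists K; split; auto. intros k. eapply Rle_trans; [apply H|apply Hp].
Qed.

Lemma exp_type_linear_factor a r p : 0 < a < r -> exp_type a p ->
  exp_type r (fun k => (INR k + 1) * p k).
Proof.
intros Har [K Hp]. assert (HK := geometric_nonneg _ _ _ Hp). destruct Hp as [_ Hp].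
destruct (linear_le_geometric a r Har) as [c [Hc Hn]].
exists (K * c); split; [lra|]. intros k. assert (H := pos_INR k).
rewrite Rabs_mult, Rabs_right by lra.
apply Rle_trans with (K * ((INR k + 1) * a ^ k)).
- assert (H1 := Rmult_le_compat_l (INR k + 1) _ _ ltac:(lra) (Hp k)). lra.
- rewrite Rmult_assoc. apply Rmult_le_compat_l; auto.
Qed.

(** Multiplication by x of the function with derivatives p at 0. *)
Lemma exp_type_mult_x a r p : 0 < a < r -> exp_type a p ->
  exp_type r (fun k => INR k * p (pred k)).
Proof.
intros Har Hp. destruct (exp_type_linear_factor a r p Har Hp) as [K HK].
assert (HK0 := geometric_nonneg _ _ _ HK). destruct HK as [Hr HK].
exists (K / r); split; auto. intros [|k].
- simpl. rewrite Rmult_0_l, Rabs_R0, Rmult_1_r. apply Rdiv_le_0_compat; lra.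
- cbn [pred]. rewrite S_INR. eapply Rle_trans; [apply HK|].
  apply Req_le. simpl. field. lra.
Qed.

Lemma egf_pair_tower r p p' : exp_type r p -> exp_type r p' ->
  exists K, tower r K (fun j x => (egf (fun k => p (k + j)%nat) x, egf (fun k => p' (k + j)%nat) x)).
Proof.
assert (Hsh : forall r K p j, geometric r K p -> geometric r (K * r ^ j) (fun k => p (k + j)%nat)).
{ intros r0 K0 p0 j [H0 H]. split; auto. intros k. eapply Rle_trans; [apply H|].
  rewrite pow_add. apply Req_le; ring. }
intros [K Hp] [K' Hp']. exists (K + K'). split.
- intros j x. eapply Rle_trans; [apply Cmod_le_Re_Im|]. cbn [Re Im fst snd].
  assert (H1 := egf_bound _ _ _ x (Hsh r K p j Hp)).
  assert (H2 := egf_bound _ _ _ x (Hsh r K' p' j Hp')). lra.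
- intros j x. split; cbn [Re Im fst snd].
  + assert (H := egf_deriv _ _ _ x (Hsh r K p j Hp)).
    replace (egf (fun k => p (k + S j)%nat) x) with (egf (fun k => p (S k + j)%nat) x); auto.
    apply egf_ext. intros k. f_equal. lia.
  + assert (H := egf_deriv _ _ _ x (Hsh r K' p' j Hp')).
    replace (egf (fun k => p' (k + S j)%nat) x) with (egf (fun k => p' (S k + j)%nat) x); auto.
    apply egf_ext. intros k. f_equal. lia.
Qed.

(** * The formal antiderivative *)

(** The product of the factors (k + 2 i) / (k + 2 i + 1), i < j, which the recurrence
    hankel_coef_rec accumulates. *)
Fixpoint double_ratio (k j : nat) : R :=
  match j with
  | O => 1
  | S i => INR k / INR (S k) * double_ratio (S (S k)) i
  end.

Lemma double_ratio_bound k j : 0 <= double_ratio k j <= 1.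
Proof.
revert k; induction j; intros k; simpl double_ratio; [lra|].
destruct (IHj (S (S k))) as [H1 H2].
assert (Hk := pos_INR k).
assert (H : 0 <= INR k / INR (S k) <= 1).
{ rewrite S_INR. split; [apply Rdiv_le_0_compat; lra | apply Rle_div_l; lra]. }
change (0 <= INR k / INR (S k) * double_ratio (S (S k)) j <= 1). nra.
Qed.

Definition hankel_term (q : R) (phi : nat -> R) (k j : nat) : R :=
  - ((-1) ^ j * (INR (k + 2 * j) + 2) / q ^ (2 * j + 2) * phi (k + 2 * j)%nat * double_ratio k j).

(** The derivatives p_k of P at 0: the solution of hankel_coef_rec obtained by iterating it,
    hankel_term being the contribution of phi (k + 2 j). *)
Definition hankel_coef (q : R) (phi : nat -> R) (k : nat) : R := Series (hankel_term q phi k).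

Section Antiderivative.
Variables (phi : nat -> R) (a q : R).
Hypothesis (Ha : 0 < a < q).
Hypothesis (Hphi : exp_type a phi).

Notation p := (hankel_coef q phi).

(** The terms decay like (2 j + k + 2) (a / q)^(2 j), since double_ratio is at most 1. *)
Lemma hankel_term_bound : exists M, 0 <= M /\ forall k,
  ex_series (fun j => Rabs (hankel_term q phi k j)) /\
  Series (fun j => Rabs (hankel_term q phi k j)) <= M * ((INR k + 1) * a ^ k).
Proof.
destruct Hphi as [K HK]. assert (HK0 := geometric_nonneg _ _ _ HK). destruct HK as [_ HK].
set (t := a ^ 2 / q ^ 2). set (s := (1 + t) / 2).
assert (Hq2 : 0 < q ^ 2) by (apply pow_lt; lra).
assert (Ht : 0 < t < 1).
{ unfold t. split; [apply Rdiv_lt_0_compat; auto; apply pow_lt; lra|].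
  apply Rlt_div_l; [auto | nra]. }
assert (Hs : 0 <= s < 1) by (unfold s; lra).
destruct (linear_le_geometric t s ltac:(unfold s; lra)) as [c [Hc Hn]].
assert (Hb : forall k j, Rabs (hankel_term q phi k j) <=
  (2 * K * c / q ^ 2 * ((INR k + 1) * a ^ k)) * s ^ j).
{ intros k j. assert (Hk := pos_INR k). assert (Hj := pos_INR j).
  unfold hankel_term. rewrite Rabs_Ropp. unfold Rdiv.
  rewrite !Rabs_mult, pow_1_abs, Rmult_1_l, Rabs_inv.
  destruct (double_ratio_bound k j) as [Hw0 Hw1].
  rewrite (Rabs_right (double_ratio k j)) by lra.
  assert (Hp2 := pos_INR (k + 2 * j)).
  rewrite (Rabs_right (INR (k + 2 * j) + 2)) by lra.
  assert (Hqj : 0 < q ^ (2 * j + 2)) by (apply pow_lt; lra).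
  rewrite (Rabs_right (q ^ (2 * j + 2))) by lra.
  apply Rle_trans with ((INR (k + 2 * j) + 2) * / q ^ (2 * j + 2) * (K * a ^ (k + 2 * j)) * 1).
  { assert (0 < / q ^ (2 * j + 2)) by (apply Rinv_0_lt_compat; auto).
    apply Rmult_le_compat; auto.
    - apply Rmult_le_pos; [nra | apply Rabs_pos].
    - apply Rmult_le_compat_l; auto. nra. }
  assert (E : (INR (k + 2 * j) + 2) * / q ^ (2 * j + 2) * (K * a ^ (k + 2 * j)) * 1 =
    K / q ^ 2 * a ^ k * ((INR (k + 2 * j) + 2) * t ^ j)).
  { unfold t, Rdiv. rewrite Rpow_mult_distr, pow_inv, !pow_add, <- !pow_mult. field.
    split; [|lra]. apply pow_nonzero. lra. }
  rewrite E.
  assert (Hak : 0 < a ^ k) by (apply pow_lt; lra).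
  assert (Htj : 0 < t ^ j) by (apply pow_lt; lra).
  replace (2 * K * c * / q ^ 2 * ((INR k + 1) * a ^ k) * s ^ j) with
    (K / q ^ 2 * a ^ k * (2 * (INR k + 1) * (c * s ^ j))) by (field; lra).
  apply Rmult_le_compat_l.
  - apply Rmult_le_pos; [apply Rdiv_le_0_compat|]; lra.
  - apply Rle_trans with (2 * (INR k + 1) * ((INR j + 1) * t ^ j)).
    + rewrite <- Rmult_assoc. apply Rmult_le_compat_r; [lra|].
      rewrite plus_INR, mult_INR. simpl (INR 2). nra.
    + apply Rmult_le_compat_l; [lra | apply Hn]. }
assert (Hg : forall D, ex_series (fun j => D * s ^ j)).
{ intros D. apply ex_series_scal_l_R.
  apply ex_series_geom. rewrite Rabs_right; lra. }
exists (2 * K * c / q ^ 2 * / (1 - s)). split.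
- apply Rmult_le_pos; [|left; apply Rinv_0_lt_compat; lra].
  apply Rdiv_le_0_compat; auto. nra.
- intros k. split.
  + apply (ex_series_le (V := R_CompleteNormedModule)) with
      (fun j => (2 * K * c / q ^ 2 * ((INR k + 1) * a ^ k)) * s ^ j); auto.
    intros j. unfold norm; simpl; unfold abs; simpl. rewrite Rabs_Rabsolu. apply Hb.
  + apply Rle_trans with (Series (fun j => (2 * K * c / q ^ 2 * ((INR k + 1) * a ^ k)) * s ^ j)).
    * apply Series_le; auto. intros j; split; [apply Rabs_pos | apply Hb].
    * rewrite Series_scal_l, Series_geom by (rewrite Rabs_right; lra). apply Req_le; ring.
Qed.

Lemma hankel_coef_rec k :
  p k = - ((INR k + 2) / q ^ 2 * phi k) - INR k / INR (S k) / q ^ 2 * p (S (S k)).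
Proof.
destruct hankel_term_bound as [M [_ HM]].
unfold hankel_coef at 1. rewrite Series_incr_1 by (apply ex_series_Rabs, HM).
unfold Rminus. f_equal.
- unfold hankel_term. simpl (double_ratio k 0). rewrite Nat.mul_0_r, Nat.add_0_r. simpl. field. lra.
- unfold hankel_coef. rewrite <- Ropp_mult_distr_l_reverse, <- Series_scal_l.
  apply Series_ext. intros j. unfold hankel_term.
  cbn [double_ratio].
  replace (k + 2 * S j)%nat with (S (S k) + 2 * j)%nat by lia.
  replace (2 * S j + 2)%nat with (2 * j + 2 + 2)%nat by lia.
  rewrite (pow_add q (2 * j + 2) 2). cbn [pow].
  assert (Hk := pos_INR k). rewrite (S_INR k). field.
  repeat split; first [apply pow_nonzero; lra | lra].
Qed.

Lemma hankel_coef_0 : p 0%nat = - (2 * phi 0%nat / q ^ 2).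
Proof. rewrite hankel_coef_rec. simpl. field. lra. Qed.

Lemma hankel_coef_exp_type r : a < r -> exp_type r p.
Proof.
intros Hr. destruct hankel_term_bound as [M [HM0 HM]].
destruct (linear_le_geometric a r ltac:(lra)) as [c [Hc Hn]].
exists (M * c). split; [lra|]. intros k. destruct (HM k) as [H1 H2].
unfold hankel_coef. eapply Rle_trans; [apply Series_Rabs; auto|].
eapply Rle_trans; [apply H2|]. rewrite Rmult_assoc. apply Rmult_le_compat_l; auto.
Qed.

Let f := egf phi.
Let c := p 1%nat.

(** S = A + i B with A = P' + x f and B = - q P; primV is V = (P' - c) / x, regular at 0 since
    c = P'(0). *)
Definition primA (x : R) : R := egf (fun k => p (S k) + INR k * phi (pred k)) x.
Definition primB (x : R) : R := egf (fun k => - q * p k) x.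
Definition primV (x : R) : R := egf (fun k => p (S (S k)) / INR (S k)) x.

(** The derivatives of S and of G = - f + V + i q x f. *)
Definition prim_tower (j : nat) (x : R) : C :=
  (egf (fun k => p (S (k + j)) + INR (k + j) * phi (pred (k + j))) x,
   egf (fun k => - q * p (k + j)%nat) x).
Definition source_tower (j : nat) (x : R) : C :=
  (egf (fun k => - phi (k + j)%nat + p (S (S (k + j))) / INR (S (k + j))) x,
   egf (fun k => q * (INR (k + j) * phi (pred (k + j)))) x).

Let r := (a + q) / 2.

Lemma exp_types :
  exp_type r (fun k => p (S k) + INR k * phi (pred k)) /\
  exp_type r (fun k => - q * p k) /\
  exp_type r (fun k => - phi k + p (S (S k)) / INR (S k)) /\
  exp_type r (fun k => q * (INR k * phi (pred k))) /\
  exp_type r (fun k => p (S (S k)) / INR (S k)) /\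
  exp_type r phi /\ exp_type r p /\ exp_type r (fun k => INR k * phi (pred k)).
Proof.
assert (Hp : exp_type r p) by (apply hankel_coef_exp_type; unfold r; lra).
assert (Hx : exp_type r (fun k => INR k * phi (pred k)))
  by (apply (exp_type_mult_x a); auto; unfold r; lra).
assert (Hf : exp_type r phi) by (apply (exp_type_mono a); auto; unfold r; lra).
assert (Hv : exp_type r (fun k => p (S (S k)) / INR (S k))).
{ apply exp_type_le with (fun k => p (S (S k))).
  - intros k. unfold Rdiv. rewrite Rabs_mult, Rabs_inv.
    assert (H := pos_INR k). rewrite S_INR, (Rabs_right (INR k + 1)) by lra.
    assert (H1 := Rabs_pos (p (S (S k)))).
    assert (/ (INR k + 1) <= 1) by (rewrite <- Rinv_1; apply Rinv_le_contravar; lra).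
    nra.
  - apply (exp_type_shift r (fun k => p (S k))), exp_type_shift, Hp. }
repeat split; auto.
- apply exp_type_ext with (fun k => 1 * p (S k) + 1 * (INR k * phi (pred k))).
  + intros k; ring.
  + apply exp_type_lin; auto. apply exp_type_shift, Hp.
- apply exp_type_ext with (fun k => - q * p k + 0 * p k); [intros k; ring|].
  apply exp_type_lin; auto.
- apply exp_type_ext with (fun k => (-1) * phi k + 1 * (p (S (S k)) / INR (S k)));
    [intros k; ring|]. apply exp_type_lin; auto.
- apply exp_type_ext with (fun k => q * (INR k * phi (pred k)) + 0 * (INR k * phi (pred k)));
    [intros k; ring|]. apply exp_type_lin; auto.
Qed.

Lemma prim_towers : exists K, tower r K prim_tower /\ tower r K source_tower.
Proof.
destruct exp_types as [H1 [H2 [H3 [H4 _]]]].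
destruct (egf_pair_tower r _ _ H1 H2) as [K1 T1].
destruct (egf_pair_tower r _ _ H3 H4) as [K2 T2].
assert (Hr : 0 <= r) by (unfold r; lra).
assert (Hmono : forall K K' u, K <= K' -> tower r K u -> tower r K' u).
{ intros K K' u HK [Hb Hd]. split; auto. intros k x. eapply Rle_trans; [apply Hb|].
  apply Rmult_le_compat_r; [left; apply exp_pos|].
  apply Rmult_le_compat_r; [apply pow_le; auto | auto]. }
exists (Rmax K1 K2). split.
- apply (Hmono K1); [apply Rmax_l | apply T1].
- apply (Hmono K2); [apply Rmax_r | apply T2].
Qed.

Lemma egf_plus u v x : exp_type r u -> exp_type r v ->
  egf (fun k => u k + v k) x = egf u x + egf v x.
Proof.
intros [K1 H1] [K2 H2]. transitivity (1 * egf u x + 1 * egf v x); [|ring].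
rewrite <- (egf_lin _ _ _ _ _ _ _ _ _ H1 H2). apply egf_ext. intros; ring.
Qed.

Lemma egf_scal u d x : exp_type r u -> egf (fun k => d * u k) x = d * egf u x.
Proof.
intros [K1 H1]. transitivity (d * egf u x + 0 * egf u x); [|ring].
rewrite <- (egf_lin _ _ _ _ _ _ _ _ _ H1 H1). apply egf_ext. intros; ring.
Qed.

Lemma source_eq x : source_tower 0 x = (- f x + primV x, q * (x * f x)).
Proof.
destruct exp_types as [H1 [H2 [H3 [H4 [H5 [H6 [H7 H8]]]]]]].
unfold source_tower, f, primV. f_equal.
- transitivity (egf (fun k => - phi k + p (S (S k)) / INR (S k)) x).
  + apply egf_ext. intros k. rewrite Nat.add_0_r. reflexivity.
  + destruct H5 as [K5 H5]. destruct H6 as [K6 H6].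
    transitivity ((-1) * egf phi x + 1 * egf (fun k => p (S (S k)) / INR (S k)) x); [|ring].
    rewrite <- (egf_lin _ _ _ _ _ _ _ _ _ H6 H5). apply egf_ext. intros; ring.
- rewrite egf_mult_x, <- egf_scal by auto. apply egf_ext.
  intros k. rewrite Nat.add_0_r. reflexivity.
Qed.

Lemma prim_eq x : prim_tower 0 x = (primA x, primB x).
Proof.
unfold prim_tower, primA, primB. f_equal; apply egf_ext; intros k; rewrite Nat.add_0_r; reflexivity.
Qed.

(** S' = - i q S + G: coefficientwise this is hankel_coef_rec. *)
Lemma prim_ode j x : prim_tower (S j) x = ((0, - q)%R * prim_tower j x + source_tower j x)%C.
Proof.
assert (Hq0 : q <> 0) by lra.
assert (Hsh : forall u j, exp_type r u -> exp_type r (fun k => u (k + j)%nat)).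
{ intros u i [K [H0 H]]. exists (K * r ^ i). split; auto. intros k.
  eapply Rle_trans; [apply H|]. rewrite pow_add. apply Req_le; ring. }
destruct exp_types as [H1 [H2 [H3 [H4 _]]]].
assert (H1' := Hsh _ j H1). assert (H2' := Hsh _ j H2).
assert (H3' := Hsh _ j H3). assert (H4' := Hsh _ j H4). cbv beta in *.
unfold prim_tower, source_tower, Cmult, Cplus. cbn [fst snd].
f_equal.
- rewrite Rmult_0_l, Rminus_0_l, Ropp_mult_distr_l, Ropp_involutive.
  rewrite <- egf_scal, <- egf_plus; auto.
  2:{ apply exp_type_ext with (fun k => q * (- q * p (k + j)%nat) + 0 * (- q * p (k + j)%nat));
      [intros; ring|]. apply exp_type_lin; auto. }
  apply egf_ext. intros k. replace (k + S j)%nat with (S (k + j)) by lia. cbn [pred].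
  rewrite (hankel_coef_rec (k + j)). assert (Hk := pos_INR (k + j)). rewrite S_INR.
  field. split; [lra | auto].
- rewrite Rmult_0_l, Rplus_0_l.
  rewrite <- egf_scal, <- egf_plus; auto.
  2:{ apply exp_type_ext with (fun k => - q * (p (S (k + j)) + INR (k + j) * phi (pred (k + j)))
        + 0 * (p (S (k + j)) + INR (k + j) * phi (pred (k + j))));
      [intros; ring|]. apply exp_type_lin; auto. }
  apply egf_ext. intros k. replace (k + S j)%nat with (S (k + j)) by lia. ring.
Qed.

Lemma primA_deriv x : is_derive primA x (q * primB x + (- f x + primV x)).
Proof.
destruct prim_towers as [K [Ht _]]. destruct (tower_deriv _ _ _ Ht 0%nat x) as [H _].
rewrite prim_ode, source_eq, prim_eq in H.
apply is_derive_ext with (fun t => Re (prim_tower 0 t)); [intros; rewrite prim_eq; reflexivity|].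
replace (q * primB x + (- f x + primV x)) with
  (Re ((0, - q)%R * (primA x, primB x) + (- f x + primV x, q * (x * f x))%R)%C); auto.
unfold Re, Cmult, Cplus; simpl; ring.
Qed.

Lemma primB_deriv x : is_derive primB x (- q * primA x + q * (x * f x)).
Proof.
destruct prim_towers as [K [Ht _]]. destruct (tower_deriv _ _ _ Ht 0%nat x) as [_ H].
rewrite prim_ode, source_eq, prim_eq in H.
apply is_derive_ext with (fun t => Im (prim_tower 0 t)); [intros; rewrite prim_eq; reflexivity|].
replace (- q * primA x + q * (x * f x)) with
  (Im ((0, - q)%R * (primA x, primB x) + (- f x + primV x, q * (x * f x))%R)%C); auto.
unfold Im, Cmult, Cplus; simpl; ring.
Qed.

Lemma primV_eq x : x * primV x = primA x - x * f x - c.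
Proof.
destruct exp_types as [H1 [H2 [H3 [H4 [H5 [H6 [H7 H8]]]]]]].
assert (Hs : exp_type r (fun k => p (S k))) by (apply exp_type_shift; auto).
unfold primV, primA, f. rewrite egf_plus, <- egf_mult_x by auto.
destruct Hs as [K Hs]. rewrite (egf_decr _ _ _ x Hs). unfold c. ring.
Qed.
End Antiderivative.

(** * Decay of the antiderivative *)

Section Decay.
Variables (phi : nat -> R) (a q : R).
Hypothesis (Ha : 0 < a < q).
Hypothesis (Hphi : exp_type a phi).
Let f := egf phi.
Hypothesis (Hdecay : forall eps, 0 < eps -> exists X, forall x, X <= x ->
  sqrt x * Rabs (f x) <= eps).

Notation PA := (primA phi q).
Notation PB := (primB phi q).
Notation PV := (primV phi q).
Let c := hankel_coef q phi 1%nat.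
Let r := (a + q) / 2.

Lemma f_le_inv_sqrt eps x : 0 < x -> sqrt x * Rabs (f x) <= eps -> Rabs (f x) <= eps / sqrt x.
Proof. intros Hx H. apply Rle_div_r; [apply sqrt_lt_R0; auto | lra]. Qed.

(** The rotation - i q drops out of (A^2 + B^2)', and division by x^2 absorbs the coefficient
    1 / x of A in V: for y = (A^2 + B^2) / x^2 there remains (sqrt (1 + y))' = O(1 / sqrt x). *)
Lemma prim_crude_growth : exists X C0, 1 <= X /\ 0 < C0 /\ forall x, X <= x ->
  Rabs (PA x) <= C0 * (x * sqrt x) /\ Rabs (f x) <= 1 / sqrt x.
Proof.
destruct (Hdecay 1 Rlt_0_1) as [X0 HX0].
set (X := Rmax 1 X0).
assert (HX1 : 1 <= X) by apply Rmax_l.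
assert (Hf : forall x, X <= x -> Rabs (f x) <= 1 / sqrt x).
{ intros x Hx. apply f_le_inv_sqrt; [lra|]. apply HX0.
  eapply Rle_trans; [apply Rmax_r|apply Hx]. }
set (y := fun x => (PA x ^ 2 + PB x ^ 2) / x ^ 2).
set (h := fun x => sqrt (1 + y x)).
set (D := 2 + Rabs c + q).
set (dy := fun x => (- 4 * PA x * f x - 2 * PA x * c / x + 2 * PB x * q * x * f x
   - 2 * PB x ^ 2 / x) / x ^ 2).
assert (Hy : forall x, X <= x -> is_derive y x (dy x)).
{ intros x Hx. unfold y, dy.
  assert (DA := primA_deriv phi a q Ha Hphi x). assert (DB := primB_deriv phi a q Ha Hphi x).
  assert (HV := primV_eq phi a q Ha Hphi x). fold f in DA, DB, HV. fold c in HV.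
  assert (EV : PV x = (PA x - x * f x - c) / x) by (rewrite <- HV; field; lra).
  auto_derive.
  - repeat split; try (eexists; eauto). assert (0 < x * x) by nra. lra.
  - rewrite (is_derive_unique (fun x : R => PA x) _ _ DA),
      (is_derive_unique (fun x : R => PB x) _ _ DB), EV.
    change (egf phi x) with (f x). field. lra. }
assert (Hy0 : forall x, X <= x -> 0 <= y x).
{ intros x Hx. unfold y. apply Rdiv_le_0_compat; [|apply pow_lt; lra].
  assert (H1 := pow2_ge_0 (PA x)). assert (H2 := pow2_ge_0 (PB x)). lra. }
assert (Hh : forall x, X <= x -> 0 < h x /\ h x * h x = 1 + y x).
{ intros x Hx. assert (H := Hy0 x Hx). split; [apply sqrt_lt_R0 | apply sqrt_sqrt]; lra. }
assert (HAB : forall x, X <= x -> Rabs (PA x) <= x * h x /\ Rabs (PB x) <= x * h x).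
{ intros x Hx. destruct (Hh x Hx) as [H1 H2].
  assert (E : PA x ^ 2 + PB x ^ 2 = x ^ 2 * y x) by (unfold y; field; lra).
  assert (H3 := pow2_ge_0 (PA x)). assert (H4 := pow2_ge_0 (PB x)).
  rewrite <- (pow2_abs (PA x)) in *. rewrite <- (pow2_abs (PB x)) in *.
  assert (H5 := Rabs_pos (PA x)). assert (H6 := Rabs_pos (PB x)).
  assert (0 < x) by lra. assert (0 < x * h x) by nra.
  assert (Hx2 : x ^ 2 * y x <= (x * h x) ^ 2) by (replace ((x * h x) ^ 2) with (x ^ 2 * (h x * h x)) by ring; rewrite H2; nra).
  split; apply Rsqr_incr_0_var; unfold Rsqr; nra. }
assert (Hdh : forall x, X <= x -> is_derive h x (dy x / (2 * h x))).
{ intros x Hx. unfold h. destruct (Hh x Hx) as [H1 _]. assert (H2 := Hy0 x Hx).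
  assert (HD := Hy x Hx). auto_derive.
  - repeat split; first [lra | eexists; eauto].
  - rewrite (is_derive_unique (fun x : R => y x) _ _ HD).
    fold (h x). field. lra. }
assert (Hsq : forall x, X <= x -> 0 < sqrt x /\ sqrt x * sqrt x = x).
{ intros x Hx. split; [apply sqrt_lt_R0 | apply sqrt_sqrt]; lra. }
assert (Hdy : forall x, X <= x -> dy x / (2 * h x) <= D / sqrt x).
{ intros x Hx. destruct (Hh x Hx) as [H1 _]. destruct (HAB x Hx) as [HA HB].
  destruct (Hsq x Hx) as [Hs Hss]. assert (Hfx := Hf x Hx).
  assert (Hs1 : 1 <= sqrt x) by nra.
  assert (Hu : 0 < x * h x) by nra.
  assert (T1 : - 4 * PA x * f x <= 4 * (x * h x) * (1 / sqrt x)).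
  { assert (H := Rle_abs (- (PA x * f x))). rewrite Rabs_Ropp, Rabs_mult in H.
    assert (H2 := Rmult_le_compat _ _ _ _ (Rabs_pos (PA x)) (Rabs_pos (f x)) HA Hfx). lra. }
  assert (T2 : - (2 * PA x * c / x) <= 2 * (x * h x) * Rabs c / x).
  { unfold Rdiv. rewrite <- Ropp_mult_distr_l_reverse.
    apply Rmult_le_compat_r; [left; apply Rinv_0_lt_compat; lra|].
    assert (H := Rle_abs (- (PA x * c))). rewrite Rabs_Ropp, Rabs_mult in H.
    assert (H2 := Rmult_le_compat_r _ _ _ (Rabs_pos c) HA). lra. }
  assert (T3 : 2 * PB x * q * x * f x <= 2 * (x * h x) * q * x * (1 / sqrt x)).
  { assert (H := Rle_abs (PB x * f x)). rewrite Rabs_mult in H.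
    assert (H2 := Rmult_le_compat _ _ _ _ (Rabs_pos (PB x)) (Rabs_pos (f x)) HB Hfx).
    assert (H3 : PB x * f x <= x * h x * (1 / sqrt x)) by lra.
    apply (Rmult_le_compat_l (2 * q * x)) in H3; [lra | nra]. }
  assert (T4 : 0 <= 2 * PB x ^ 2 / x).
  { apply Rdiv_le_0_compat; [|lra]. assert (H := pow2_ge_0 (PB x)). lra. }
  apply (Rle_div_l _ _ (2 * h x)); [lra|]. unfold dy.
  apply (Rle_div_l _ _ (x ^ 2)); [apply pow_lt; lra|].
  apply Rle_trans with (4 * (x * h x) * (1 / sqrt x) + 2 * (x * h x) * Rabs c / x +
    2 * (x * h x) * q * x * (1 / sqrt x)); [lra|].
  set (s := sqrt x) in *.
  assert (Ex : x = s * s) by lra.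
  replace (4 * (x * h x) * (1 / s) + 2 * (x * h x) * Rabs c / x + 2 * (x * h x) * q * x * (1 / s))
    with (2 * h x * (2 * s + Rabs c + q * s ^ 3)) by (rewrite Ex; field; lra).
  replace (D / s * (2 * h x) * x ^ 2) with (2 * h x * (D * s ^ 3)) by (rewrite Ex; field; lra).
  apply Rmult_le_compat_l; [lra|]. unfold D.
  assert (Hc := Rabs_pos c).
  assert (s <= s ^ 3) by (simpl; nra). assert (1 <= s ^ 3) by (simpl; nra).
  nra. }
assert (Hmono : forall x, X <= x -> h x <= h X + 2 * D * sqrt x).
{ intros x Hx.
  assert (H := mean_value_le (fun t => h t - 2 * D * sqrt t)
    (fun t => dy t / (2 * h t) - D / sqrt t) X x Hx
    ltac:(intros t Ht; apply (is_derive_minus h (fun t => 2 * D * sqrt t) t);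
      [apply Hdh; lra | auto_derive; [lra | field; apply Rgt_not_eq, sqrt_lt_R0; lra]])
    ltac:(intros t Ht; assert (H1 := Hdy t ltac:(lra)); lra)).
  cbv beta in H. assert (0 <= 2 * D * sqrt X).
  { apply Rmult_le_pos; [unfold D; assert (H0 := Rabs_pos c); lra | apply sqrt_pos]. }
  lra. }
exists X, (h X + 2 * D).
destruct (Hh X (Rle_refl X)) as [HhX _].
assert (HD : 0 < D) by (unfold D; assert (H0 := Rabs_pos c); lra).
split; auto. split; [lra|]. intros x Hx. split; [|apply Hf; auto].
destruct (HAB x Hx) as [HA _]. eapply Rle_trans; [apply HA|].
destruct (Hsq x Hx) as [Hs Hss].
assert (Hs1 : 1 <= sqrt x) by nra.
assert (H := Hmono x Hx).
replace ((h X + 2 * D) * (x * sqrt x)) with (x * (h X * sqrt x + 2 * D * sqrt x)) by ring.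
apply Rmult_le_compat_l; [lra|]. nra.
Qed.

Notation S0 := (prim_tower phi q 0%nat).
Notation G0 := (source_tower phi q 0%nat).

Lemma V_bound x : 0 < x -> Rabs (PV x) <= (Rabs (PA x) + Rabs c) / x + Rabs (f x).
Proof.
intros Hx. assert (HV := primV_eq phi a q Ha Hphi x). fold f in HV. fold c in HV.
replace (PV x) with ((PA x - c) / x - f x).
2:{ apply Rmult_eq_reg_l with x; [|lra]. rewrite HV. field. lra. }
unfold Rminus. eapply Rle_trans; [apply Rabs_triang|]. rewrite Rabs_Ropp.
apply Rplus_le_compat_r. unfold Rdiv. rewrite Rabs_mult, (Rabs_right (/ x))
  by (apply Rle_ge; left; apply Rinv_0_lt_compat; lra).
apply Rmult_le_compat_r; [left; apply Rinv_0_lt_compat; lra|].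
eapply Rle_trans; [apply Rabs_triang|]. rewrite Rabs_Ropp. lra.
Qed.

Lemma G0_bound x : 0 < x -> Cmod (G0 x) <=
  (Rabs (PA x) + Rabs c) / x + 2 * Rabs (f x) + q * (x * Rabs (f x)).
Proof.
intros Hx. rewrite (source_eq phi a q Ha Hphi). fold f.
eapply Rle_trans; [apply Cmod_le_Re_Im|]. cbn [Re Im fst snd].
rewrite !Rabs_mult, (Rabs_right q), (Rabs_right x) by lra.
apply Rplus_le_compat_r. eapply Rle_trans; [apply Rabs_triang|]. rewrite Rabs_Ropp.
assert (H := V_bound x Hx). lra.
Qed.

(** A bound by eps sqrt x for large x extends to the half-line after adding a constant
    under the square root; that constant may be taken as large as desired. *)
Lemma sqrt_weight (eps X L : R) : 0 < eps ->
  (forall x, X <= x -> Cmod (G0 x) <= eps * sqrt x) ->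
  exists al, L <= al /\ 0 < al /\ forall x, 0 <= x -> Cmod (G0 x) <= sqrt (al + 2 * eps ^ 2 * x).
Proof.
intros Heps HX. destruct (prim_towers phi a q Ha Hphi) as [K [_ HG]].
assert (HK := tower_K_nonneg _ _ _ HG).
set (M := K * exp (r * Rabs X)).
assert (HM : 0 <= M) by (apply Rmult_le_pos; auto; left; apply exp_pos).
exists (2 * M ^ 2 + Rabs L + 1).
assert (HL := Rle_abs L). assert (HL0 := Rabs_pos L). assert (HM2 := pow2_ge_0 M).
split; [lra|]. split; [lra|]. intros x Hx.
assert (H : Cmod (G0 x) <= M + eps * sqrt x).
{ assert (Hs := sqrt_pos x). destruct (Rle_dec X x) as [h|h].
  - specialize (HX x h). lra.
  - assert (H := tower_bound _ _ _ HG 0%nat x). fold r in H. rewrite pow_O, Rmult_1_r in H.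
    assert (H1 : exp (r * Rabs x) <= exp (r * Rabs X)).
    { apply exp_mono. apply Rmult_le_compat_l; [unfold r; lra|]. rewrite !Rabs_right; lra. }
    apply (Rmult_le_compat_l K) in H1; auto. fold M in H1. nra. }
eapply Rle_trans; [apply H|].
assert (Hs := sqrt_pos x). assert (Hss := sqrt_sqrt x Hx).
rewrite <- (sqrt_pow2 (M + eps * sqrt x)) by nra. apply sqrt_le_1_alt.
set (s := sqrt x) in *. rewrite <- Hss. assert (H0 := pow2_ge_0 (M - eps * s)). simpl in *. nra.
Qed.

Lemma sqrt_weight_growth al be x : 0 < al -> 0 < be -> al / be <= x ->
  sqrt (al + be * x) <= sqrt (2 * be) * sqrt x.
Proof.
intros H1 H2 H3. assert (0 < al / be) by (apply Rdiv_lt_0_compat; lra).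
rewrite <- sqrt_mult by lra. apply sqrt_le_1_alt.
assert (al <= be * x).
{ apply (Rmult_le_compat_l be) in H3; [|lra].
  replace (be * (al / be)) with al in H3 by (field; lra). auto. }
lra.
Qed.

(** The instance z = - i q of linear_ode_weighted. *)
Lemma prim_weighted : exists C1 eta0, 0 < C1 /\ 0 < eta0 /\ forall al be, 0 < al ->
  0 <= be <= 2 * eta0 * al ->
  (forall y, 0 <= y -> Cmod (G0 y) <= sqrt (al + be * y)) ->
  forall x, 0 <= x -> Cmod (S0 x) <= C1 * (1 + sqrt (al + be * x)).
Proof.
destruct (prim_towers phi a q Ha Hphi) as [K [HS HG]].
assert (HK := tower_K_nonneg _ _ _ HG).
destruct (linear_ode_weighted r q ltac:(unfold r; lra) ltac:(unfold r; lra))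
  as [C0 [eta0 [HC0 [He0 Hw]]]].
exists (C0 * (K + 1)), eta0. split; [nra|]. split; auto.
intros al be Ha1 Hb HGb x Hx.
assert (Hz : Cmod (0, - q) = q).
{ assert (E := Cmod2_alt (0, - q)). cbn [Re Im fst snd] in E.
  assert (H := Cmod_ge_0 (0, - q)). nra. }
assert (H := Hw K al be (0, - q) (prim_tower phi q) (source_tower phi q)
  eq_refl Hz HS HG (fun j y => prim_ode phi a q Ha Hphi j y) Ha1 Hb HGb x Hx).
eapply Rle_trans; [apply H|].
assert (Hs := sqrt_pos (al + be * x)).
rewrite Rmult_assoc. apply Rmult_le_compat_l; [lra|]. nra.
Qed.

(** First pass: G = O(sqrt x), so S = O(sqrt x); this makes the perturbation V small and G
    of order o(sqrt x).  Second pass: S = o(sqrt x). *)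
Lemma prim_decay eps : 0 < eps -> exists X, forall x, X <= x ->
  Cmod (S0 x) <= eps * sqrt x.
Proof.
intros Heps.
destruct prim_weighted as [C1 [eta0 [HC1 [He0 Hw]]]].
destruct prim_crude_growth as [X0 [C0 [HX0 [HC0 Hcr]]]].
assert (Hc := Rabs_pos c).
assert (Hsq : forall x, 1 <= x -> 1 <= sqrt x /\ sqrt x * sqrt x = x).
{ intros x Hx. split; [|apply sqrt_sqrt; lra].
  rewrite <- sqrt_1 at 1. apply sqrt_le_1_alt; lra. }
(* a bound e sqrt x on G for large x passes to S with a factor 3 C1 independent of e *)
assert (Hboot : forall e X, 0 < e -> (forall x, X <= x -> Cmod (G0 x) <= e * sqrt x) ->
  exists X', 1 <= X' /\ forall x, X' <= x -> Cmod (S0 x) <= C1 * (3 * e) * sqrt x).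
{ intros e X He HX.
  assert (He2 : 0 < e ^ 2) by (apply pow_lt; lra).
  destruct (sqrt_weight e X (2 * e ^ 2 / (2 * eta0)) He HX) as [al [Hal1 [Hal Hal2]]].
  assert (Hb : 0 <= 2 * e ^ 2 <= 2 * eta0 * al).
  { split; [lra|]. apply (Rmult_le_compat_l (2 * eta0)) in Hal1; [|lra].
    replace (2 * eta0 * (2 * e ^ 2 / (2 * eta0))) with (2 * e ^ 2) in Hal1 by (field; lra). lra. }
  exists (1 + al / (2 * e ^ 2) + / (e ^ 2)).
  assert (P1 : 0 < al / (2 * e ^ 2)) by (apply Rdiv_lt_0_compat; lra).
  assert (P2 : 0 < / e ^ 2) by (apply Rinv_0_lt_compat; lra).
  split; [lra|]. intros x Hx.
  eapply Rle_trans; [apply (Hw al (2 * e ^ 2) Hal Hb Hal2); lra|].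
  rewrite (Rmult_assoc C1). apply Rmult_le_compat_l; [lra|].
  assert (G1 := sqrt_weight_growth al (2 * e ^ 2) x Hal ltac:(lra) ltac:(lra)).
  replace (2 * (2 * e ^ 2)) with ((2 * e) ^ 2) in G1 by ring.
  rewrite sqrt_pow2 in G1 by lra.
  assert (G2 : 1 <= e * sqrt x).
  { rewrite <- (sqrt_pow2 e), <- sqrt_mult by lra. rewrite <- sqrt_1 at 1.
    apply sqrt_le_1_alt. assert (/ e ^ 2 <= x) by lra.
    apply (Rmult_le_compat_l (e ^ 2)) in H; [|lra]. rewrite Rinv_r in H; lra. }
  lra. }
assert (HPA : forall x, Rabs (PA x) <= Cmod (S0 x)).
{ intros x. rewrite (prim_eq phi q). apply (re_le_Cmod (PA x, PB x)). }
destruct (Hboot (C0 + Rabs c + 2 + q) X0 ltac:(lra)) as [X1 [HX1 HS1]].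
{ intros x Hx. destruct (Hcr x Hx) as [H1 H2]. destruct (Hsq x ltac:(lra)) as [H3 H4].
  eapply Rle_trans; [apply G0_bound; lra|].
  set (s := sqrt x) in *.
  assert (T1 : (Rabs (PA x) + Rabs c) / x <= C0 * s + Rabs c).
  { apply Rle_div_l; [lra|]. nra. }
  assert (T2 : 1 / s <= 1) by (apply Rle_div_l; lra).
  assert (T3 : x * Rabs (f x) <= s).
  { apply Rle_trans with (x * (1 / s)); [apply Rmult_le_compat_l; lra|].
    rewrite <- H4. apply Req_le. field. lra. }
  nra. }
set (C2 := C1 * (3 * (C0 + Rabs c + 2 + q))) in *.
set (e := eps / (3 * C1)).
assert (He : 0 < e) by (apply Rdiv_lt_0_compat; lra).
destruct (Hdecay (e / (2 * (2 + q))) ltac:(apply Rdiv_lt_0_compat; lra)) as [X2 HX2].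
assert (HC2 : 0 <= C2) by (unfold C2; apply Rmult_le_pos; lra).
set (X3 := 2 * (C2 + Rabs c) / e).
destruct (Hboot e (Rmax X1 (Rmax X2 X3)) He) as [X' [_ HX']].
{ intros x Hx.
  assert (Hx1 : X1 <= x) by (eapply Rle_trans; [apply Rmax_l|apply Hx]).
  assert (Hx23 : Rmax X2 X3 <= x) by (eapply Rle_trans; [apply Rmax_r|apply Hx]).
  assert (Hx2 : X2 <= x) by (eapply Rle_trans; [apply Rmax_l|apply Hx23]).
  assert (Hx3 : X3 <= x) by (eapply Rle_trans; [apply Rmax_r|apply Hx23]).
  eapply Rle_trans; [apply G0_bound; lra|].
  destruct (Hsq x ltac:(lra)) as [H3 H4].
  assert (HA := Rle_trans _ _ _ (HPA x) (HS1 x Hx1)).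
  assert (Hf := HX2 x Hx2). set (s := sqrt x) in *.
  assert (Hfp := Rabs_pos (f x)).
  assert (T1 : (Rabs (PA x) + Rabs c) / x <= e / 2 * s).
  { apply (Rle_div_l _ _ x); [lra|].
    assert (Hx4 : 2 * (C2 + Rabs c) <= e * x).
    { unfold X3 in Hx3. apply (Rmult_le_compat_l e) in Hx3; [|lra].
      replace (e * (2 * (C2 + Rabs c) / e)) with (2 * (C2 + Rabs c)) in Hx3 by (field; lra). auto. }
    nra. }
  assert (T2 : 2 * Rabs (f x) + q * (x * Rabs (f x)) <= (2 + q) * (s * (s * Rabs (f x)))).
  { replace (s * (s * Rabs (f x))) with (s * s * Rabs (f x)) by ring. rewrite H4. nra. }
  assert (T3 : (2 + q) * (s * (s * Rabs (f x))) <= (2 + q) * (s * (e / (2 * (2 + q))))).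
  { apply Rmult_le_compat_l; [lra|]. apply Rmult_le_compat_l; lra. }
  replace ((2 + q) * (s * (e / (2 * (2 + q))))) with (e / 2 * s) in T3 by (field; lra).
  lra. }
exists X'. intros x Hx. specialize (HX' x Hx).
replace (C1 * (3 * e)) with eps in HX' by (unfold e; field; lra). auto.
Qed.

(** * The Hankel transform of a real function *)

(** P J0(q x) + Q J1(q x), with P = - B / q and Q = - (A + c) / q. *)
Definition hankel_prim (x : R) : R :=
  - (PB x / q) * BesselJ 0 (q * x) - (PA x + c) / q * BesselJ 1 (q * x).

Lemma hankel_prim_deriv x :
  is_derive hankel_prim x ((x * f x + c) * BesselJ 2 (q * x)).
Proof.
unfold hankel_prim.
assert (DA := primA_deriv phi a q Ha Hphi x). assert (DB := primB_deriv phi a q Ha Hphi x).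
assert (HV := primV_eq phi a q Ha Hphi x). fold f in DA, DB, HV. fold c in HV.
assert (D0 := is_derive_BesselJ_0 (q * x)). assert (D1 := is_derive_BesselJ_1 (q * x)).
auto_derive.
- repeat split; eexists; eauto.
- rewrite (is_derive_unique (fun x : R => PA x) _ _ DA),
    (is_derive_unique (fun x : R => PB x) _ _ DB),
    (is_derive_unique (fun x : R => BesselJ 0 x) _ _ D0),
    (is_derive_unique (fun x : R => BesselJ 1 x) _ _ D1).
  rewrite BesselJ_2_eq, !BesselJ_1_eq.
  set (j0 := BesselJ 0 (q * x)). set (h := bessel_series 1 (q * x)).
  transitivity ((PA x - x * f x) * j0 + (x * f x - x * PV x) * h / 2
    - (PA x + c) * (j0 - h / 2)); [field; lra|].
  rewrite HV. field.
Qed.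

(** J2 = J0 - 2 J1'. *)
Lemma RInt_BesselJ_2 X : 0 <= X ->
  is_RInt (fun x => BesselJ 2 (q * x)) 0 X
    ((RInt (BesselJ 0) 0 (q * X) - 2 * BesselJ 1 (q * X)) / q).
Proof.
intros HX.
assert (HN : forall y, is_derive (fun y => RInt (BesselJ 0) 0 y) y (BesselJ 0 y)).
{ intros y. apply (is_derive_RInt (BesselJ 0) (fun y => RInt (BesselJ 0) 0 y) 0 y).
  - apply filter_forall. intros z. apply (RInt_correct (V := R_CompleteNormedModule)).
    apply ex_RInt_cont, BesselJ_continuous_0.
  - apply BesselJ_continuous_0. }
assert (H := is_RInt_deriv
  (fun x => ((fun y => RInt (BesselJ 0) 0 y) (q * x) - 2 * BesselJ 1 (q * x)) / q)
  (fun x => BesselJ 2 (q * x)) 0 X HX).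
cbv beta in H. rewrite Rmult_0_r, RInt_point, (BesselJ_1_eq 0) in H.
match type of H with _ -> _ -> is_RInt _ _ _ ?v => replace v with
  ((RInt (BesselJ 0) 0 (q * X) - 2 * BesselJ 1 (q * X)) / q) in H end.
2:{ unfold zero; simpl. field. lra. }
apply H.
- intros x _. assert (D0 := HN (q * x)). assert (D1 := is_derive_BesselJ_1 (q * x)).
  set (N := fun y => RInt (BesselJ 0) 0 y) in *.
  apply is_derive_ext with (fun x => (N (q * x) - 2 * BesselJ 1 (q * x)) / q); [reflexivity|].
  auto_derive.
  + repeat split; eexists; eauto.
  + rewrite (is_derive_unique (fun y : R => N y) _ _ D0),
      (is_derive_unique (fun x : R => BesselJ 1 x) _ _ D1), BesselJ_2_eq.
    field. lra.
- intros x _. apply (continuous_comp (fun x => q * x) (BesselJ 2)).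
  + apply ex_derive_continuous_R. auto_derive; auto.
  + apply BesselJ_continuous_2.
Qed.

Lemma egf_continuous x : continuous f x.
Proof.
destruct Hphi as [K HK]. apply ex_derive_continuous_R.
eexists. apply (egf_deriv _ _ _ _ HK).
Qed.

Lemma real_hankel_partial X : 0 <= X ->
  is_RInt (fun x => x * BesselJ 2 (q * x) * f x) 0 X
   (hankel_prim X + 2 * phi 0%nat / q ^ 2
    - c / q * (RInt (BesselJ 0) 0 (q * X) - 2 * BesselJ 1 (q * X))).
Proof.
intros HX.
assert (H1 : is_RInt (fun x => (x * f x + c) * BesselJ 2 (q * x)) 0 X
  (hankel_prim X - hankel_prim 0)).
{ apply is_RInt_deriv; auto.
  - intros x _. apply hankel_prim_deriv.
  - intros x _. apply (continuous_mult (fun x => x * f x + c) (fun x => BesselJ 2 (q * x))).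
    + apply (continuous_plus (fun x => x * f x) (fun _ => c)); [|apply continuous_const].
      apply (continuous_mult (fun x => x) f); [apply continuous_id | apply egf_continuous].
    + apply (continuous_comp (fun x => q * x) (BesselJ 2)).
      * apply ex_derive_continuous_R. auto_derive; auto.
      * apply BesselJ_continuous_2. }
assert (E : hankel_prim 0 = - (2 * phi 0%nat / q ^ 2)).
{ unfold hankel_prim. rewrite Rmult_0_r, BesselJ_0_at_0, BesselJ_1_eq.
  unfold primB. rewrite egf_0. rewrite (hankel_coef_0 phi a q Ha Hphi). field. lra. }
assert (H := is_RInt_minus _ _ _ _ _ _ H1 (is_RInt_scal _ _ _ c _ (RInt_BesselJ_2 X HX))).
rewrite E in H. unfold minus, plus, opp, scal in H; simpl in H; unfold mult in H; simpl in H.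
match type of H with is_RInt _ _ _ ?v => replace v with
  (hankel_prim X + 2 * phi 0%nat / q ^ 2
    - c / q * (RInt (BesselJ 0) 0 (q * X) - 2 * BesselJ 1 (q * X))) in H end.
- revert H. apply is_RInt_ext. intros x _.
  as_real_equation. ring.
- simpl. field. lra.
Qed.

(** The boundary term is o(sqrt X) O(1 / sqrt X). *)
Lemma real_hankel :
  filterlim (fun X => RInt (fun x => x * BesselJ 2 (q * x) * f x) 0 X)
    (Rbar_locally p_infty) (locally (2 * phi 0%nat / q ^ 2 - c / q)).
Proof.
apply (is_lim_spec _ p_infty (2 * phi 0%nat / q ^ 2 - c / q)). intros eps.
unfold Rbar_locally'.
destruct BesselJ_decay as [M [HM HJ]].
assert (Hc := Rabs_pos c). assert (Heps := cond_pos eps).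
assert (Hsq : 0 < sqrt q) by (apply sqrt_lt_R0; lra).
set (e1 := eps * (q * sqrt q) / (8 * M)).
assert (He1 : 0 < e1).
{ apply Rdiv_lt_0_compat; [apply Rmult_lt_0_compat; auto; nra | lra]. }
destruct (prim_decay e1 He1) as [X1 HX1].
set (D := 8 * (Rabs c + 1) * M / (q * eps)).
assert (HD : 0 < D) by (apply Rdiv_lt_0_compat; nra).
exists (Rmax (Rmax X1 (Rmax 1 (/ q))) (D ^ 2 / q)).
intros X HX.
assert (HX2 := Rmax_l (Rmax X1 (Rmax 1 (/ q))) (D ^ 2 / q)).
assert (HX3 := Rmax_r (Rmax X1 (Rmax 1 (/ q))) (D ^ 2 / q)).
assert (HX4 := Rmax_l X1 (Rmax 1 (/ q))). assert (HX5 := Rmax_r X1 (Rmax 1 (/ q))).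
assert (HX6 := Rmax_l 1 (/ q)). assert (HX7 := Rmax_r 1 (/ q)).
assert (Hq1 : 1 <= q * X).
{ assert (/ q <= X) by lra. apply (Rmult_le_compat_l q) in H; [|lra]. rewrite Rinv_r in H; lra. }
assert (HqD : D ^ 2 <= q * X).
{ assert (D ^ 2 / q <= X) by lra. apply (Rmult_le_compat_l q) in H; [|lra].
  replace (q * (D ^ 2 / q)) with (D ^ 2) in H by (field; lra). auto. }
destruct (HJ (q * X) Hq1) as [J0 J1].
assert (HS := HX1 X ltac:(lra)).
rewrite (prim_eq phi q) in HS.
assert (HA := Rle_trans _ _ _ (re_le_Cmod (PA X, PB X)) HS).
assert (HB := Rle_trans _ _ _ (Im_le_Cmod (PA X, PB X)) HS). cbn [Re Im fst snd] in HA, HB.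
assert (HR := RInt_BesselJ_0 (q * X) ltac:(lra)).
rewrite (is_RInt_unique _ _ _ _ (real_hankel_partial X ltac:(lra))).
set (N := RInt (BesselJ 0) 0 (q * X)) in *.
replace (hankel_prim X + 2 * phi 0%nat / q ^ 2 - c / q * (N - 2 * BesselJ 1 (q * X)) -
  (2 * phi 0%nat / q ^ 2 - c / q)) with
  (- (PB X / q) * BesselJ 0 (q * X) + (- (PA X / q) * BesselJ 1 (q * X) +
   c / q * (BesselJ 1 (q * X) + - (N - 1)))) by (unfold hankel_prim; field; lra).
set (m := M / sqrt (q * X)) in *.
assert (Hsx : 0 < sqrt X) by (apply sqrt_lt_R0; lra).
assert (Em : m = M / (sqrt q * sqrt X)) by (unfold m; rewrite sqrt_mult by lra; reflexivity).
assert (Hm0 : 0 < m) by (rewrite Em; apply Rdiv_lt_0_compat; auto; nra).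
assert (HmD : m <= M / D).
{ unfold m. apply Rmult_le_compat_l; [lra|]. apply Rinv_le_contravar; auto.
  rewrite <- (sqrt_pow2 D) by lra. apply sqrt_le_1_alt; auto. }
assert (T1 : forall u v, Rabs u <= e1 * sqrt X -> Rabs v <= m -> Rabs (- (u / q) * v) <= eps / 8).
{ intros u v Hu Hv. rewrite Rabs_mult, Rabs_Ropp. unfold Rdiv at 1.
  rewrite Rabs_mult, (Rabs_right (/ q)) by (apply Rle_ge; left; apply Rinv_0_lt_compat; lra).
  apply Rle_trans with (e1 * sqrt X * / q * m).
  - apply Rmult_le_compat; auto using Rabs_pos.
    + apply Rmult_le_pos; [apply Rabs_pos | left; apply Rinv_0_lt_compat; lra].
    + apply Rmult_le_compat_r; auto. left; apply Rinv_0_lt_compat; lra.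
  - rewrite Em. apply Req_le. unfold e1. field. repeat split; lra. }
assert (T2 : Rabs (c / q * (BesselJ 1 (q * X) + - (N - 1))) <= eps / 2).
{ rewrite Rabs_mult. unfold Rdiv at 1.
  rewrite Rabs_mult, (Rabs_right (/ q)) by (apply Rle_ge; left; apply Rinv_0_lt_compat; lra).
  apply Rle_trans with ((Rabs c + 1) * / q * (4 * m)).
  - assert (Hiq : 0 < / q) by (apply Rinv_0_lt_compat; lra).
    apply Rmult_le_compat.
    + nra.
    + apply Rabs_pos.
    + apply Rmult_le_compat_r; lra.
    + eapply Rle_trans; [apply Rabs_triang|]. rewrite Rabs_Ropp. lra.
  - apply Rle_trans with ((Rabs c + 1) * / q * (4 * (M / D))).
    + apply Rmult_le_compat_l; [|lra]. apply Rmult_le_pos; [lra|].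
      left; apply Rinv_0_lt_compat; lra.
    + apply Req_le. unfold D. field. repeat split; lra. }
eapply Rle_lt_trans; [apply Rabs_triang|].
assert (T3 := T1 _ _ HB J0).
assert (T4 := Rabs_triang (- (PA X / q) * BesselJ 1 (q * X))
  (c / q * (BesselJ 1 (q * X) + - (N - 1)))).
assert (T5 := T1 _ _ HA J1). lra.
Qed.
End Decay.

(** * The Gaussian integral and the Gamma function at half-integers *)

Lemma is_RInt_gen_half_line (F f : R -> R) (la lb : R) :
  (forall t, 0 < t -> is_derive F t (f t)) ->
  (forall t, 0 < t -> continuous f t) ->
  filterlim F (at_right 0) (locally la) ->
  filterlim F (Rbar_locally p_infty) (locally lb) ->
  is_RInt_gen f (at_right 0) (Rbar_locally p_infty) (lb - la).
Proof.
intros Hd Hc H0 Hi.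
assert (Hpos : filter_prod (at_right 0) (Rbar_locally p_infty)
  (fun ab => 0 < fst ab /\ 0 < snd ab)).
{ apply (Filter_prod _ _ _ (fun x => 0 < x) (fun x => 0 < x)).
  - exists (mkposreal 1 Rlt_0_1). intros y _ Hy. exact Hy.
  - exists 0. auto.
  - simpl. auto. }
assert (Hmin : forall ab : R * R, 0 < fst ab /\ 0 < snd ab -> forall x,
  Rmin (fst ab) (snd ab) <= x -> 0 < x).
{ intros ab [H1 H2] x Hx. eapply Rlt_le_trans; [|apply Hx]. apply Rmin_pos; auto. }
apply (is_RInt_gen_ext (Derive F) f).
- revert Hpos. apply filter_imp. intros ab Hab x Hx.
  apply is_derive_unique, Hd. apply (Hmin ab Hab). lra.
- apply (is_RInt_gen_Derive F la lb); auto.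
  + revert Hpos. apply filter_imp. intros ab Hab x Hx. exists (f x).
    apply Hd, (Hmin ab Hab). lra.
  + revert Hpos. apply filter_imp. intros ab Hab x Hx.
    assert (Hx0 : 0 < x) by (apply (Hmin ab Hab); lra).
    apply (continuous_ext_loc _ f); [|apply Hc; auto].
    exists (mkposreal x Hx0). intros y Hy. symmetry. apply is_derive_unique, Hd.
    unfold ball in Hy; simpl in Hy; unfold AbsRing_ball, abs, minus, plus, opp in Hy; simpl in Hy.
    apply Rabs_def2 in Hy. lra.
Qed.

Definition Gauss (y : R) : R := RInt (fun u => exp (- u ^ 2)) 0 y.

Lemma continuous_gauss u : continuous (fun u => exp (- u ^ 2)) u.
Proof. apply ex_derive_continuous_R. auto_derive; auto. Qed.

Lemma Gauss_deriv y : is_derive Gauss y (exp (- y ^ 2)).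
Proof.
apply (is_derive_RInt (fun u => exp (- u ^ 2)) Gauss 0 y).
- apply filter_forall. intros z. apply (RInt_correct (V := R_CompleteNormedModule)).
  apply ex_RInt_cont, continuous_gauss.
- apply continuous_gauss.
Qed.

Lemma Gauss_0 : Gauss 0 = 0.
Proof. apply (RInt_point (V := R_CompleteNormedModule)). Qed.

Lemma Gauss_scale y : Gauss y = y * RInt (fun t => exp (- (y * t) ^ 2)) 0 1.
Proof.
unfold Gauss.
assert (H := RInt_comp_lin (V := R_CompleteNormedModule) (fun u => exp (- u ^ 2)) y 0 0 1).
rewrite Rmult_0_r, Rplus_0_l, Rmult_1_r, Rplus_0_r in H.
rewrite <- H by (apply ex_RInt_cont, continuous_gauss).
rewrite <- (RInt_scal (V := R_CompleteNormedModule)).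
- apply RInt_ext. intros t _. rewrite Rplus_0_r. reflexivity.
- apply ex_RInt_cont. intros t. apply ex_derive_continuous_R.
  auto_derive; auto.
Qed.

(** The classical companion of the Gaussian integral: Gauss^2 + gauss_aux is constant. *)
Definition gauss_aux (y : R) : R := RInt (fun t => exp (- (y ^ 2 * (1 + t ^ 2))) / (1 + t ^ 2)) 0 1.

Lemma gauss_aux_deriv y : is_derive gauss_aux y (- 2 * exp (- y ^ 2) * Gauss y).
Proof.
assert (HD : forall u v, is_derive (fun z => exp (- (z ^ 2 * (1 + v ^ 2))) / (1 + v ^ 2)) u
  (- 2 * u * exp (- (u ^ 2 * (1 + v ^ 2))))).
{ intros u v. assert (0 < 1 + v * (v * 1)) by nra. auto_derive; [auto|]. simpl. field. lra. }
replace (- 2 * exp (- y ^ 2) * Gauss y) with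
  (RInt (fun v => Derive (fun u => exp (- (u ^ 2 * (1 + v ^ 2))) / (1 + v ^ 2)) y) 0 1).
- apply is_derive_RInt_param.
  + apply filter_forall. intros u v _. eexists; apply HD.
  + intros v _. apply continuity_2d_pt_ext with
      (fun u v => - 2 * u * exp (- (u ^ 2 * (1 + v ^ 2)))).
    { intros u w. symmetry. apply is_derive_unique, HD. }
    assert (Hsq : forall g, continuity_2d_pt g y v -> continuity_2d_pt (fun u v => g u v ^ 2) y v).
    { intros g Hg. apply continuity_2d_pt_ext with (fun u v => g u v * g u v);
        [intros; ring | apply continuity_2d_pt_mult; auto]. }
    apply continuity_2d_pt_mult.
    * apply continuity_2d_pt_mult; [apply continuity_2d_pt_const | apply continuity_2d_pt_id1].
    * apply (continuity_1d_2d_pt_comp exp (fun u v => - (u ^ 2 * (1 + v ^ 2)))).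
      -- apply derivable_continuous_pt, derivable_pt_exp.
      -- apply continuity_2d_pt_opp, continuity_2d_pt_mult.
         ++ apply (Hsq (fun u v => u)), continuity_2d_pt_id1.
         ++ apply continuity_2d_pt_plus; [apply continuity_2d_pt_const|].
            apply (Hsq (fun u v => v)), continuity_2d_pt_id2.
  + apply filter_forall. intros u. apply ex_RInt_cont. intros v.
    apply ex_derive_continuous_R.
    assert (0 < 1 + v * (v * 1)) by nra. auto_derive. lra.
- rewrite Gauss_scale, <- Rmult_assoc.
  rewrite <- (RInt_scal (V := R_CompleteNormedModule)).
  + apply RInt_ext. intros v _. etransitivity; [apply is_derive_unique, HD|].
    unfold scal; simpl; unfold mult; simpl.
    transitivity (- 2 * y * (exp (- (y * (y * 1))) * exp (- (y * v * (y * v * 1))))); [|ring].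
    rewrite <- exp_plus. do 2 f_equal. ring.
  + apply ex_RInt_cont. intros t. apply ex_derive_continuous_R.
    auto_derive; auto.
Qed.

Lemma gauss_aux_0 : gauss_aux 0 = PI / 4.
Proof.
unfold gauss_aux. rewrite <- atan_1.
replace (atan 1) with (atan 1 - atan 0) by (rewrite atan_0; ring).
apply is_RInt_unique. apply is_RInt_deriv; [lra| |].
- intros t _. apply is_derive_Reals.
  replace (exp (- (0 ^ 2 * (1 + t ^ 2))) / (1 + t ^ 2)) with (/ (1 + t ^ 2)).
  + apply derivable_pt_lim_atan.
  + replace (- (0 ^ 2 * (1 + t ^ 2))) with 0 by ring. rewrite exp_0. field. nra.
- intros t _. apply ex_derive_continuous_R.
  assert (0 < 1 + t * (t * 1)) by nra. auto_derive. lra.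
Qed.

Lemma Gauss_square y : 0 <= y -> Gauss y ^ 2 + gauss_aux y = PI / 4.
Proof.
intros Hy. rewrite <- gauss_aux_0.
replace (gauss_aux 0) with (Gauss 0 ^ 2 + gauss_aux 0) by (rewrite Gauss_0; ring).
assert (HD : forall t, is_derive (fun t => Gauss t ^ 2 + gauss_aux t) t 0).
{ intros t. assert (D1 := Gauss_deriv t). assert (D2 := gauss_aux_deriv t).
  auto_derive.
  - split; [eexists; eauto|]. split; [eexists; eauto|]. auto.
  - rewrite (is_derive_unique (fun x : R => Gauss x) _ _ D1),
      (is_derive_unique (fun x : R => gauss_aux x) _ _ D2). simpl. ring. }
apply Rle_antisym.
- apply (mean_value_le (fun t => Gauss t ^ 2 + gauss_aux t) (fun _ => 0) 0 y); auto. intros; lra.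
- apply Ropp_le_cancel.
  apply (mean_value_le (fun t => - (Gauss t ^ 2 + gauss_aux t)) (fun _ => 0) 0 y); auto.
  + intros t _. replace 0 with (opp 0) by (unfold opp; simpl; ring).
    apply (is_derive_opp (fun t => Gauss t ^ 2 + gauss_aux t)), HD.
  + intros; lra.
Qed.

Lemma gauss_aux_bound y : 0 <= gauss_aux y <= exp (- y ^ 2).
Proof.
assert (Hc : forall v, continuous (fun t => exp (- (y ^ 2 * (1 + t ^ 2))) / (1 + t ^ 2)) v).
{ intros v. apply ex_derive_continuous_R.
  assert (0 < 1 + v * (v * 1)) by nra. auto_derive. lra. }
assert (Hb : forall t, 0 <= exp (- (y ^ 2 * (1 + t ^ 2))) / (1 + t ^ 2) <= exp (- y ^ 2)).
{ intros t. assert (0 < 1 + t ^ 2) by (assert (H := pow2_ge_0 t); lra).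
  split; [apply Rdiv_le_0_compat; auto; left; apply exp_pos|].
  apply (Rle_div_l _ _ (1 + t ^ 2)); auto.
  assert (H1 : exp (- (y ^ 2 * (1 + t ^ 2))) <= exp (- y ^ 2)).
  { apply exp_mono. assert (H2 := pow2_ge_0 (y * t)). simpl in *. nra. }
  assert (H2 := exp_pos (- y ^ 2)). assert (H3 := pow2_ge_0 t). nra. }
unfold gauss_aux. split.
- apply (RInt_ge_0 (fun t => exp (- (y ^ 2 * (1 + t ^ 2))) / (1 + t ^ 2)) 0 1); [lra| |].
  + apply ex_RInt_cont, Hc.
  + intros t _. apply Hb.
- replace (exp (- y ^ 2)) with (RInt (fun _ => exp (- y ^ 2)) 0 1).
  + apply RInt_le; [lra| | |].
    * apply ex_RInt_cont, Hc.
    * apply ex_RInt_const.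
    * intros t _. apply Hb.
  + rewrite RInt_const. unfold scal; simpl; unfold mult; simpl. ring.
Qed.

Lemma Gauss_lim : filterlim Gauss (Rbar_locally p_infty) (locally (sqrt PI / 2)).
Proof.
assert (HG : forall y, 0 <= y -> 0 <= Gauss y).
{ intros y Hy. apply (RInt_ge_0 (fun u => exp (- u ^ 2)) 0 y); auto.
  - apply ex_RInt_cont, continuous_gauss.
  - intros; left; apply exp_pos. }
assert (Hp := PI_RGT_0). assert (Hsp := sqrt_lt_R0 _ Hp). assert (Hss := sqrt_sqrt PI ltac:(lra)).
apply (is_lim_spec Gauss p_infty (sqrt PI / 2)). intros eps. unfold Rbar_locally'.
assert (Heps := cond_pos eps).
set (e := eps * sqrt PI / 2). assert (He : 0 < e) by (unfold e; nra).
exists (Rmax 1 (/ e)). intros y Hy.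
assert (H1 := Rmax_l 1 (/ e)). assert (H2 := Rmax_r 1 (/ e)).
assert (HS := Gauss_square y ltac:(lra)). assert (HB := gauss_aux_bound y).
assert (HGy := HG y ltac:(lra)).
assert (Hex : exp (- y ^ 2) < e).
{ rewrite exp_Ropp. apply Rlt_le_trans with (/ y); [|].
  - apply Rinv_lt_contravar.
    + apply Rmult_lt_0_compat; [lra | apply exp_pos].
    + assert (H := exp_ineq1 (y ^ 2) ltac:(simpl; nra)). simpl in *. nra.
  - rewrite <- (Rinv_inv e). apply Rinv_le_contravar; [apply Rinv_0_lt_compat; auto | lra]. }
assert (HF : (sqrt PI / 2 - Gauss y) * (sqrt PI / 2 + Gauss y) = gauss_aux y) by nra.
assert (Hd : 0 <= sqrt PI / 2 - Gauss y) by nra.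
rewrite Rabs_left1 by lra.
assert ((sqrt PI / 2 - Gauss y) * (sqrt PI / 2) < eps * (sqrt PI / 2)).
{ apply Rle_lt_trans with (gauss_aux y); [nra|]. unfold e in *. lra. }
nra.
Qed.

Definition is_Euler (x v : R) : Prop :=
  is_RInt_gen (fun t => Rpower t (x - 1) * exp (- t)) (at_right 0) (Rbar_locally p_infty) v.

Lemma is_Euler_unique x v : is_Euler x v -> Euler_integral x = v.
Proof.
unfold is_Euler, Euler_integral. intros H.
exact (is_RInt_gen_unique (V := R_CompleteNormedModule) _ _ H).
Qed.

Lemma is_derive_Rpower x t : 0 < t -> is_derive (fun t => Rpower t x) t (x * Rpower t (x - 1)).
Proof. intros Ht. apply is_derive_Reals, derivable_pt_lim_power; auto. Qed.

Lemma continuous_Euler_integrand x t : 0 < t ->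
  continuous (fun t => Rpower t x * exp (- t)) t.
Proof.
intros Ht. apply (continuous_mult (fun t => Rpower t x) (fun t => exp (- t))).
- apply ex_derive_continuous_R. eexists; apply is_derive_Rpower; auto.
- apply ex_derive_continuous_R. auto_derive; auto.
Qed.

(** The substitution t = u^2. *)
Lemma is_Euler_half : is_Euler (1 / 2) (sqrt PI).
Proof.
unfold is_Euler. replace (sqrt PI) with (sqrt PI - 0) by ring.
apply (is_RInt_gen_half_line (fun t => 2 * Gauss (sqrt t))).
- intros t Ht. assert (D := Gauss_deriv (sqrt t)). auto_derive.
  + split; auto. eexists; eauto.
  + rewrite (is_derive_unique (fun x : R => Gauss x) _ _ D).
    rewrite pow2_sqrt by lra.
    replace (1 / 2 - 1) with (- (/ 2)) by field.
    rewrite Rpower_Ropp, Rpower_sqrt by auto. field. apply Rgt_not_eq, sqrt_lt_R0; auto.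
- intros t Ht. apply continuous_Euler_integrand; auto.
- replace 0 with (2 * Gauss (sqrt 0)) at 2 by (rewrite sqrt_0, Gauss_0; ring).
  apply (filterlim_filter_le_1 (F := locally 0)).
  + intros P HP. apply filter_le_within, HP.
  + apply (continuous_scal_r 2 (fun t => Gauss (sqrt t))).
    apply (continuous_comp sqrt Gauss).
    * apply continuity_pt_filterlim, continuity_pt_sqrt. lra.
    * apply ex_derive_continuous_R. eexists; apply Gauss_deriv.
- replace (sqrt PI) with (2 * (sqrt PI / 2)) by field.
  apply (filterlim_comp _ _ _ (fun t => Gauss (sqrt t)) (fun v => 2 * v) _ (locally (sqrt PI / 2))).
  + apply (filterlim_comp _ _ _ sqrt Gauss _ (Rbar_locally p_infty)); [|apply Gauss_lim].
    apply filterlim_sqrt_p.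
  + apply (ex_derive_continuous_R (fun v => 2 * v)). auto_derive; auto.
Qed.

Lemma filterlim_opp_0 : filterlim Ropp (locally 0) (locally (- 0)).
Proof.
apply (ex_derive_continuous_R (fun v => - v)). auto_derive; auto.
Qed.

Lemma is_Euler_1 : is_Euler 1 1.
Proof.
cut (is_RInt_gen (fun t => Rpower t (1 - 1) * exp (- t)) (at_right 0)
  (Rbar_locally p_infty) (0 - - (1))).
{ intros H. replace (0 - - (1)) with 1 in H by ring. exact H. }
apply (is_RInt_gen_half_line (fun t => - exp (- t))).
- intros t Ht. replace (1 - 1) with 0 by ring. rewrite Rpower_O by auto.
  auto_derive; auto. ring.
- intros t Ht. apply continuous_Euler_integrand; auto.
- replace (- (1)) with (- exp (- 0)) by (rewrite Ropp_0, exp_0; ring).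
  apply (filterlim_filter_le_1 (F := locally 0)).
  + intros P HP. apply filter_le_within, HP.
  + apply (ex_derive_continuous_R (fun t => - exp (- t))). auto_derive; auto.
- replace 0 with (- 0) by ring.
  apply (filterlim_comp _ _ _ (fun t => exp (- t)) Ropp _ (locally 0)).
  + apply (filterlim_comp _ _ _ Ropp exp _ (Rbar_locally m_infty)).
    * apply (is_lim_opp (fun t => t) p_infty p_infty), is_lim_id.
    * apply is_lim_exp_m.
  + apply filterlim_opp_0.
Qed.

(** Comparison of exp t with the term t^(n+1) / (n+1)! of its series, for an integer n > x. *)
Lemma Rpower_exp_lim x : filterlim (fun t => Rpower t x * exp (- t)) (Rbar_locally p_infty) (locally 0).
Proof.
destruct (INR_unbounded x) as [n Hn].
apply (is_lim_spec (fun t => Rpower t x * exp (- t)) p_infty 0). intros eps. unfold Rbar_locally'.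
assert (Heps := cond_pos eps). assert (Hf := INR_fact_lt_0 (S n)).
exists (Rmax 1 (INR (fact (S n)) / eps)). intros t Ht.
assert (H1 := Rmax_l 1 (INR (fact (S n)) / eps)). assert (H2 := Rmax_r 1 (INR (fact (S n)) / eps)).
assert (Hp : 0 < Rpower t x) by apply exp_pos. assert (He := exp_pos (- t)).
rewrite Rminus_0_r, Rabs_right by nra.
assert (Hle : Rpower t x <= t ^ n).
{ rewrite <- Rpower_pow by lra. apply Rle_Rpower; lra. }
assert (H3 := pow_fact_le_exp (S n) t ltac:(lra)).
assert (Htn : 0 < t ^ n) by (apply pow_lt; lra).
assert (E : exp t * exp (- t) = 1) by (rewrite <- exp_plus, Rplus_opp_r; apply exp_0).
assert (H4 : t * (t ^ n * exp (- t)) <= INR (fact (S n))).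
{ apply (Rmult_le_compat_r (INR (fact (S n)) * exp (- t))) in H3; [|nra].
  replace (exp t * (INR (fact (S n)) * exp (- t))) with
    (INR (fact (S n)) * (exp t * exp (- t))) in H3 by ring.
  rewrite E in H3.
  replace (t ^ S n / INR (fact (S n)) * (INR (fact (S n)) * exp (- t))) with
    (t * (t ^ n * exp (- t))) in H3 by (simpl pow; field; lra). lra. }
assert (H5 : INR (fact (S n)) < eps * t).
{ assert (H6 : INR (fact (S n)) / eps < t) by lra. apply Rlt_div_l in H6; lra. }
apply Rle_lt_trans with (t ^ n * exp (- t)); [nra|].
apply Rmult_lt_reg_l with t; lra.
Qed.

Lemma Rpower_exp_lim_0 x : 0 < x ->
  filterlim (fun t => Rpower t x * exp (- t)) (at_right 0) (locally 0).
Proof.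
intros Hx. replace 0 with (0 * exp (- 0)) at 2 by ring.
apply (filterlim_comp_2 (fun t => Rpower t x) (fun t => exp (- t)) Rmult
  (G := locally 0) (H := locally (exp (- 0)))).
- apply (filterlim_comp _ _ _ (fun t => x * ln t) exp _ (Rbar_locally m_infty)); [|apply is_lim_exp_m].
  apply (filterlim_comp _ _ _ ln (fun y => x * y) _ (Rbar_locally m_infty)); [apply is_lim_ln_0|].
  assert (H := is_lim_scal_l (fun y => y) x m_infty m_infty (is_lim_id m_infty)).
  replace (Rbar_mult x m_infty) with m_infty in H; [exact H|].
  simpl. destruct (Rle_dec 0 x) as [h|h]; [|lra].
  destruct (Rle_lt_or_eq_dec 0 x h); [reflexivity | lra].
- apply (filterlim_filter_le_1 (F := locally 0)).
  + intros P HP. apply filter_le_within, HP.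
  + apply (ex_derive_continuous_R (fun t => exp (- t))). auto_derive; auto.
- apply (filterlim_mult (K := R_AbsRing) 0 (exp (- 0))).
Qed.

(** Integration by parts. *)
Lemma is_Euler_succ x v : 0 < x -> is_Euler x v -> is_Euler (x + 1) (x * v).
Proof.
intros Hx H. unfold is_Euler in *.
assert (H1 : is_RInt_gen (fun t => Rpower t x * exp (- t) - x * (Rpower t (x - 1) * exp (- t)))
  (at_right 0) (Rbar_locally p_infty) (- 0 - - 0)).
{ apply (is_RInt_gen_half_line (fun t => - (Rpower t x * exp (- t)))).
  - intros t Ht. assert (D := is_derive_Rpower x t Ht).
    apply is_derive_ext with (fun t => Rpower t x * - exp (- t)).
    { intros s. as_real_equation. ring. }
    replace (Rpower t x * exp (- t) - x * (Rpower t (x - 1) * exp (- t))) with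
      (x * Rpower t (x - 1) * - exp (- t) + Rpower t x * exp (- t)) by ring.
    apply (is_derive_mult (fun t => Rpower t x) (fun t => - exp (- t))); auto.
    + auto_derive; auto. ring.
    + intros; apply Rmult_comm.
  - intros t Ht.
    apply (continuous_minus (fun t => Rpower t x * exp (- t))
      (fun t => x * (Rpower t (x - 1) * exp (- t)))).
    + apply continuous_Euler_integrand; auto.
    + apply (continuous_scal_r x (fun t => Rpower t (x - 1) * exp (- t))).
      apply continuous_Euler_integrand; auto.
  - apply (filterlim_comp _ _ _ _ Ropp _ (locally 0)); [apply Rpower_exp_lim_0; auto|].
    apply filterlim_opp_0.
  - apply (filterlim_comp _ _ _ _ Ropp _ (locally 0)); [apply Rpower_exp_lim|].
    apply filterlim_opp_0. }
assert (H2 := is_RInt_gen_plus _ _ _ _ H1 (is_RInt_gen_scal _ x _ H)).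
replace (x * v) with (plus (- 0 - - 0) (scal x v))
  by (unfold plus, scal; simpl; unfold mult; simpl; ring).
revert H2. apply is_RInt_gen_ext. apply filter_forall. intros ab t _.
replace (x + 1 - 1) with x by ring. unfold plus, scal; simpl; unfold mult; simpl. ring.
Qed.

(** The rising factorial (1/2)_m. *)
Fixpoint half_rising (m : nat) : R :=
  match m with
  | O => 1
  | S i => (INR i + 1 / 2) * half_rising i
  end.

Lemma is_Euler_half_integer m : is_Euler (INR m + 1 / 2) (sqrt PI * half_rising m).
Proof.
induction m.
- simpl. rewrite Rplus_0_l, Rmult_1_r. apply is_Euler_half.
- rewrite S_INR. replace (INR m + 1 + 1 / 2) with (INR m + 1 / 2 + 1) by ring.
  replace (sqrt PI * half_rising (S m)) with ((INR m + 1 / 2) * (sqrt PI * half_rising m))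
    by (simpl; ring).
  apply is_Euler_succ; auto. assert (H := pos_INR m). lra.
Qed.

Lemma is_Euler_integer m : is_Euler (INR m + 1) (INR (fact m)).
Proof.
induction m.
- simpl. rewrite Rplus_0_l. apply is_Euler_1.
- rewrite S_INR, fact_simpl, mult_INR, S_INR.
  apply is_Euler_succ; auto. assert (H := pos_INR m). lra.
Qed.

Lemma Gamma_half_integer m : Gamma (INR m + 1 / 2) = sqrt PI * half_rising m.
Proof.
rewrite Gamma_pos by (assert (H := pos_INR m); lra). apply is_Euler_unique, is_Euler_half_integer.
Qed.

Lemma Gamma_integer m : Gamma (INR m + 1) = INR (fact m).
Proof.
rewrite Gamma_pos by (assert (H := pos_INR m); lra). apply is_Euler_unique, is_Euler_integer.
Qed.

Lemma rising_left x n : rising x (S n) = x * rising (x + 1) n.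
Proof.
induction n; [simpl; ring|].
change (rising x (S (S n))) with (rising x (S n) * (x + INR (S n))).
rewrite IHn, S_INR. simpl. ring.
Qed.

Lemma rising_half m : rising (1 / 2 - INR m) m = (-1) ^ m * half_rising m.
Proof.
induction m; [simpl; ring|].
rewrite rising_left. replace (1 / 2 - INR (S m) + 1) with (1 / 2 - INR m) by (rewrite S_INR; ring).
rewrite IHm, S_INR. simpl. field.
Qed.

(** The shift by m brings the argument to 1/2. *)
Lemma rGamma_half_integer m : rGamma (1 / 2 - INR m) = (-1) ^ m * half_rising m / sqrt PI.
Proof.
assert (Hs : Gamma_shift (1 / 2 - INR m) = m).
{ unfold Gamma_shift. replace (up (- (1 / 2 - INR m))) with (Z.of_nat m); [apply Nat2Z.id|].
  apply tech_up; rewrite <- INR_IZR_INZ; lra. }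
unfold rGamma. rewrite Hs, rising_half.
replace (1 / 2 - INR m + INR m) with (INR 0 + 1 / 2) by (simpl; ring).
rewrite (is_Euler_unique _ _ (is_Euler_half_integer 0)). simpl. rewrite Rmult_1_r. reflexivity.
Qed.

Lemma odd_coefficient m :
  Gamma (INR m + 5 / 2) * Gamma (INR m + 1 / 2) / Gamma (2 * INR m + 2) =
  PI * (half_rising (m + 2) * half_rising m / INR (fact (2 * m + 1))).
Proof.
replace (INR m + 5 / 2) with (INR (m + 2) + 1 / 2) by (rewrite plus_INR; simpl; field).
replace (2 * INR m + 2) with (INR (2 * m + 1) + 1)
  by (rewrite plus_INR, mult_INR; simpl; ring).
rewrite !Gamma_half_integer, Gamma_integer.
replace PI with (sqrt PI * sqrt PI) at 3 by (apply sqrt_sqrt; left; apply PI_RGT_0).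
field. apply INR_fact_neq_0.
Qed.

Lemma full_coefficient_odd m :
  Gamma (INR (2 * m + 1) / 2 + 2) * rGamma (1 - INR (2 * m + 1) / 2) / Gamma (INR (2 * m + 1) + 1) =
  (-1) ^ m * (half_rising (m + 2) * half_rising m / INR (fact (2 * m + 1))).
Proof.
replace (INR (2 * m + 1) / 2 + 2) with (INR (m + 2) + 1 / 2)
  by (rewrite !plus_INR, mult_INR; simpl; field).
replace (1 - INR (2 * m + 1) / 2) with (1 / 2 - INR m)
  by (rewrite !plus_INR, mult_INR; simpl; field).
rewrite Gamma_half_integer, Gamma_integer, rGamma_half_integer.
assert (Hs := sqrt_lt_R0 _ PI_RGT_0). field. split; [apply INR_fact_neq_0 | lra].

Qed.

Lemma full_coefficient_0 : Gamma (INR 0 / 2 + 2) * rGamma (1 - INR 0 / 2) / Gamma (INR 0 + 1) = 1.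
Proof.
replace (INR 0 / 2 + 2) with (INR 1 + 1) by (simpl; field).
replace (1 - INR 0 / 2) with (INR 0 + 1) by (simpl; field).
rewrite rGamma_Rinv, !Gamma_integer. simpl. field.
Qed.

Lemma full_coefficient_even m :
  Gamma (INR (2 * S m) / 2 + 2) * rGamma (1 - INR (2 * S m) / 2) / Gamma (INR (2 * S m) + 1) = 0.
Proof.
replace (1 - INR (2 * S m) / 2) with (- INR m) by (rewrite mult_INR, (S_INR m); simpl; field).
rewrite rGamma_pole. unfold Rdiv. ring.
Qed.

(** * The two series of the theorem *)

(** The terms of the two series for a real or imaginary part with derivatives p at 0. *)
Definition odd_real (p : nat -> R) (m : nat) (q : R) : R :=
  (-1) ^ m * (Gamma (INR m + 5 / 2) * Gamma (INR m + 1 / 2) / Gamma (2 * INR m + 2))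
  * p (2 * m + 1)%nat * / (q / 2) ^ (2 * m).

Definition full_real (p : nat -> R) (k : nat) (q : R) : R :=
  Gamma (INR k / 2 + 2) * rGamma (1 - INR k / 2) / Gamma (INR k + 1) * p k * / (q / 2) ^ k.

(** Splitting off the last factor instead of the first keeps k fixed in inductions on j. *)
Lemma double_ratio_right k j :
  double_ratio k (S j) = double_ratio k j * (INR (k + 2 * j) / INR (S (k + 2 * j))).
Proof.
revert k; induction j; intros k.
- cbn [double_ratio]. rewrite Nat.mul_0_r, Nat.add_0_r. ring.
- change (double_ratio k (S (S j))) with (INR k / INR (S k) * double_ratio (S (S k)) (S j)).
  change (double_ratio k (S j)) with (INR k / INR (S k) * double_ratio (S (S k)) j).
  rewrite IHj. replace (S (S k) + 2 * j)%nat with (k + 2 * S j)%nat by lia. ring.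
Qed.

(** The products of Gamma values and the coefficients produced by the recurrence start with
    the same value and have the same quotient of consecutive terms. *)
Lemma half_rising_double_ratio m :
  4 ^ (m + 1) * (half_rising (m + 2) * half_rising m / INR (fact (2 * m + 1))) =
  (2 * INR m + 3) * double_ratio 1 m.
Proof.
induction m; [simpl; field|].
rewrite double_ratio_right.
replace (2 * S m + 1)%nat with (S (S (2 * m + 1))) by lia.
replace (S m + 2)%nat with (S (m + 2)) by lia.
cbn [half_rising]. rewrite !fact_simpl, !mult_INR.
replace (INR (1 + 2 * m)) with (2 * INR m + 1) by (rewrite plus_INR, mult_INR; simpl; ring).
replace (INR (S (1 + 2 * m))) with (2 * INR m + 2) by (rewrite S_INR, plus_INR, mult_INR; simpl; ring).
replace (INR (S (2 * m + 1))) with (2 * INR m + 2) by (rewrite S_INR, plus_INR, mult_INR; simpl; ring).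
replace (INR (S (S (2 * m + 1)))) with (2 * INR m + 3) by (rewrite !S_INR, plus_INR, mult_INR; simpl; ring).
rewrite S_INR, plus_INR. replace (INR 2) with 2 by (simpl; ring).
replace (4 ^ (S m + 1)) with (4 * 4 ^ (m + 1)) by (simpl; ring).
assert (Hm := pos_INR m). assert (Hf := INR_fact_lt_0 (2 * m + 1)).
transitivity (4 ^ (m + 1) * (half_rising (m + 2) * half_rising m / INR (fact (2 * m + 1))) *
  ((2 * INR m + 5) * (2 * INR m + 1) / ((2 * INR m + 3) * (2 * INR m + 2)))); [field; lra|].
rewrite IHm. field. lra.
Qed.

Lemma odd_real_eq p m q : q <> 0 ->
  odd_real p m q = (-1) ^ m * PI * ((2 * INR m + 3) * double_ratio 1 m) / 4
    * p (2 * m + 1)%nat / q ^ (2 * m).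
Proof.
intros Hq. unfold odd_real. rewrite odd_coefficient, <- half_rising_double_ratio.
replace ((q / 2) ^ (2 * m)) with (q ^ (2 * m) / 4 ^ m).
- rewrite pow_add. simpl (4 ^ 1).
  assert (q ^ (2 * m) <> 0) by (apply pow_nonzero; auto).
  assert (4 ^ m <> 0) by (apply pow_nonzero; lra).
  field. repeat split; auto. apply INR_fact_neq_0.
- unfold Rdiv. rewrite Rpow_mult_distr, !pow_inv, (pow_mult 2).
  replace (2 ^ 2) with 4 by ring. reflexivity.
Qed.

Lemma odd_real_hankel_term p m q : q <> 0 ->
  4 / (PI * q ^ 3) * odd_real p m q = - / q * hankel_term q p 1 m.
Proof.
intros Hq. rewrite odd_real_eq by auto. unfold hankel_term.
replace (INR (1 + 2 * m) + 2) with (2 * INR m + 3) by (rewrite plus_INR, mult_INR; simpl; ring).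
replace (1 + 2 * m)%nat with (2 * m + 1)%nat by lia.
rewrite pow_add.
assert (q ^ (2 * m) <> 0) by (apply pow_nonzero; auto). assert (Hp := PI_RGT_0).
field. repeat split; auto; lra.
Qed.

Lemma full_real_0 p q : full_real p 0 q = p 0%nat.
Proof. unfold full_real. rewrite full_coefficient_0. simpl. field. Qed.

Lemma full_real_even p m q : full_real p (2 * S m) q = 0.
Proof. unfold full_real. rewrite full_coefficient_even. ring. Qed.

Lemma full_real_odd p m q : q <> 0 ->
  full_real p (2 * m + 1) q = 2 / (PI * q) * odd_real p m q.
Proof.
intros Hq. unfold full_real, odd_real. rewrite full_coefficient_odd, odd_coefficient, pow_add.
assert ((q / 2) ^ (2 * m) <> 0).
{ apply pow_nonzero. intros H. apply Hq. lra. }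
assert (Hp := PI_RGT_0). field. repeat split; auto; try lra. apply INR_fact_neq_0.
Qed.

Lemma odd_real_bound p K a b q m :
  0 < a -> 0 < b <= q -> (forall k, Rabs (p k) <= K * a ^ k) ->
  Rabs (odd_real p m q) <= PI * K * a * ((INR m + 1) * ((a / b) ^ 2) ^ m).
Proof.
intros Ha Hb Hp. assert (Hpi := PI_RGT_0).
assert (HK : 0 <= K).
{ specialize (Hp 0%nat). assert (H0 := Rabs_pos (p 0%nat)). simpl in Hp. lra. }
rewrite odd_real_eq by lra.
destruct (double_ratio_bound 1 m) as [Hw0 Hw1]. assert (Hm := pos_INR m).
assert (Hqm : 0 < q ^ (2 * m)) by (apply pow_lt; lra).
assert (Hbm : 0 < b ^ (2 * m)) by (apply pow_lt; lra).
unfold Rdiv. rewrite !Rabs_mult, pow_1_abs, !Rabs_inv.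
rewrite (Rabs_right PI), (Rabs_right (2 * INR m + 3)), (Rabs_right (double_ratio 1 m)),
  (Rabs_right 4), (Rabs_right (q ^ (2 * m))) by lra.
apply Rle_trans with (1 * PI * ((2 * INR m + 3) * 1) * / 4 * (K * a ^ (2 * m + 1)) * / b ^ (2 * m)).
- assert (Hqi : 0 < / q ^ (2 * m)) by (apply Rinv_0_lt_compat; auto).
  apply Rmult_le_compat; [|lra| |].
  + apply Rmult_le_pos; [|apply Rabs_pos]. apply Rmult_le_pos; [|lra].
    apply Rmult_le_pos; [lra|]. apply Rmult_le_pos; lra.
  + apply Rmult_le_compat; [|apply Rabs_pos| |apply Hp].
    * apply Rmult_le_pos; [|lra]. apply Rmult_le_pos; [lra|]. apply Rmult_le_pos; lra.
    * apply Rmult_le_compat_r; [lra|]. apply Rmult_le_compat_l; [lra|].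
      apply Rmult_le_compat_l; lra.
  + apply Rinv_le_contravar; auto. apply pow_incr; lra.
- replace (((a * / b) ^ 2) ^ m) with (a ^ (2 * m) / b ^ (2 * m)).
  2:{ rewrite <- pow_mult, Rpow_mult_distr, pow_inv. reflexivity. }
  rewrite pow_add. simpl (a ^ 1).
  assert (Ham : 0 < a ^ (2 * m)) by (apply pow_lt; lra).
  replace (1 * PI * ((2 * INR m + 3) * 1) * / 4 * (K * (a ^ (2 * m) * (a * 1))) * / b ^ (2 * m))
    with ((PI * K * a * (a ^ (2 * m) / b ^ (2 * m))) * ((2 * INR m + 3) / 4)) by (field; lra).
  replace (PI * K * a * ((INR m + 1) * (a ^ (2 * m) / b ^ (2 * m)))) with
    ((PI * K * a * (a ^ (2 * m) / b ^ (2 * m))) * (INR m + 1)) by ring.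
  apply Rmult_le_compat_l; [|lra].
  apply Rmult_le_pos; [|apply Rdiv_le_0_compat; lra].
  apply Rmult_le_pos; [|lra]. apply Rmult_le_pos; lra.
Qed.

(** The coefficient at an odd k is (k + 2) / 2^(k+1) times a double_ratio, which is at most 1;
    the powers of 2 cancel those of q / 2. *)
Lemma full_real_bound p K a b q k :
  0 < a -> 0 < b <= q -> (forall k, Rabs (p k) <= K * a ^ k) ->
  Rabs (full_real p k q) <= 2 * K * ((INR k + 1) * (a / b) ^ k).
Proof.
intros Ha Hb Hp. assert (Hpi := PI_RGT_0).
assert (HK : 0 <= K).
{ specialize (Hp 0%nat). assert (H0 := Rabs_pos (p 0%nat)). simpl in Hp. lra. }
assert (Hab : 0 < a / b) by (apply Rdiv_lt_0_compat; lra).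
destruct (Nat.Even_or_Odd k) as [[m Hm]|[m Hm]]; subst k.
- assert (Hpos : 0 <= 2 * K * ((INR (2 * m) + 1) * (a / b) ^ (2 * m))).
  { apply Rmult_le_pos; [lra|]. apply Rmult_le_pos; [|apply pow_le; lra].
    assert (H := pos_INR (2 * m)). lra. }
  destruct m as [|m].
  + rewrite Nat.mul_0_r, full_real_0. specialize (Hp 0%nat). simpl in *. lra.
  + rewrite full_real_even, Rabs_R0. auto.
- rewrite full_real_odd by lra. rewrite Rabs_mult.
  rewrite (Rabs_right (2 / (PI * q))).
  2:{ apply Rle_ge, Rdiv_le_0_compat; [lra|]. apply Rmult_lt_0_compat; lra. }
  assert (H := odd_real_bound p K a b q m Ha Hb Hp). assert (Hm := pos_INR m).
  assert (Hpq : 0 < 2 / (PI * q)) by (apply Rdiv_lt_0_compat; [lra|apply Rmult_lt_0_compat; lra]).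
  apply Rle_trans with (2 / (PI * b) * (PI * K * a * ((INR m + 1) * ((a / b) ^ 2) ^ m))).
  + apply Rmult_le_compat; [lra|apply Rabs_pos| |auto].
    apply Rmult_le_compat_l; [lra|]. apply Rinv_le_contravar.
    * apply Rmult_lt_0_compat; lra.
    * apply Rmult_le_compat_l; lra.
  + rewrite pow_add, <- pow_mult, plus_INR, mult_INR. simpl (INR 1). simpl (INR 2).
    simpl ((a / b) ^ 1).
    assert (Hx : 0 < (a / b) ^ (2 * m)) by (apply pow_lt; lra).
    replace (2 / (PI * b) * (PI * K * a * ((INR m + 1) * (a / b) ^ (2 * m)))) with
      (2 * K * ((INR m + 1) * ((a / b) ^ (2 * m) * (a / b * 1)))) by (field; lra).
    apply Rmult_le_compat_l; [lra|]. apply Rmult_le_compat_r; [|lra].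
    apply Rmult_le_pos; lra.
Qed.

Lemma ex_series_linear_geom c t : 0 < t < 1 -> ex_series (fun m => c * ((INR m + 1) * t ^ m)).
Proof.
intros Ht. apply ex_series_scal_l_R.
destruct (linear_le_geometric t ((1 + t) / 2) ltac:(lra)) as [d [Hd Hn]].
apply (ex_series_le (V := R_CompleteNormedModule)) with (fun m => d * ((1 + t) / 2) ^ m).
- intros m. change (Rabs ((INR m + 1) * t ^ m) <= d * ((1 + t) / 2) ^ m).
  rewrite Rabs_right; auto. apply Rle_ge, Rmult_le_pos; [|apply pow_le; lra].
  assert (H := pos_INR m). lra.
- apply ex_series_scal_l_R, ex_series_geom.
  rewrite Rabs_right; lra.
Qed.

Lemma ratio_lt_1 a b : 0 < a < b -> 0 < a / b < 1.
Proof. intros H. split; [apply Rdiv_lt_0_compat | apply Rlt_div_l]; lra. Qed.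

Lemma odd_real_ex_series p K a q : 0 < a < q -> (forall k, Rabs (p k) <= K * a ^ k) ->
  ex_series (fun m => odd_real p m q).
Proof.
intros Ha Hp. assert (Ht := ratio_lt_1 a q Ha).
apply (ex_series_le (V := R_CompleteNormedModule)) with
  (fun m => PI * K * a * ((INR m + 1) * ((a / q) ^ 2) ^ m)).
- intros m. apply (odd_real_bound p K a q q); auto; lra.
- apply ex_series_linear_geom. split; [apply pow_lt; lra | simpl; nra].
Qed.

Lemma full_real_ex_series p K a q : 0 < a < q -> (forall k, Rabs (p k) <= K * a ^ k) ->
  ex_series (fun m => full_real p m q).
Proof.
intros Ha Hp.
apply (ex_series_le (V := R_CompleteNormedModule)) with
  (fun k => 2 * K * ((INR k + 1) * (a / q) ^ k)).
- intros m. apply (full_real_bound p K a q q); auto; lra.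
- apply ex_series_linear_geom, ratio_lt_1; auto.
Qed.

(** The even terms of positive index vanish at the poles of Gamma. *)
Lemma Series_full_real p K a q : 0 < a < q -> (forall k, Rabs (p k) <= K * a ^ k) ->
  Series (fun k => full_real p k q) =
  p 0%nat + 2 / (PI * q) * Series (fun m => odd_real p m q).
Proof.
intros Ha Hp.
assert (Hsum : forall n, sum_n (fun k => full_real p k q) (2 * n + 1) =
  p 0%nat + 2 / (PI * q) * sum_n (fun m => odd_real p m q) n).
{ induction n.
  - change (2 * 0 + 1)%nat with 1%nat. rewrite sum_Sn, !sum_O, full_real_0.
    change (full_real p 1 q) with (full_real p (2 * 0 + 1) q).
    rewrite full_real_odd by lra. reflexivity.
  - replace (2 * S n + 1)%nat with (S (S (2 * n + 1))) by lia.
    rewrite !sum_Sn, IHn.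
    replace (S (2 * n + 1)) with (2 * S n)%nat by lia.
    replace (S (2 * S n)) with (2 * S n + 1)%nat by lia.
    rewrite full_real_even, full_real_odd by lra. unfold plus; simpl. ring. }
assert (L1 := Series_correct _ (full_real_ex_series p K a q Ha Hp)).
assert (L2 := Series_correct _ (odd_real_ex_series p K a q Ha Hp)).
assert (L3 : is_lim_seq (fun n => sum_n (fun k => full_real p k q) (2 * n + 1))
  (Series (fun k => full_real p k q))).
{ apply (is_lim_seq_subseq (sum_n (fun k => full_real p k q)) _ (fun n => (2 * n + 1)%nat)).
  - apply eventually_subseq. intros n. lia.
  - exact L1. }
assert (L4 : is_lim_seq (fun n => p 0%nat + 2 / (PI * q) * sum_n (fun m => odd_real p m q) n)
  (p 0%nat + 2 / (PI * q) * Series (fun m => odd_real p m q))).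
{ apply is_lim_seq_plus'; [apply is_lim_seq_const|].
  apply (is_lim_seq_scal_l _ (2 / (PI * q)) (Series (fun m => odd_real p m q))), L2. }
apply is_lim_seq_unique in L3. apply is_lim_seq_unique in L4.
rewrite (Lim_seq_ext _ _ Hsum), L4 in L3. injection L3; auto.
Qed.

Lemma hankel_value p K a q : 0 < a < q -> (forall k, Rabs (p k) <= K * a ^ k) ->
  2 * p 0%nat / q ^ 2 - hankel_coef q p 1 / q =
  2 / q ^ 2 * p 0%nat + 4 / (PI * q ^ 3) * Series (fun m => odd_real p m q).
Proof.
intros Ha Hp. rewrite <- Series_scal_l.
rewrite (Series_ext _ (fun m => - / q * hankel_term q p 1 m))
  by (intros; apply odd_real_hankel_term; lra).
rewrite Series_scal_l. fold (hankel_coef q p 1). field. lra.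
Qed.

(** * Componentwise limits of complex-valued quantities *)

Lemma filterlim_C {T : Type} (F : (T -> Prop) -> Prop) {FF : Filter F} (u v : T -> R) (l m : R) :
  filterlim u F (locally l) -> filterlim v F (locally m) ->
  filterlim (fun x => (u x, v x) : C) F (locally (T := C_R_NormedModule) (l, m)).
Proof.
intros Hu Hv P [eps HP].
assert (H1 : F (fun x => ball l eps (u x))) by (apply Hu; exists eps; auto).
assert (H2 : F (fun x => ball m eps (v x))) by (apply Hv; exists eps; auto).
unfold filtermap. generalize (filter_and _ _ H1 H2). apply filter_imp.
intros x [B1 B2]. apply HP. split; auto.
Qed.

Lemma filterlim_Re_Im {T : Type} (F : (T -> Prop) -> Prop) {FF : Filter F} (u : T -> C) (l : C) :
  filterlim u F (locally (T := C_R_NormedModule) l) ->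
  filterlim (fun x => Re (u x)) F (locally (Re l)) /\
  filterlim (fun x => Im (u x)) F (locally (Im l)).
Proof.
intros Hu. split; intros P [eps HP];
  (assert (H : F (fun x => ball (M := C_R_NormedModule) l eps (u x)))
    by (apply Hu; exists eps; auto));
  unfold filtermap; revert H; apply filter_imp; intros x [B1 B2]; apply HP; auto.
Qed.

Lemma sum_n_Re_Im (a : nat -> C) n :
  sum_n (G := C_R_NormedModule) a n =
  (sum_n (fun k => Re (a k)) n, sum_n (fun k => Im (a k)) n).
Proof.
induction n; [rewrite !sum_O; apply C_ext; reflexivity|].
rewrite !sum_Sn, IHn. reflexivity.
Qed.

Lemma is_series_Re_Im (a : nat -> C) (l : C) :
  is_series (K := R_AbsRing) (V := C_R_NormedModule) a l ->
  is_series (fun k => Re (a k)) (Re l) /\ is_series (fun k => Im (a k)) (Im l).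
Proof.
intros H. apply (filterlim_Re_Im eventually) in H. destruct H as [H1 H2]. split.
- apply (filterlim_ext (fun n => Re (sum_n (G := C_R_NormedModule) a n))); [|exact H1].
  intros n. rewrite sum_n_Re_Im. reflexivity.
- apply (filterlim_ext (fun n => Im (sum_n (G := C_R_NormedModule) a n))); [|exact H2].
  intros n. rewrite sum_n_Re_Im. reflexivity.
Qed.

Lemma Cseries_correct (a : nat -> C) (B : nat -> R) : Cdominated a B ->
  is_series (K := R_AbsRing) (V := C_R_NormedModule) a (Cseries a).
Proof.
intros Hd. destruct (Cdominated_ex _ _ Hd) as [H1 H2].
apply (filterlim_ext (fun n => (sum_n (fun k => Re (a k)) n, sum_n (fun k => Im (a k)) n) : C)).
- intros n. symmetry. apply sum_n_Re_Im.
- apply (filterlim_C eventually); apply Series_correct; auto.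
Qed.

Lemma Cseries_remainder (a : nat -> C) (B : nat -> R) n : Cdominated a B ->
  Cmod (sum_n (G := C_R_NormedModule) a n - Cseries a) <= Series B - sum_n B n.
Proof.
intros Hd.
assert (Hsh : forall m, Cdominated (fun j => a (S m + j)%nat) (fun j => B (S m + j)%nat)).
{ intros m. destruct Hd as [H1 H2]. split; [|intros; apply H2].
  apply (ex_series_incr_n (V := R_NormedModule) B (S m)), H1. }
assert (E : Cseries a = (sum_n (G := C_R_NormedModule) a n + Cseries (fun j => a (S n + j)%nat))%C).
{ induction n.
  - rewrite sum_O. apply (Cseries_incr_1 a B Hd).
  - rewrite sum_Sn, IHn. rewrite (Cseries_incr_1 _ _ (Hsh n)), Cplus_assoc.
    rewrite Nat.add_0_r. f_equal.
    unfold Cseries; f_equal; apply Series_ext; intros j; do 2 f_equal; lia. }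
rewrite E. match goal with |- Cmod ?t <= _ => replace t with
  (- Cseries (fun j => a (S n + j)%nat))%C by ring end.
rewrite Cmod_opp. eapply Rle_trans; [apply (Cseries_bound _ _ (Hsh n))|].
destruct Hd as [H1 _]. rewrite (Series_incr_n B (S n)) by (auto; lia).
simpl pred. rewrite sum_n_Reals. apply Req_le. ring.
Qed.

(** The remainder is bounded by that of the dominating series, whatever q. *)
Lemma unif_cv_dominated (u : nat -> R -> C) (B : nat -> R) (D : R -> Prop) :
  (forall q, D q -> Cdominated (fun k => u k q) B) ->
  unif_cv_series u (fun q => Cseries (fun k => u k q)) D.
Proof.
intros HD eps.
destruct (classic (exists q, D q)) as [[q0 H0]|Hn].
- destruct (HD q0 H0) as [HB _]. apply Series_correct in HB.
  assert (Hl : is_lim_seq (fun n => Series B - sum_n B n) 0).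
  { replace (Finite 0) with (Rbar_minus (Series B) (Series B))
      by (simpl; f_equal; ring).
    apply is_lim_seq_minus'; [apply is_lim_seq_const | exact HB]. }
  apply is_lim_seq_spec in Hl. specialize (Hl eps). revert Hl. apply filter_imp.
  intros n Hn q Hq. eapply Rle_lt_trans; [apply (Cseries_remainder _ B n (HD q Hq))|].
  rewrite Rminus_0_r in Hn. eapply Rle_lt_trans; [apply Rle_abs | exact Hn].
- apply filter_forall. intros n q Hq. exfalso. apply Hn. exists q; auto.
Qed.

Lemma is_RInt_gen_0_infty (g I : R -> C) (l : C) :
  (forall X, 0 <= X -> is_RInt (V := C_R_NormedModule) g 0 X (I X)) ->
  filterlim I (Rbar_locally p_infty) (locally (T := C_R_NormedModule) l) ->
  is_RInt_gen (V := C_R_NormedModule) g (at_point 0) (Rbar_locally p_infty) l.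
Proof.
intros Hg HI P HP.
apply (Filter_prod _ _ _ (fun x => x = 0) (fun X => 0 <= X /\ P (I X))).
- reflexivity.
- apply filter_and.
  + exists 0. intros; lra.
  + apply HI, HP.
- intros x X -> [HX HPX]. exists (I X). simpl. auto.
Qed.

(** The growth condition at s = k. *)
Lemma Derive_nC_bound (f : R -> C) (phi : C -> C) (delta K a : R) :
  0 < a -> 0 < delta ->
  (forall k : nat, phi (RtoC (INR k)) = g_der f k 0) ->
  (forall s : C, - delta <= Re s -> Cmod (phi s) < K * Rpower a (Re s)) ->
  forall k, Cmod (Derive_nC f k 0) <= K * a ^ k.
Proof.
intros Ha Hd Hi Hg k. assert (Hk := pos_INR k).
assert (H := Hg (RtoC (INR k))). rewrite Hi in H. unfold g_der in H.
rewrite Cmod_mult, Cmod_R, pow_1_abs, Rmult_1_l in H.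
replace (Re (RtoC (INR k))) with (INR k) in H by reflexivity.
rewrite Rpower_pow in H by auto. left. apply H. lra.
Qed.

Lemma taylor_egf (f : R -> C) (x : R) :
  is_series (K := R_AbsRing) (V := C_R_NormedModule)
    (fun k : nat => (g_der f k 0 / RtoC (INR (fact k)) * RtoC ((- x) ^ k))%C) (f x) ->
  Re (f x) = egf (fun k => Re (Derive_nC f k 0)) x /\
  Im (f x) = egf (fun k => Im (Derive_nC f k 0)) x.
Proof.
intros H. apply is_series_Re_Im in H. destruct H as [H1 H2].
assert (E : forall k, (g_der f k 0 / RtoC (INR (fact k)) * RtoC ((- x) ^ k))%C =
  (RtoC (x ^ k / INR (fact k)) * Derive_nC f k 0)%C).
{ intros k. unfold g_der. replace (x ^ k) with ((-1) ^ k * (- x) ^ k).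
  - unfold Rdiv. rewrite !RtoC_mult, RtoC_inv by apply INR_fact_neq_0.
    unfold Cdiv. ring.
  - rewrite <- Rpow_mult_distr. f_equal. ring. }
split; symmetry; unfold egf, PSeries.
- rewrite <- (is_series_unique _ _ H1). apply Series_ext. intros k. rewrite E.
  unfold Re, Cmult, RtoC; cbn [fst snd]. unfold Rdiv; ring.
- rewrite <- (is_series_unique _ _ H2). apply Series_ext. intros k. rewrite E.
  unfold Im, Cmult, RtoC; cbn [fst snd]. unfold Rdiv; ring.
Qed.

Lemma decay_component (h : R -> R) :
  filterlim (fun x => sqrt x * h x) (Rbar_locally p_infty) (locally 0) ->
  forall eps, 0 < eps -> exists X, forall x, X <= x -> sqrt x * Rabs (h x) <= eps.
Proof.
intros H eps Heps.
apply (is_lim_spec (fun x => sqrt x * h x) p_infty 0) in H.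
destruct (H (mkposreal eps Heps)) as [X HX]. exists (X + 1). intros x Hx.
assert (H1 := HX x ltac:(lra)). simpl in H1. rewrite Rminus_0_r, Rabs_mult in H1.
rewrite (Rabs_right (sqrt x)) in H1 by (apply Rle_ge, sqrt_pos). lra.
Qed.

Lemma odd_term_eq f m q : odd_term f m q =
  (odd_real (fun k => Re (Derive_nC f k 0)) m q, odd_real (fun k => Im (Derive_nC f k 0)) m q).
Proof.
unfold odd_term, odd_real. apply C_ext; unfold Re, Im, Cmult, RtoC; cbn [fst snd]; ring.
Qed.

Lemma full_term_eq f k q : full_term f k q =
  (full_real (fun k => Re (Derive_nC f k 0)) k q, full_real (fun k => Im (Derive_nC f k 0)) k q).
Proof.
unfold full_term, full_real. apply C_ext; unfold Re, Im, Cmult, RtoC; cbn [fst snd]; ring.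
Qed.

Theorem theorem3 (f : R -> C) (phi : C -> C) (delta K a : R)
  (f_not_even : exists x : R, f (- x) <> f x)
  (f_analytic_0 : analytic_at (K := R_AbsRing) (V := C_R_NormedModule) f 0)
  (f_taylor : forall x : R,
     is_series (K := R_AbsRing) (V := C_R_NormedModule)
       (fun k : nat =>
          (g_der f k 0 / RtoC (INR (fact k)) * RtoC ((- x) ^ k))%C)
       (f x))
  (f_decay : filterlim (fun x : R => (RtoC (sqrt x) * f x)%C)
     (Rbar_locally p_infty) (locally (RtoC 0)))
  (delta_bounds : 3 / 4 < delta < 1)
  (a_pos : 0 < a)
  (phi_interpolates : forall k : nat, phi (RtoC (INR k)) = g_der f k 0)
  (phi_analytic : forall s : C, - delta <= Re s ->
     analytic_at (K := C_AbsRing) (V := C_NormedModule) phi s)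
  (phi_growth : forall s : C, - delta <= Re s ->
     Cmod (phi s) < K * Rpower a (Re s)) :
  exists S_odd S_full : R -> C,
    (forall q : R, a < q ->
       hankel_converges 2 f q /\
       hankel 2 f q =
         (RtoC (2 / q ^ 2) * f 0 + RtoC (4 / (PI * q ^ 3)) * S_odd q)%C /\
       hankel 2 f q = (RtoC (2 / q ^ 2) * S_full q)%C /\
       is_series (K := R_AbsRing) (V := C_R_NormedModule)
         (fun m : nat => odd_term f m q) (S_odd q) /\
       is_series (K := R_AbsRing) (V := C_R_NormedModule)
         (fun k : nat => full_term f k q) (S_full q) /\
       abs_cv_series (odd_term f) q /\
       abs_cv_series (full_term f) q) /\
    (forall b : R, a < b ->
       unif_cv_series (odd_term f) S_odd (fun q : R => b <= q) /\
       unif_cv_series (full_term f) S_full (fun q : R => b <= q)).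
Proof.
set (pR := fun k => Re (Derive_nC f k 0)). set (pI := fun k => Im (Derive_nC f k 0)).
assert (Hd := Derive_nC_bound f phi delta K a a_pos ltac:(lra) phi_interpolates phi_growth).
assert (HR : forall k, Rabs (pR k) <= K * a ^ k)
  by (intros k; eapply Rle_trans; [apply re_le_Cmod | apply Hd]).
assert (HI : forall k, Rabs (pI k) <= K * a ^ k)
  by (intros k; eapply Rle_trans; [apply Im_le_Cmod | apply Hd]).
assert (Hf : forall x, f x = (egf pR x, egf pI x)).
{ intros x. destruct (taylor_egf f x (f_taylor x)). apply C_ext; auto. }
assert (Hpi := PI_RGT_0).
assert (Hodd : forall b q, a < b <= q -> Cdominated (fun m => odd_term f m q)
  (fun m => 2 * (PI * K * a) * ((INR m + 1) * ((a / b) ^ 2) ^ m))).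
{ intros b q Hb. assert (Ht := ratio_lt_1 a b ltac:(lra)). split.
  - apply ex_series_linear_geom. split; [apply pow_lt; lra | simpl; nra].
  - intros m. eapply Rle_trans; [apply Cmod_le_Re_Im|]. rewrite odd_term_eq. cbn [Re Im fst snd].
    assert (H1 := odd_real_bound pR K a b q m a_pos ltac:(lra) HR).
    assert (H2 := odd_real_bound pI K a b q m a_pos ltac:(lra) HI). unfold pR, pI in *. lra. }
assert (Hfull : forall b q, a < b <= q -> Cdominated (fun k => full_term f k q)
  (fun k => 2 * (2 * K) * ((INR k + 1) * (a / b) ^ k))).
{ intros b q Hb. split.
  - apply ex_series_linear_geom, ratio_lt_1; lra.
  - intros m. eapply Rle_trans; [apply Cmod_le_Re_Im|]. rewrite full_term_eq. cbn [Re Im fst snd].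
    assert (H1 := full_real_bound pR K a b q m a_pos ltac:(lra) HR).
    assert (H2 := full_real_bound pI K a b q m a_pos ltac:(lra) HI). unfold pR, pI in *. lra. }
exists (fun q => Cseries (fun m => odd_term f m q)), (fun q => Cseries (fun k => full_term f k q)).
split.
2:{ intros b Hb. split; (eapply unif_cv_dominated; intros q Hq; [apply (Hodd b) || apply (Hfull b)]; auto). }
intros q Hq.
assert (Eodd : Cseries (fun m => odd_term f m q) =
  (Series (fun m => odd_real pR m q), Series (fun m => odd_real pI m q))).
{ unfold Cseries. f_equal; apply Series_ext; intros m; rewrite odd_term_eq; reflexivity. }
assert (Efull : Cseries (fun m => full_term f m q) =
  (Series (fun m => full_real pR m q), Series (fun m => full_real pI m q))).
{ unfold Cseries. f_equal; apply Series_ext; intros m; rewrite full_term_eq; reflexivity. }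
set (value := fun p : nat -> R => 2 / q ^ 2 * p 0%nat +
  4 / (PI * q ^ 3) * Series (fun m => odd_real p m q)).
assert (Hex : forall p, (forall k, Rabs (p k) <= K * a ^ k) -> exp_type a p).
{ intros p Hp. exists K. split; [lra | auto]. }
assert (Hlim : forall p, (forall k, Rabs (p k) <= K * a ^ k) ->
  filterlim (fun x => sqrt x * egf p x) (Rbar_locally p_infty) (locally 0) ->
  (forall X, 0 <= X -> is_RInt (fun x => x * BesselJ 2 (q * x) * egf p x) 0 X
     (RInt (fun x => x * BesselJ 2 (q * x) * egf p x) 0 X)) /\
  filterlim (fun X => RInt (fun x => x * BesselJ 2 (q * x) * egf p x) 0 X)
    (Rbar_locally p_infty) (locally (value p))).
{ intros p Hp Hdec. split.
  - intros X HX. apply (RInt_correct (V := R_CompleteNormedModule)).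
    eexists. apply (real_hankel_partial p a q ltac:(lra) (Hex p Hp) X HX).
  - unfold value. rewrite <- (hankel_value p K a q ltac:(lra) Hp).
    apply (real_hankel p a q ltac:(lra) (Hex p Hp)). apply decay_component; auto. }
destruct (filterlim_Re_Im _ _ _ f_decay) as [DR DI].
destruct (Hlim pR HR) as [IR LR].
{ revert DR. apply filterlim_ext. intros x. rewrite Hf.
  unfold Re, Cmult, RtoC; cbn [fst snd]. ring. }
destruct (Hlim pI HI) as [II LI].
{ revert DI. apply filterlim_ext. intros x. rewrite Hf.
  unfold Im, Cmult, RtoC; cbn [fst snd]. ring. }
assert (Hgen : is_RInt_gen (V := C_R_NormedModule) (hankel_integrand 2 f q)
  (at_point 0) (Rbar_locally p_infty) (value pR, value pI)).
{ apply (is_RInt_gen_0_infty _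
    (fun X => (RInt (fun x => x * BesselJ 2 (q * x) * egf pR x) 0 X,
               RInt (fun x => x * BesselJ 2 (q * x) * egf pI x) 0 X))).
  - intros X HX.
    apply (is_RInt_fct_extend_pair (hankel_integrand 2 f q) 0 X _ _).
    + revert IR. intros IR. apply (is_RInt_ext (fun x => x * BesselJ 2 (q * x) * egf pR x)); [|apply IR; auto].
      intros x _. unfold hankel_integrand. rewrite Hf. unfold Cmult, RtoC; cbn [fst snd].
      as_real_equation. ring.
    + apply (is_RInt_ext (fun x => x * BesselJ 2 (q * x) * egf pI x)); [|apply II; auto].
      intros x _. unfold hankel_integrand. rewrite Hf. unfold Cmult, RtoC; cbn [fst snd].
      as_real_equation. ring.
  - apply filterlim_C; auto. apply Rbar_locally_filter. }
assert (Hval : hankel 2 f q = (value pR, value pI)).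
{ unfold hankel. apply (is_RInt_gen_unique (V := C_R_CompleteNormedModule)), Hgen. }
assert (H0 : f 0 = (pR 0%nat, pI 0%nat)) by (rewrite Hf, !egf_0; reflexivity).
split; [|split; [|split; [|split; [|split; [|split]]]]].
- eexists; apply Hgen.
- rewrite Hval, Eodd, H0. unfold value.
  apply C_ext; unfold Re, Im, Cplus, Cmult, RtoC; cbn [fst snd]; ring.
- rewrite Hval, Efull, (Series_full_real pR K a q), (Series_full_real pI K a q) by (auto; lra).
  unfold value. apply C_ext; unfold Re, Im, Cmult, RtoC; cbn [fst snd]; field; lra.
- eapply Cseries_correct, (Hodd q); lra.
- eapply Cseries_correct, (Hfull q); lra.
- destruct (Hodd q q ltac:(lra)) as [H1 H2].
  apply (ex_series_le (V := R_CompleteNormedModule)) with (2 := H1). intros m.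
  change (Rabs (Cmod (odd_term f m q)) <= 2 * (PI * K * a) * ((INR m + 1) * ((a / q) ^ 2) ^ m)).
  rewrite Rabs_right by apply Rle_ge, Cmod_ge_0. apply H2.
- destruct (Hfull q q ltac:(lra)) as [H1 H2].
  apply (ex_series_le (V := R_CompleteNormedModule)) with (2 := H1). intros m.
  change (Rabs (Cmod (full_term f m q)) <= 2 * (2 * K) * ((INR m + 1) * (a / q) ^ m)).
  rewrite Rabs_right by apply Rle_ge, Cmod_ge_0. apply H2.
Qed.
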